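(* Let $T>0$, $M\in\mathbb{N}$, $\Delta t=T/M$, and let $\{(x_n^m,v_n^m)\}_{1\le n\le N,\,0\le m\le M}$ be the particles produced by the Monte Carlo algorithm described in the context. For $\phi\in\Phi=C_c^\infty(\mathbb{R}^{d_x}\times\Omega)$ let $$\mathsf{e}_{N,\phi}^M=\frac1N\sum_{n=1}^N\phi(x_n^M,v_n^M)-\int_{\mathbb{R}^{d_x}}\int_\Omega f(T,x,v)\,\phi(x,v)\,\mathrm{d}v\,\mathrm{d}x .$$ Then for any $\phi\in\Phi$, the error $\mathsf{e}_{N,\phi}^M$: (i) is first order in time in expectation: $$\mathbb{E}\big|\mathsf{e}_{N,\phi}^M\big|=\mathcal{O}(\Delta t);$$ (ii) has an exponential concentration bound in $N$: for all $\epsilon>0$, $$\mathbb{P}\big(|\mathsf{e}_{N,\phi}^M|\ge \epsilon+\Delta t\big)\lesssim\exp\!\big(-N\epsilon^2\big).$$ Here $\mathcal{O}$ and $\lesssim$ hide a constant that depends on $T$, the initial condition $f_{\mathrm{in}}$ and $\phi$ (and on the fixed data $\sigma$, $\Omega$), but does not depend on $M$ and $\Delta t$.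
   Context: Radiative transfer equation: $\Omega$ is a bounded velocity domain with measure $0<|\Omega|<\infty$, $\sigma:\mathbb{R}^{d_x}\to[0,\infty)$ belongs to $W^{1,\infty}(\mathbb{R}^{d_x})$, and $f(t,x,v)$ is the solution of $$\partial_t f+v\cdot\nabla_x f=\sigma(x)\mathcal{L}[f],\quad f(0,x,v)=f_{\mathrm{in}}(x,v),\qquad x\in\mathbb{R}^{d_x},\ v\in\Omega,$$ where $\mathcal{L}[f]=\frac1{|\Omega|}\int_\Omega f\,\mathrm{d}v-f$. The initial datum $f_{\mathrm{in}}$ is a probability density on $\mathbb{R}^{d_x}\times\Omega$ (nonnegative, total mass $1$) with finite norm $\|f_{\mathrm{in}}\|_{W^{2,\infty}_xL^\infty_v}$ (sup norm of $x$-derivatives up to order 2). Monte Carlo algorithm: draw $N$ independent samples $(x_n^0,v_n^0)$, $n=1,\dots,N$, from $f_{\mathrm{in}}$. For $m=0,\dots,M-1$ and each $n$: set $x_n^{m+1}=x_n^m+\Delta t\,v_n^m$; draw $p_n^{m+1}$ uniformly from $[0,1]$; if $p_n^{m+1}\ge \exp(-\sigma(x_n^{m+1})\Delta t)$, set $v_n^{m+1}=\eta_n^{m+1}$ with $\eta_n^{m+1}$ drawn uniformly from $\Omega$; otherwise set $v_n^{m+1}=v_n^m$. All random draws are mutually independent. $\mathbb{E}$ and $\mathbb{P}$ refer to all this randomness (initial samples and all $p_n^m$, $\eta_n^m$).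
   Formalization: As stated (i) fails for fixed N (e.g. σ=0) and (ii) fails when φ is scaled up; proved instead: |E e| ≤ CΔt, E|e| ≤ C(Δt+N^{-1/2}), and P(|e| ≥ ε+CΔt) ≤ C exp(−Nε²/C), with C independent of M, N, Δt, ε. *)

(* Defs.v *)
From HB Require Import structures.
From mathcomp Require Import all_boot all_order all_algebra.
From mathcomp Require Import all_classical all_reals all_analysis.

Set Implicit Arguments.
Unset Strict Implicit.
Unset Printing Implicit Defensive.

Import Order.TTheory GRing.Theory Num.Theory.
Import numFieldNormedType.Exports.

Local Open Scope classical_set_scope.
Local Open Scope ring_scope.

(* The library has a Borel structure on R but none on R^n: 'rV[R]_n receives  *)
(* the sigma-algebra generated by the coordinates, which is its Borel one.    *)
Section measurable_row_vector.
Context {R : realType} (n : nat).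

Let coord (i : 'I_n) (x : 'rV[R]_n) : measurableTypeR R := x ord0 i.

Let row0 : g_sigma_preimage coord set0.
Proof. exact: sigma_algebra0. Qed.

Let rowC A : g_sigma_preimage coord A -> g_sigma_preimage coord (~` A).
Proof. exact: sigma_algebraC. Qed.

Let row_bigcup (F : _^nat) : (forall i, g_sigma_preimage coord (F i)) ->
  g_sigma_preimage coord (\bigcup_i (F i)).
Proof. exact: sigma_algebra_bigcup. Qed.

Fact row_display : measure_display. Proof. exact: default_measure_display. Qed.

HB.instance Definition _ := @isMeasurable.Build row_display
  'rV[R]_n (g_sigma_preimage coord) row0 rowC row_bigcup.

Lemma measurable_coord (i : 'I_n) :
  measurable_fun [set: 'rV[R]_n] (fun x => x ord0 i : measurableTypeR R).
Proof.
move=> _ Y mY; rewrite setTI; apply: sub_sigma_algebra => /=.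
rewrite -bigcup_seq/=; exists i => /=; first by rewrite mem_index_enum.
by exists Y => //; rewrite setTI.
Qed.

Lemma measurable_rowP d (T : measurableType d) (f : T -> 'rV[R]_n) :
  (forall i, measurable_fun [set: T] (fun t => f t ord0 i : measurableTypeR R)) ->
  measurable_fun [set: T] f.
Proof.
move=> mf.
apply: (@measurability _ _ T 'rV[R]_n setT f
  (\big[setU/set0]_(i < n) preimage_set_system setT (coord i) measurable)) => //.
move=> _ [A + <-]; rewrite -bigcup_seq/= => -[i _ [B mB <-]].
by rewrite !setTI -comp_preimage -[X in measurable X]setTI; exact: mf.
Qed.

End measurable_row_vector.

Section lebesgue_step.
Context {R : realType} (n : nat).

Definition row_cons (p : measurableTypeR R * 'rV[R]_n) : 'rV[R]_n.+1 :=
  row_mx (const_mx p.1 : 'rV_1) p.2.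

Let row_uncons (x : 'rV[R]_n.+1) : measurableTypeR R * 'rV[R]_n :=
  (x ord0 ord0, \row_i x ord0 (lift ord0 i)).

Lemma row_consE0 p : row_cons p ord0 ord0 = p.1.
Proof. by rewrite mxE; case: splitP => // j _; rewrite mxE. Qed.

Lemma row_consES p i : row_cons p ord0 (lift ord0 i) = p.2 ord0 i.
Proof.
rewrite mxE; case: splitP => j /=; first by case: j => -[].
by rewrite /bump /= !add1n => -[/val_inj ->].
Qed.

Lemma measurable_row_cons : measurable_fun setT row_cons.
Proof.
apply: measurable_rowP => i; case: (unliftP ord0 i) => [j|] ->.
  under [X in measurable_fun _ X]eq_fun do rewrite row_consES.
  exact: (measurableT_comp (measurable_coord j) measurable_snd).
under [X in measurable_fun _ X]eq_fun do rewrite row_consE0.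
exact: measurable_fst.
Qed.

HB.instance Definition _ :=
  isMeasurableFun.Build _ _ _ _ row_cons measurable_row_cons.

Let row_consK : cancel row_cons row_uncons.
Proof.
move=> p; rewrite /row_uncons row_consE0 [RHS]surjective_pairing; congr pair.
by apply/rowP => i; rewrite mxE row_consES.
Qed.

Let row_unconsK : cancel row_uncons row_cons.
Proof.
move=> x; apply/rowP => i; case: (unliftP ord0 i) => [j|] ->.
  by rewrite row_consES mxE.
by rewrite row_consE0.
Qed.

Let measurable_row_uncons : measurable_fun setT row_uncons.
Proof.
apply/measurable_fun_pairP; split; first exact: measurable_coord.
apply: measurable_rowP => i.
under [X in measurable_fun _ X]eq_fun do rewrite /= mxE.
exact: measurable_coord.
Qed.

Variable mu : {sigma_finite_measure set 'rV[R]_n -> \bar R}.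

Definition lebesgue_step :=
  pushforward (@lebesgue_measure R \x mu)%E row_cons.

Let lebesgue_step0 : lebesgue_step set0 = 0%E.
Proof. exact: measure0. Qed.

Let lebesgue_step_ge0 A : (0 <= lebesgue_step A)%E.
Proof. exact: measure_ge0. Qed.

Let lebesgue_step_sigma_additive : semi_sigma_additive lebesgue_step.
Proof. exact: measure_semi_sigma_additive. Qed.

HB.instance Definition _ := isMeasure.Build _ _ _ lebesgue_step
  lebesgue_step0 lebesgue_step_ge0 lebesgue_step_sigma_additive.

Let lebesgue_step_sigma_finite : sigma_finite setT lebesgue_step.
Proof.
have /sigma_finiteP[F [TF ndF Foo]] :=
  sigma_finiteT (@lebesgue_measure R : {sigma_finite_measure set _ -> \bar R}).
have /sigma_finiteP[G [TG ndG Goo]] := sigma_finiteT mu.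
exists (fun k => row_uncons @^-1` (F k `*` G k)).
  rewrite -preimage_bigcup -(preimage_setT row_uncons); congr (_ @^-1` _).
  apply/esym/seteqP; split=> // -[x y] _.
  have [i _ Fx] : (\bigcup_i F i) x by rewrite -TF.
  have [j _ Gy] : (\bigcup_j G j) y by rewrite -TG.
  exists (maxn i j) => //; split => /=.
    by move: x Fx; exact/subsetPset/ndF/leq_maxl.
  by move: y Gy; exact/subsetPset/ndG/leq_maxr.
move=> k; have [mF Fk] := Foo k; have [mG Gk] := Goo k; split.
  rewrite -[X in measurable X]setTI; apply: measurable_row_uncons => //.
  exact: measurableX.
rewrite /lebesgue_step /pushforward -comp_preimage.
rewrite (_ : row_uncons \o row_cons = id) ?preimage_id; last first.
  exact/funext/row_consK.
by rewrite product_measure1E// lte_mul_pinfty// ge0_fin_numE.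
Qed.

HB.instance Definition _ :=
  Measure_isSigmaFinite.Build _ _ _ lebesgue_step lebesgue_step_sigma_finite.

End lebesgue_step.

(* Lebesgue measure on R^n, as an iterated product: R^0 is a point of mass 1. *)
Fixpoint lebesgue_row (R : realType) (n : nat) :
    {sigma_finite_measure set 'rV[R]_n -> \bar R} :=
  match n with
  | 0 => \d_(0 : 'rV[R]_0)
  | n'.+1 => lebesgue_step (lebesgue_row R n')
  end.

Section test_functions.
Context {R : realType}.

Definition iter_derive (V : normedModType R) (hs : seq V) (g : V -> R) : V -> R :=
  foldr (fun h k => 'D_h k) g hs.

Definition smooth (V : normedModType R) (g : V -> R) :=
  forall hs : seq V, continuous (iter_derive hs g) /\
    forall h x, derivable (iter_derive hs g) x h.

Definition fsupport (V : normedModType R) (g : V -> R) : set V :=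
  closure [set x | g x != 0].

(* C_c^oo(D) for D open, each function being extended by 0 outside of D. *)
Definition test_function (V : normedModType R) (D : set V) (g : V -> R) :=
  [/\ smooth g, compact (fsupport g) & fsupport g `<=` D].

End test_functions.

Section sobolev.
Context {R : realType} (n : nat).
Local Notation V := 'rV[R]_n.
Local Notation lambda := (lebesgue_row R n).

Definition Linfty d (T : measurableType d) (mu : {measure set T -> \bar R})
    (D : set T) (u : T -> R) :=
  measurable_fun D (u : T -> measurableTypeR R) /\
  exists C : R, {ae mu, forall z, D z -> `|u z| <= C}.

(* g is the weak derivative of u along the coordinates listed in s. *)
Definition weak_derivative (s : seq 'I_n) (u g : V -> R) :=
  forall psi : V -> R, test_function setT psi ->
    \int[lambda]_x (u x * iter_derive [seq delta_mx ord0 i | i <- s] psi x) =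
    (-1) ^+ size s * \int[lambda]_x (g x * psi x).

Definition W_infty (k : nat) (u : V -> R) :=
  Linfty lambda setT u /\
  forall s : seq 'I_n, (size s <= k)%N ->
    exists2 g : V -> R, Linfty lambda setT g & weak_derivative s u g.

Definition W_infty_Linfty (k : nat) (Omega : set V) (u : V -> V -> R) :=
  let D := [set: V] `*` Omega in
  Linfty (lambda \x lambda)%E D (fun z => u z.1 z.2) /\
  forall s : seq 'I_n, (size s <= k)%N ->
    exists2 g : V -> V -> R,
      Linfty (lambda \x lambda)%E D (fun z => g z.1 z.2) &
      {ae lambda, forall v, Omega v -> weak_derivative s (u ^~ v) (g ^~ v)}.

Definition probability_density (Omega : set V) (u : V -> V -> R) :=
  (forall x v, Omega v -> 0 <= u x v) /\
  (\int[(lambda \x lambda)]_(z in [set: V] `*` Omega) (u z.1 z.2)%:E = 1)%E.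

End sobolev.

Section radiative_transfer.
Context {R : realType} (n : nat).
Local Notation V := 'rV[R]_n.
Local Notation lambda := (lebesgue_row R n).

Definition velocity_domain (Omega : set V) :=
  [/\ open Omega, bounded_set Omega & (0 < lambda Omega < +oo)%E].

Definition collision (Omega : set V) (g : V -> R) (v : V) : R :=
  (fine (lambda Omega))^-1 * \int[lambda]_(w in Omega) g w - g v.

(* The transport operator d/dt + v . grad_x is the derivative of f(., ., v)   *)
(* along the space-time direction (1, v). It is not split into partial        *)
(* derivatives: for sigma merely Lipschitz the solution need not have them at *)
(* every point, whereas this directional derivative always exists. Boundedness*)
(* makes the solution unique up to null sets.                                 *)
Record rte_solution (T : R) (Omega : set V) (sigma : V -> R) (fin : V -> V -> R)
    (f : R -> V -> V -> R) : Prop := {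
  rte_measurable : measurable_fun
    ([set z | [/\ 0 <= z.1.1, z.1.1 <= T & Omega z.2]]
      : set (measurableTypeR R * V * V))
    (fun z => f z.1.1 z.1.2 z.2 : measurableTypeR R);
  rte_bounded : exists B : R, forall t x v,
    0 <= t <= T -> Omega v -> `|f t x v| <= B;
  rte_initial : {ae (lambda \x lambda)%E, forall z : V * V,
    Omega z.2 -> f 0 z.1 z.2 = fin z.1 z.2};
  rte_continuous : forall x v, Omega v ->
    {within `[0, T], continuous (fun t : R => f t (x + t *: v) v)};
  rte_equation : forall t x v, 0 < t < T -> Omega v ->
    is_derive ((t : R^o), x) ((1 : R^o), v)
      (fun z : R^o * V => f z.1 z.2 v : R^o)
      (sigma x * collision Omega (f t x) v) }.

End radiative_transfer.

Section monte_carlo.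
Context {R : realType} (n : nat).
Local Notation V := 'rV[R]_n.
Local Notation lambda := (lebesgue_row R n).

(* State (x^m, v^m) of one particle started from z0; p m and eta m are the    *)
(* draws made in the step from m to m.+1, i.e. p^{m+1} and eta^{m+1}.         *)
Fixpoint particle (sigma : V -> R) (dt : R) (z0 : V * V) (p : nat -> R)
    (eta : nat -> V) (m : nat) : V * V :=
  match m with
  | 0 => z0
  | k.+1 =>
    let z := particle sigma dt z0 p eta k in
    let x := z.1 + dt *: z.2 in
    (x, if expR (- (sigma x * dt)) <= p k then eta k else z.2)
  end.

Section draws.
Context d (T : measurableType d) (P : probability T R) (N M : nat).

(* Mutual independence of the families of events F i. *)
Definition independent_events (I : finType) (F : I -> set (set T)) :=
  forall (J : {set I}) (E : I -> set T), (forall i, i \in J -> F i (E i)) ->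
    P (\bigcap_(i in [set` J]) E i) = (\prod_(i in J) P (E i))%E.

Variables (z0 : 'I_N -> T -> V * V) (p : 'I_N -> nat -> T -> R)
  (eta : 'I_N -> nat -> T -> V).

Definition generated_events d' (U : measurableType d') (X : T -> U) :
  set (set T) := preimage_set_system setT X measurable.

Definition draw_events
    (i : 'I_N + ('I_N * 'I_M + 'I_N * 'I_M)) : set (set T) :=
  match i with
  | inl j => generated_events (z0 j)
  | inr (inl (j, m)) => generated_events (p j m : T -> measurableTypeR R)
  | inr (inr (j, m)) => generated_events (eta j m)
  end.

Record monte_carlo_draws (Omega : set V) (fin : V -> V -> R) : Prop := {
  draws_measurable_init : forall j, measurable_fun setT (z0 j);
  draws_measurable_p : forall j (m : 'I_M),
    measurable_fun setT (p j m : T -> measurableTypeR R);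
  draws_measurable_eta : forall j (m : 'I_M), measurable_fun setT (eta j m);
  draws_init : forall j (A : set (V * V)), measurable A ->
    (P (z0 j @^-1` A) =
     \int[(lambda \x lambda)]_(z in A `&` ([set: V] `*` Omega))
        (fin z.1 z.2)%:E)%E;
  draws_p : forall j (m : 'I_M) (A : set (measurableTypeR R)), measurable A ->
    P (p j m @^-1` A) = uniform_prob (@ltr01 R) A;
  draws_eta : forall j (m : 'I_M) (A : set V), measurable A ->
    (P (eta j m @^-1` A) =
     lambda (A `&` Omega) * ((fine (lambda Omega))^-1)%:E)%E;
  draws_independent : independent_events draw_events }.

Definition monte_carlo_error (Tf : R) (Omega : set V) (sigma : V -> R)
    (f : R -> V -> V -> R) (phi : V * V -> R) (w : T) : R :=
  N%:R^-1 * (\sum_(j < N) phi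
     (particle sigma (Tf / M%:R) (z0 j w) (fun m => p j m w)
        (fun m => eta j m w) M)) -
  \int[lambda]_x \int[lambda]_(v in Omega) (f Tf x v * phi (x, v)).

End draws.
End monte_carlo.

(* Main.v *)
(** Write [Q] for the expected one-step update of an observable along the
    algorithm (free flight over [dt], then a collision with probability
    [1 - expR (- (sigma x * dt))]). Conditioning on the draws of the last step,
    over and over, turns the expectation of [phi] at the final state into the
    integral of [fin * Q^M phi]. On the other side, pair the solution at time [s]
    with [Q_(t'-s) g] along the characteristic [s |-> y + s v]: since the
    collision operator is symmetric for Lebesgue measure on [Omega], the
    first-order terms in the [s]-derivative of this pairing cancel, up to the
    oscillation of [sigma] and [g] over a distance of order [dt]. One step thus
    costs O(dt^2), and a telescoping sum over the [M] steps bounds the bias by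
    O(dt). Boundedness and Lipschitz continuity of [sigma] are recovered from its
    weak derivatives by testing them against smooth bumps.

    The particles are independent, so the centered empirical mean has moment
    generating function at most [expR (2 D^2 s^2 / N)]; Chernoff's bound gives the
    tail, and [x <= expR x] at the scale [s = sqrt N] gives the O(N^(-1/2)) mean
    absolute deviation. *)
Require Import Defs.
From HB Require Import structures.
From mathcomp Require Import all_boot all_order all_algebra.
From mathcomp Require Import all_classical all_reals all_analysis.
From mathcomp Require Import measurable_realfun ring lra.
Import Order.TTheory GRing.Theory Num.Theory.
Import numFieldNormedType.Exports.
Local Open Scope classical_set_scope.
Local Open Scope ring_scope.
Set Implicit Arguments.
Unset Strict Implicit.
Unset Printing Implicit Defensive.

(** * The Borel structure and Lebesgue measure on row vectors *)

(** The obstacle is regularity: [sigma] is only Lipschitz, and after one step the observable is only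
    known to be Lipschitz in [x], so neither can be differentiated. The length of the last flight is
    therefore tied to time. With [t' - s] left to fly, a particle at [y + s v] lands at [y + t' v]
    for every [s]: the rate and the observable are evaluated at a point that does not move, and only
    an exponential in [s] is differentiated. Phase-space Lebesgue measure is invariant under the
    shear [(x, v) |-> (x + s v, v)], which carries integrals along characteristics back to integrals
    at a fixed time. Uniformity in [M] rests on three quantities propagated by [Q]: the sup bound
    does not grow, the support radius grows by [vmax * dt], and the Lipschitz constant grows by
    adding a multiple of [dt]. Since [M * dt = T], all of them stay bounded by the data. *)

Lemma countable_approx_open_measurable (R : realType) d (T : measurableType d)
    (X : pseudoMetricType R) (i : T -> X) (C : countType) (q : nat -> T -> C)
    (h : nat -> C -> X) :
  (forall k c, measurable (q k @^-1` [set c])) ->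
  (forall k x, ball (i x) k.+1%:R^-1 (h k (q k x))) ->
  forall U : set X, open U -> measurable (i @^-1` U).
Proof.
move=> mq hq U oU.
(* Every point lies in the ball around its own grid point, so cells with index in [S k] contain only
   points of [U]. Conversely a point with an [e]-ball inside [U] is caught as soon as
   [1 / (k + 1) < e / 2]. The indices being countable, [U] is a countable union of cells. *)
pose S k := [set c | ball (h k c) k.+1%:R^-1 `<=` U].
have -> : i @^-1` U = \bigcup_k \bigcup_c (q k @^-1` [set c] `&` [set _ | S k c]).
  apply/seteqP; split=> [x Ux|x [k _ [c _ [/= <-]]]]; last first.
    by apply; apply: ball_sym; exact: hq.
  have /nbhs_ballP[e /= e0 eU] := open_nbhs_nbhs (conj oU Ux).
  have e20 : 0 < e / 2 by rewrite divr_gt0.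
  near \oo => k; exists k => //; exists (q k x) => //; split=> // y /= hy.
  apply: eU; apply: le_ball (ball_triangle (hq k x) hy).
  rewrite [leRHS]splitr lerD// ltW//;
    by near: k; exact: (near_infty_natSinv_lt (PosNum e20)).
apply: bigcupT_measurable => k; apply: countable_bigcupT_measurable => // c.
have [Sc|Sc] := pselect (S k c).
  by rewrite (_ : [set _ | _] = setT) ?setIT//; apply/seteqP; split.
by rewrite (_ : [set _ | _] = set0) ?setI0//; apply/seteqP; split.
Unshelve. all: by end_near. Qed.

Section borel_row.
Context {R : realType} (n : nat).
Local Notation V := 'rV[R]_n.

Let q (k : nat) (x : V) : 'rV[int]_n := \row_i Num.floor (x ord0 i * k.+1%:R).
Let h (k : nat) (c : 'rV[int]_n) : V := \row_i ((c ord0 i)%:~R / k.+1%:R).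

Let mq k c : measurable (q k @^-1` [set c]).
Proof.
have -> : q k @^-1` [set c] = \bigcap_(i in [set: 'I_n])
   (fun x : V => Num.floor (x ord0 i * k.+1%:R)) @^-1` [set c ord0 i].
  apply/seteqP; split=> [x /= <- i _|x /= xc]; first by rewrite /= mxE.
  by apply/rowP => i; rewrite mxE; exact: xc.
apply: fin_bigcap_measurable => //= i _.
rewrite -[X in measurable X]setTI.
have mf : measurable_fun setT (fun x : V => (x ord0 i * k.+1%:R : measurableTypeR R)).
  by apply: measurable_funM => //; exact: measurable_coord.
have -> : [set: V] `&` (fun x : V => Num.floor (x ord0 i * k.+1%:R)) @^-1` [set c ord0 i]
  = [set: V] `&` (fun x : V => (x ord0 i * k.+1%:R : measurableTypeR R)) @^-1`
     `[(c ord0 i)%:~R, (c ord0 i + 1)%:~R[.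
  rewrite !setTI; apply/seteqP; split=> x /=; rewrite in_itv/=.
    by move=> <-; rewrite floor_le_tmp ?num_real// floorD1_gt ?num_real.
  by move=> ?; apply/eqP; rewrite floor_eq// num_real.
exact: mf.
Qed.

Let hq k (x : V) i j : ball (x i j) k.+1%:R^-1 (h k (q k x) i j).
Proof.
rewrite ord1 !mxE /ball/=.
set y := x _ _ * _; have yE : x ord0 j = y / k.+1%:R by rewrite mulfK.
have f1 : (Num.floor y)%:~R <= y by rewrite floor_le_tmp ?num_real.
have f2 : y < (Num.floor y + 1)%:~R by rewrite floorD1_gt ?num_real.
rewrite intrD in f2.
have k0 : 0 < k.+1%:R :> R by rewrite ltr0n.
rewrite yE -mulrBl ger0_norm; last by rewrite mulr_ge0 ?invr_ge0 ?(ltW k0)// subr_ge0.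
by rewrite ltr_pdivrMr// mulVf ?gt_eqF// ltrBlDl.
Qed.

Lemma open_row_measurable (U : set V) : open U -> measurable U.
Proof.
move=> oU.
apply: (@countable_approx_open_measurable R _ V V id 'rV[int]_n q h).
  exact: mq.
  by move=> k x; split=> [|i j]; [rewrite invr_gt0 ltr0n|exact: hq].
  exact: oU.
Qed.

Lemma open_row2_measurable (U : set (V * V)) : open U -> measurable U.
Proof.
move=> oU.
apply: (@countable_approx_open_measurable R _ (V * V)%type (V * V)%type id ('rV[int]_n * 'rV[int]_n)%type
  (fun k z => (q k z.1, q k z.2)) (fun k c => (h k c.1, h k c.2))) => // k.
  move=> [c1 c2].
  rewrite (_ : _ @^-1` _ = (q k @^-1` [set c1]) `*` (q k @^-1` [set c2])).
    by apply: measurableX; exact: mq.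
  by apply/seteqP; split=> -[x y] /= [-> ->].
Qed.

Lemma continuous_row2_measurable (f : V * V -> R) : continuous f ->
  measurable_fun setT (f : V * V -> measurableTypeR R).
Proof.
move=> /continuousP cf; apply: (measurability _ (RGenOpens.measurableE R)).
move=> _ [_ [a [b ->] <-]]; rewrite setTI.
by apply: open_row2_measurable; apply: cf; exact: interval_open.
Qed.

Lemma continuous_row_measurable (f : V -> R) : continuous f ->
  measurable_fun setT (f : V -> measurableTypeR R).
Proof.
move=> /continuousP cf; apply: (measurability _ (RGenOpens.measurableE R)).
move=> _ [_ [a [b ->] <-]]; rewrite setTI.
by apply: open_row_measurable; apply: cf; exact: interval_open.
Qed.

End borel_row.

(** Lebesgue measure transported by [x |-> x + a] has the right value on half-open intervals, and
    these determine it. *)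
Lemma ge0_integral_lebesgue_translate (R : realType) (a : R) (F : measurableTypeR R -> \bar R) :
  measurable_fun setT F -> (forall x, 0 <= F x)%E ->
  (\int[lebesgue_measure]_x F (x + a : R)%R = \int[lebesgue_measure]_x F x)%E.
Proof.
move=> mF F0.
have mp : measurable_fun setT (fun x : measurableTypeR R => x + a : measurableTypeR R).
  exact: measurable_funD.
transitivity (\int[pushforward (@lebesgue_measure R)
    (fun x : measurableTypeR R => (x + a)%R : measurableTypeR R)]_x F x)%E.
  by rewrite ge0_integral_pushforward// => x _; exact: F0.
apply: eq_measure_integral => A mA _.
apply/esym/lebesgue_measure_unique => // _ [[b c] _ <-].
rewrite /= /pushforward (_ : _ @^-1` _ = `]b - a, c - a]%classic).
  rewrite !lebesgue_measure_itv/= !lte_fin ltrD2r; case: ifP => // _.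
  by rewrite -!EFinD; congr (_%:E); lra.
by apply/seteqP; split => x /=; rewrite !in_itv/= ltrBlDr lerBrDr.
Qed.

Section row_measure.
Context {R : realType}.
Local Notation V n := 'rV[R]_n.
Local Notation lambda n := (lebesgue_row R n).

Lemma ge0_integral_lebesgue_step n (mu : {sigma_finite_measure set (V n) -> \bar R})
    (F : V n.+1 -> \bar R) :
  measurable_fun setT F -> (forall x, 0 <= F x)%E ->
  (\int[lebesgue_step mu]_x F x =
   \int[lebesgue_measure]_t \int[mu]_y F (row_cons (t, y)))%E.
Proof.
move=> mF F0.
have mc := @measurable_row_cons R n.
transitivity (\int[pushforward (@lebesgue_measure R \x mu) (@row_cons R n)]_x F x)%E.
  exact: eq_measure_integral.
rewrite ge0_integral_pushforward//.
by rewrite preimage_setT fubini_tonelli1//=; exact: (measurableT_comp mF mc).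
Qed.

Lemma ge0_integral_lebesgue_rowS n (F : V n.+1 -> \bar R) :
  measurable_fun setT F -> (forall x, 0 <= F x)%E ->
  (\int[lambda n.+1]_x F x =
   \int[lebesgue_measure]_t \int[lambda n]_y F (row_cons (t, y)))%E.
Proof. exact: ge0_integral_lebesgue_step. Qed.

Lemma measurable_row_add n : measurable_fun setT (fun z : V n * V n => z.1 + z.2).
Proof.
apply: measurable_rowP => i; under eq_fun do rewrite mxE.
apply: measurable_funD.
  exact: (measurableT_comp (measurable_coord i) measurable_fst).
exact: (measurableT_comp (measurable_coord i) measurable_snd).
Qed.

Lemma measurable_row_scale n (c : R) : measurable_fun setT (fun x : V n => c *: x).
Proof.
apply: measurable_rowP => i; under eq_fun do rewrite mxE.
by apply: measurable_funM => //; exact: measurable_coord.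
Qed.

Lemma measurable_funD_row d (T : measurableType d) n (f g : T -> V n) :
  measurable_fun setT f -> measurable_fun setT g ->
  measurable_fun setT (fun x => f x + g x).
Proof.
move=> mf mg.
exact: (measurableT_comp (@measurable_row_add n) (measurable_fun_pair mf mg)).
Qed.

Lemma measurable_funZ_row d (T : measurableType d) n c (f : T -> V n) :
  measurable_fun setT f -> measurable_fun setT (fun x => c *: f x).
Proof. exact: (measurableT_comp (@measurable_row_scale n c)). Qed.

Lemma ge0_integral_row_translate n (a : V n) (F : V n -> \bar R) :
  measurable_fun setT F -> (forall x, 0 <= F x)%E ->
  (\int[lambda n]_x F (x + a)%R = \int[lambda n]_x F x)%E.
Proof.
elim: n a F => [|n IH] a F mF F0.
  by apply: eq_integral => x _; congr F; apply/rowP => -[].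
have mD b : measurable_fun setT (fun x : V n.+1 => x + b).
  by apply: measurable_funD_row.
have mcons y : measurable_fun setT (fun t : measurableTypeR R => row_cons (t, y : V n)).
  by apply: measurableT_comp; [exact: measurable_row_cons|exact: measurable_fun_pair].
have mcons2 t : measurable_fun setT (fun y => row_cons (t, y : V n)).
  by apply: measurableT_comp; [exact: measurable_row_cons|exact: measurable_fun_pair].
rewrite !ge0_integral_lebesgue_rowS//; last exact: (measurableT_comp mF (mD a)).
have aE t y : row_cons (t, y) + a =
    row_cons (t + a ord0 ord0, y + \row_i a ord0 (lift ord0 i)).
  apply/rowP => i; rewrite mxE; case: (unliftP ord0 i) => [j|] ->.
    by rewrite !row_consES !mxE.
  by rewrite !row_consE0.
under eq_integral do under eq_integral do rewrite aE.
under eq_integral => t _.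
  rewrite (IH _ (fun y => F (row_cons (t + a ord0 ord0, y))))//.
    over.
  exact: measurableT_comp.
rewrite (ge0_integral_lebesgue_translate _
   (F := fun t : measurableTypeR R => \int[lambda n]_y F (row_cons (t, y)))%E)//.
  apply: (@measurable_fun_fubini_tonelli_F _ _ (measurableTypeR R) _ _ (lambda n) (F \o @row_cons R n)) => //=.
  by apply: measurableT_comp => //; exact: measurable_row_cons.
by move=> t; exact: integral_ge0.
Qed.

(** Tonelli, one coordinate at a time. It serves both for the volume of boxes (products of
    indicators) and for the mass of the mollifiers. *)
Lemma ge0_integral_row_prod n (k : 'I_n -> measurableTypeR R -> R) :
  (forall i, measurable_fun setT (k i)) -> (forall i t, 0 <= k i t) ->
  (\int[lambda n]_x (\prod_(i < n) k i (x ord0 i))%:E =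
   \prod_(i < n) \int[lebesgue_measure]_t (k i t)%:E)%E.
Proof.
elim: n k => [|n IH] k mk k0.
  under eq_integral do rewrite big_ord0.
  by rewrite big_ord0 integral_cst//= mul1e diracT.
have mprod m (k' : 'I_m -> measurableTypeR R -> R) : (forall i, measurable_fun setT (k' i)) ->
    measurable_fun setT (fun x : V m => (\prod_(i < m) k' i (x ord0 i))%:E).
  move=> mk'; apply/measurable_EFinP; apply: measurable_prod => i _.
  exact: (measurableT_comp (mk' i) (measurable_coord i)).
rewrite ge0_integral_lebesgue_rowS//; last 2 first.
- exact: mprod.
- by move=> x; rewrite lee_fin prodr_ge0.
rewrite big_ord_recl -IH//.
under eq_integral => t _.
  under eq_integral => y _.
    rewrite big_ord_recl row_consE0 EFinM /=.
    under eq_bigr do rewrite row_consES/=.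
    over.
  rewrite ge0_integralZl//=; first last.
    by rewrite lee_fin.
    by move=> y _; rewrite lee_fin prodr_ge0.
    by apply: (mprod _ (fun i => k (lift ord0 i))) => i.
  over.
rewrite ge0_integralZr//.
- exact/measurable_EFinP.
- by move=> t _; rewrite lee_fin.
- by apply: integral_ge0 => y _; rewrite lee_fin prodr_ge0.
Qed.

End row_measure.

Section phase_space.
Context {R : realType} (n : nat).
Local Notation V := 'rV[R]_n.
Local Notation lambda := (lebesgue_row R n).

Lemma row_entry_le_norm (x : V) i : `|x ord0 i| <= `|x|.
Proof.
rewrite [leRHS]/Num.norm/= mx_normrE.
exact: (le_bigmax _ (fun ij : 'I_1 * 'I_n => `|x ij.1 ij.2|) (ord0, i)).
Qed.

Lemma measurable_row_norm : measurable_fun setT (fun x : V => `|x| : measurableTypeR R).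
Proof. by apply: continuous_row_measurable; exact: norm_continuous. Qed.

Lemma measurable_row_box (rho : R) : measurable [set x : V | `|x| <= rho].
Proof.
rewrite (_ : [set _ | _] = setT `&` (fun x : V => `|x| : measurableTypeR R) @^-1` `]-oo, rho]).
  exact: measurable_row_norm.
by rewrite setTI; apply/seteqP; split=> x; rewrite /= in_itv.
Qed.

Lemma lebesgue_row_box_lty (rho : R) : (lambda [set x : V | `|x| <= rho]%R < +oo)%E.
Proof.
pose k (i : 'I_n) (t : measurableTypeR R) : R := \1_(`[- rho, rho]) t.
have mk i : measurable_fun setT (k i) by exact: measurable_indic.
have k0 i t : 0 <= k i t by rewrite /k indicE.
have mb := measurable_row_box rho.
rewrite -(setIT [set x | _]) -integral_indic//.
apply: (@le_lt_trans _ _ (\int[lambda]_x (\prod_(i < n) k i (x ord0 i))%:E)%E).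
  apply: ge0_le_integral => //=.
  - exact/measurable_EFinP/measurable_indic.
  - apply/measurable_EFinP; apply: measurable_prod => i _.
    exact: (measurableT_comp (mk i) (measurable_coord i)).
  move=> x _; rewrite lee_fin indicE; case: (boolP (x \in _)) => /=; last first.
    by move=> _; rewrite prodr_ge0.
  rewrite inE/= => xr; rewrite big1// => i _.
  rewrite /k indicE mem_set//= in_itv/= -ler_norml.
  exact: le_trans (row_entry_le_norm x i) xr.
rewrite (ge0_integral_row_prod mk k0).
have kE i : (\int[lebesgue_measure]_t (k i t)%:E = lebesgue_measure (`[(- rho)%R, rho]%classic : set R))%E.
  by rewrite /k integral_indic// setIT.
rewrite (eq_bigr _ (fun i _ => kE i)) -ge0_fin_numE ?prode_ge0//.
by apply: prode_fin_num => i _; rewrite lebesgue_measure_itv/=; case: ifP.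
Qed.

Lemma measurable_shear (s : R) :
  measurable_fun setT (fun z : V * V => (z.1 + s *: z.2, z.2)).
Proof.
apply: measurable_fun_pair; last exact: measurable_snd.
by apply: measurable_funD_row => //; exact: measurable_funZ_row.
Qed.

(** With [x] as the inner variable, the shear at a fixed velocity is the translation by [s *: v]. *)
Lemma lebesgue_shear (s : R) (A : set (V * V)) : measurable A ->
  pushforward (lambda \x lambda)%E (fun z : V * V => (z.1 + s *: z.2, z.2)) A =
  (lambda \x lambda)%E A.
Proof.
move=> mA; have ms := measurable_shear s.
have mi : measurable_fun setT (EFin \o \1_A : V * V -> \bar R).
  exact/measurable_EFinP/measurable_indic.
have i0 z : (0 <= (EFin \o \1_A) z :> \bar R)%E by rewrite /= lee_fin indicE.
have im B : measurable B ->
    ((lambda \x lambda) B = \int[lambda \x lambda]_z (\1_B z)%:E)%E.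
  by move=> mB; rewrite integral_indic// setIT.
rewrite /pushforward !im//; last by rewrite -[X in measurable X]setTI; exact: ms.
transitivity (\int[lambda \x lambda]_z
    (((EFin \o \1_A) \o (fun z : V * V => (z.1 + s *: z.2, z.2)%R)) z))%E.
  by apply: eq_integral => z _ /=; rewrite !indicE.
rewrite (fubini_tonelli2 _ (measurableT_comp mi ms) (fun z => i0 _)).
rewrite [RHS](fubini_tonelli2 _ mi i0).
apply: eq_integral => v _; rewrite /fubini_G/=.
rewrite (@ge0_integral_row_translate R n (s *: v) (fun x => (\1_A (x, v))%:E))//.
apply: (measurableT_comp mi); exact: measurable_fun_pair.
Qed.

End phase_space.

(** The integral is the difference of the integrals of the positive and negative parts, and Tonelli
    makes each of these measurable, whether finite or not. *)
Lemma measurable_fun_partial_integral d1 d2 (T1 : measurableType d1)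
    (T2 : measurableType d2) (R : realType)
    (m : {sigma_finite_measure set T2 -> \bar R}) (F : T1 * T2 -> \bar R) :
  measurable_fun setT F -> measurable_fun setT (fun x => \int[m]_y F (x, y))%E.
Proof.
move=> mF; under eq_fun => x do rewrite integralE.
apply: emeasurable_funB.
  rewrite [X in measurable_fun _ X](_ : _ = fun x => \int[m]_y (F^\+%E (x, y)))%E.
    by apply: measurable_fun_fubini_tonelli_F => //; exact: measurable_funepos.
  by apply/funext => x; apply: eq_integral => y _; rewrite funepos_comp.
rewrite [X in measurable_fun _ X](_ : _ = fun x => \int[m]_y (F^\-%E (x, y)))%E.
  by apply: measurable_fun_fubini_tonelli_F => //; exact: measurable_funeneg.
by apply/funext => x; apply: eq_integral => y _; rewrite funeneg_comp.
Qed.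

Lemma Rintegral_bound d (T : measurableType d) (R : realType)
    (mu : {measure set T -> \bar R}) (D : set T) (F : T -> R) (c : R) :
  measurable D -> (mu D < +oo)%E -> measurable_fun D F ->
  (forall x, D x -> `|F x| <= c) ->
  mu.-integrable D (EFin \o F) /\ `|\int[mu]_(x in D) F x| <= c * fine (mu D).
Proof.
move=> mD fD mF Fc.
have iF : mu.-integrable D (EFin \o F).
  apply: measurable_bounded_integrable => //.
  exists c; split; first exact: num_real.
  by move=> M cM x Dx; exact: (le_trans (Fc x Dx) (ltW cM)).
split => //.
have ic : mu.-integrable D (EFin \o cst c).
  by apply: measurable_bounded_integrable => //; exact: bounded_cst.
rewrite -Rintegral_cst//; apply: (le_trans (le_normr_Rintegral mD iF)).
apply: le_Rintegral => //.
exact: integrable_norm.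
Qed.

(** * Integrals over phase space *)

Section phase_integral.
Context {R : realType} (n : nat).
Local Notation V := 'rV[R]_n.
Local Notation lambda := (lebesgue_row R n).
Variable Omega : set V.
Hypothesis mO : measurable Omega.
Hypothesis O_gt0 : (0 < lambda Omega)%E.
Hypothesis O_lty : (lambda Omega < +oo)%E.
Variable vmax : R.
Hypothesis O_bnd : forall v, Omega v -> `|v| <= vmax.

Let D := [set: V] `*` Omega.
Let mD : measurable D. Proof. exact: measurableX. Qed.

Local Notation "'I' H" := (\int[(lambda \x lambda)%E]_(z in D) H z)
  (at level 10, H at level 8).

Definition vmean (g : V -> R) : R :=
  (fine (lambda Omega))^-1 * \int[lambda]_(w in Omega) g w.

(** Bounds are asked only for velocities in [Omega], where the data are controlled. The sup bound
    and the support radius are explicit parameters because the final constant has to be uniform over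
    all iterates of the one-step operator. *)
Definition xsupported (H : V * V -> R) (c rho : R) :=
  [/\ measurable_fun setT H, forall z, Omega z.2 -> `|H z| <= c &
      forall z, Omega z.2 -> rho < `|z.1| -> H z = 0].

Let cell rho : set (V * V) := [set x | `|x| <= rho]%R `*` Omega.

Let mcell rho : measurable (cell rho).
Proof. by apply: measurableX => //; exact: measurable_row_box. Qed.

Let cell_lty rho : ((lambda \x lambda) (cell rho) < +oo)%E.
Proof.
rewrite product_measure1E//; last exact: measurable_row_box.
by rewrite lte_mul_pinfty// ?ge0_fin_numE// lebesgue_row_box_lty.
Qed.

Definition cell_volume rho := fine ((lambda \x lambda)%E (cell rho)).

Lemma cell_volume_ge0 rho : 0 <= cell_volume rho.
Proof. exact: fine_ge0. Qed.

Lemma fine_Omega_gt0 : 0 < fine (lambda Omega).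
Proof. by rewrite fine_gt0// O_gt0 O_lty. Qed.

Lemma xsupported_cell H c rho : xsupported H c rho ->
  (forall z, D z -> (H \_ (cell rho)) z = H z).
Proof.
move=> [mH Hc Hr] z [_ Oz]; rewrite patchE; case: ifPn => // /negP nz.
rewrite Hr// ltNge; apply/negP => zr; apply: nz; rewrite inE; by split.
Qed.

Let cellD rho : D `&` cell rho = cell rho.
Proof. by apply/seteqP; split=> [z []//|z [zr Oz]]; split => //; split. Qed.

Lemma xsupported_integral H c rho : xsupported H c rho ->
  (lambda \x lambda)%E.-integrable D (EFin \o H) /\
  `|I H| <= c * cell_volume rho.
Proof.
move=> xH; have [mH Hc Hr] := xH.
have [||iH bH] := @Rintegral_bound _ _ _ (lambda \x lambda)%E _ H c (mcell rho) (cell_lty rho).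
- exact: measurable_funTS.
- by move=> z [_ Oz]; exact: Hc.
split.
  have : (lambda \x lambda)%E.-integrable D ((EFin \o H) \_ (cell rho)).
    by apply: (proj1 (integrable_restrict _ (mcell rho) mD _)); rewrite cellD.
  apply: eq_integrable => // z /set_mem Dz.
  by rewrite restrict_EFin /= (xsupported_cell xH).
rewrite (_ : I H = \int[(lambda \x lambda)%E]_(z in cell rho) H z)//.
rewrite -[in RHS]cellD [RHS](@Rintegral_mkcondr _ _ _ _ D (cell rho)).
by apply: eq_Rintegral => z /set_mem Dz; rewrite (xsupported_cell xH).
Qed.

Lemma xsupported_shear H c rho s : xsupported H c rho ->
  xsupported (fun z => H (z.1 + s *: z.2, z.2)) c (rho + `|s| * vmax).
Proof.
move=> [mH Hc Hr]; split.
- exact: (measurableT_comp mH (measurable_shear s)).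
- by move=> z Oz; exact: Hc.
- move=> z Oz rz; apply: Hr => //=.
  have : `|z.1| <= `|z.1 + s *: z.2| + `|s *: z.2|.
    by rewrite -{1}(addrK (s *: z.2) z.1) ler_normB.
  rewrite normrZ => h.
  have := ler_wpM2l (normr_ge0 s) (O_bnd Oz); lra.
Qed.

(** Free flight preserves phase-space volume and leaves the velocity, hence the domain,
    unchanged. *)
Lemma Rintegral_shear H c rho s : xsupported H c rho ->
  I (fun z => H (z.1 + s *: z.2, z.2)) = I H.
Proof.
move=> xH; have [mH _ _] := xH.
have [iH _] := xsupported_integral (xsupported_shear s xH).
have ms := @measurable_shear R n s.
congr fine.
transitivity (\int[pushforward (lambda \x lambda)
   (fun z : V * V => (z.1 + s *: z.2, z.2)%R)]_(z in D) (H z)%:E)%E.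
  rewrite integral_pushforward//.
    exact/measurable_EFinP.
by apply: eq_measure_integral => A mA _; exact: lebesgue_shear.
Qed.

Lemma xsupported_slice H c rho x : xsupported H c rho ->
  lambda.-integrable Omega (fun v => (H (x, v))%:E).
Proof.
move=> [mH Hc _].
have [||//] := @Rintegral_bound _ _ _ lambda Omega (fun v => H (x, v)) c mO O_lty.
- by apply: measurable_funTS; apply: (measurableT_comp mH); exact: measurable_fun_pair.
- by move=> v Ov; exact: Hc.
Qed.

Lemma Rintegral_iterated H c rho : xsupported H c rho ->
  I H = \int[lambda]_x \int[lambda]_(v in Omega) H (x, v).
Proof.
move=> xH; have [iH _] := xsupported_integral xH; have [mH _ _] := xH.
rewrite {1}/Rintegral integral_mkcond -(@integral12_prod_meas1 _ _ _ _ _ lambda lambda); last first.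
  exact: (proj1 (integrable_mkcond (EFin \o H) mD) iH).
congr fine; apply: eq_integral => x _.
rewrite fineK; last exact: integrable_fin_num (xsupported_slice x xH).
rewrite [RHS]integral_mkcond; apply: eq_integral => v _.
rewrite /= !patchE; congr (if _ then _ else _).
by apply/idP/idP => /set_mem h; apply/mem_set; [case: h|split].
Qed.

Lemma measurable_vmean (F : V * V -> R) : measurable_fun setT F ->
  measurable_fun setT (fun x => vmean (fun v => F (x, v))).
Proof.
move=> mF; apply: measurable_funM => //.
apply: measurableT_comp => //.
under eq_fun do rewrite integral_mkcond.
apply: (measurable_fun_partial_integral _
  (F := fun z => ((fun v => (F (z.1, v))%:E) \_ Omega) z.2)).
rewrite (_ : (fun z : V * V => _) = (EFin \o F) \_ D).
  by apply/(measurable_restrictT _ mD); apply: measurable_funTS; exact/measurable_EFinP.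
apply/funext => -[x v]; rewrite !patchE/=; congr (if _ then _ else _).
by apply/idP/idP => /set_mem h; apply/mem_set; [split|case: h].
Qed.

Lemma vmean_bound (g : V -> R) (c : R) : measurable_fun setT g ->
  (forall v, Omega v -> `|g v| <= c) -> `|vmean g| <= c.
Proof.
move=> mg gc.
have [|_ b] := @Rintegral_bound _ _ _ lambda Omega g c mO O_lty _ gc.
  exact: measurable_funTS.
have O0 := fine_Omega_gt0.
by rewrite normrM gtr0_norm ?invr_gt0// mulrC ler_pdivrMr.
Qed.

Lemma vmeanB (g h : V -> R) (c : R) : measurable_fun setT g -> measurable_fun setT h ->
  (forall v, Omega v -> `|g v| <= c) -> (forall v, Omega v -> `|h v| <= c) ->
  vmean g - vmean h = vmean (fun v => g v - h v).
Proof.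
move=> mg mh gc hc.
have [|ig _] := @Rintegral_bound _ _ _ lambda Omega g c mO O_lty _ gc.
  exact: measurable_funTS.
have [|ih _] := @Rintegral_bound _ _ _ lambda Omega h c mO O_lty _ hc.
  exact: measurable_funTS.
by rewrite /vmean RintegralB// mulrBr.
Qed.

(** At fixed [x] both sides equal the inverse volume of [Omega] times the product of the velocity
    integrals of [F] and [G]. Compact support in [x] is asked of one factor only, since a solution
    need not have it. *)
Lemma vmean_symmetric (F G : V * V -> R) (b c rho : R) :
  measurable_fun setT F -> (forall z, Omega z.2 -> `|F z| <= b) ->
  xsupported G c rho ->
  I (fun z => vmean (fun w => F (z.1, w)) * G z) =
  I (fun z => F z * vmean (fun w => G (z.1, w))).
Proof.
move=> mF Fb xG; have [mG Gc Gr] := xG.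
have mF1 := measurable_vmean mF; have mG1 := measurable_vmean mG.
have sl (F' : V * V -> R) x : measurable_fun setT F' -> measurable_fun setT (fun w => F' (x, w)).
  by move=> mF'; apply: (measurableT_comp mF'); exact: measurable_fun_pair.
have xl : xsupported (fun z => vmean (fun w => F (z.1, w)) * G z) (b * c) rho.
  split.
  - apply: measurable_funM => //; exact: (measurableT_comp mF1).
  - move=> z Oz; rewrite normrM ler_pM// ?Gc//.
    by apply: vmean_bound; [exact: sl|move=> v Ov; exact: Fb].
  - by move=> z Oz rz; rewrite Gr// mulr0.
have xr : xsupported (fun z => F z * vmean (fun w => G (z.1, w))) (b * c) rho.
  split.
  - apply: measurable_funM => //; exact: (measurableT_comp mG1).
  - move=> z Oz; rewrite normrM ler_pM// ?Fb//.
    by apply: vmean_bound; [exact: sl|move=> v Ov; exact: Gc].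
  - move=> z Oz rz; rewrite /vmean (_ : \int[_]_(w in _) _ = 0) ?mulr0//.
    rewrite -[RHS](mul0r (fine (lambda Omega))) -Rintegral_cst//.
    by apply: eq_Rintegral => w /set_mem Ow; rewrite Gr.
rewrite (Rintegral_iterated xl) (Rintegral_iterated xr).
apply: eq_Rintegral => x _ /=.
have [||iF _] := @Rintegral_bound _ _ _ lambda Omega (fun w => F (x, w)) b mO O_lty.
  by apply: measurable_funTS; exact: sl.
  by move=> w Ow; exact: Fb.
rewrite RintegralZl//; last exact: (xsupported_slice x xG).
by rewrite RintegralZr// /vmean; ring.
Qed.

End phase_integral.

(** * Smooth bumps *)

Section line_derivative.
Context {R : realType} {V : normedModType R}.

(** The two difference quotients are the same function. Applied in space-time, this turns the
    transport operator into a derivative along a characteristic. *)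
Lemma is_derive_line (g : V -> R) (x v : V) (s d : R) :
  is_derive (s *: v + x) v g d <->
  is_derive s 1 (fun t : R => g (t *: v + x)) d.
Proof.
have E : (fun h : R => h^-1 *: ((g \o shift (s *: v + x)) (h *: v) - g (s *: v + x))) =
    (fun h : R => h^-1 *: (((fun t : R => g (t *: v + x)) \o shift s) (h *: (1 : R)) -
       g (s *: v + x))).
  apply/funext => h /=; congr (_ *: (g _ - _)).
  by rewrite [h *: 1]mulr1 scalerDl addrA.
by split=> -[D1 D2]; split; rewrite /derivable/derive -?E// ?E.
Qed.

Lemma is_derive_line0 (g : V -> R) (x v : V) (d : R) :
  is_derive x v g d <-> is_derive (0 : R) 1 (fun t : R => g (t *: v + x)) d.
Proof. by rewrite -is_derive_line scale0r add0r. Qed.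

Lemma line_lipschitz (g : V -> R) (x v : V) (C h : R) :
  (forall y, derivable g y v) -> (forall y, `|'D_v g y| <= C) ->
  `|g (x + h *: v) - g x| <= C * `|h|.
Proof.
move=> dg gC.
pose F t := g (t *: v + x).
have dF (s : R) : is_derive s 1 F ('D_v g (s *: v + x)).
  by apply/is_derive_line; exact: derivableP.
have cF a b : {within `[a, b], continuous F}.
  by apply: derivable_within_continuous => s _; case: (dF s).
have H a b : a < b -> `|F b - F a| <= C * `|b - a|.
  move=> ab; have [c _ ->] := MVT ab (fun s _ => dF s) (@cF a b).
  by rewrite normrM ler_wpM2r.
have E : g (x + h *: v) - g x = F h - F 0.
  by rewrite /F scale0r add0r [x + _]addrC.
rewrite E; have [h0|h0|<-] := ltgtP 0 h.
- by rewrite -[X in C * `|X|]subr0; exact: H.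
- by rewrite distrC -[X in C * X]normrN -[X in C * `|X|]sub0r; exact: H.
- by rewrite subrr !normr0 mulr0.
Qed.

End line_derivative.

Section flat_function.
Context {R : realType}.
Implicit Types (p : {poly R}) (t : R).

(* The k-th derivative of exp (- 1 / t) is of this form. *)
Definition flat p t : R := if 0 < t then p.[t^-1] * expR (- t^-1) else 0.

(** In the variable [s = 1 / t] one has [d/dt = - s^2 d/ds], and [d/ds] sends [p exp (- s)] to
    [(p' - p) exp (- s)]. *)
Definition flat_deriv p : {poly R} := (p - p^`()) * 'X^2.

(** For [k > 0], raise [s / k <= expR (s / k)] to the power [k]. *)
Lemma expRN_poly_bound (k : nat) (s : R) : 0 < s -> s ^+ k * expR (- s) <= k%:R ^+ k.
Proof.
move=> s0; case: k => [|k].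
  by rewrite !expr0 mul1r -(expR0 R) ler_expR oppr_le0 ltW.
rewrite expRN ler_pdivrMr ?expR_gt0//.
have k0 : 0 < k.+1%:R :> R by rewrite ltr0n.
have -> : expR s = expR (s / k.+1%:R) ^+ k.+1.
  by rewrite -expRM_natr divfK// gt_eqF.
rewrite -exprMn; apply: lerXn2r; rewrite ?nnegrE ?(ltW s0) ?mulr_ge0 ?expR_ge0//.
rewrite -ler_pdivrMl// mulrC.
by apply: le_trans (expR_ge1Dx _); rewrite lerDr.
Qed.

(** Dividing by [t] multiplies by [s = 1 / t], so the claim is that [s * p(s) * exp (- s)] is
    bounded; this is done monomial by monomial. *)
Lemma flat_bound p : exists2 C : R, 0 <= C & forall t, `|flat p t| <= C * `|t|.
Proof.
pose C := \sum_(i < size p) `|p`_i| * i.+1%:R ^+ i.+1.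
have C0 : 0 <= C by apply: sumr_ge0 => i _; rewrite mulr_ge0.
exists C => // t; rewrite /flat; case: ifPn => t0; last by rewrite normr0 mulr_ge0.
rewrite (gtr0_norm t0) -ler_pdivrMr//.
set s := t^-1; have s0 : 0 < s by rewrite invr_gt0.
rewrite -[X in _ * X <= _](gtr0_norm s0) -normrM.
rewrite horner_coef !mulr_suml; apply: le_trans (ler_norm_sum _ _ _) _.
apply: ler_sum => i _; rewrite -!mulrA normrM ler_wpM2l//.
rewrite ger0_norm ?mulr_ge0 ?exprn_ge0 ?expR_ge0 ?(ltW s0)//.
by have := expRN_poly_bound i.+1 s0; rewrite exprSr -mulrA [s * _]mulrC.
Qed.

Lemma flatX p t : flat p t = flat (p * 'X) t * t.
Proof.
rewrite /flat; case: ifPn => t0; last by rewrite mul0r.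
by rewrite hornerMX; field; rewrite gt_eqF.
Qed.

Lemma is_derive_flat p t : is_derive t 1 (flat p) (flat (flat_deriv p) t).
Proof.
have [t0|t0|<-] := ltgtP 0 t.
- apply: (@near_eq_is_derive _ _ _ (fun y : R => p.[y^-1] * expR (- y^-1))).
    by near=> y; rewrite /flat ifT//; near: y; exact: lt_nbhsr.
  have dV : is_derive t 1 (fun y : R => y^-1) (- t ^- 2).
    by apply: is_derive_eq; [apply: is_deriveV; rewrite gt_eqF|rewrite /GRing.scale/= mulr1].
  have dp : is_derive t 1 (fun y : R => p.[y^-1]) (p^`().[t^-1] * - t ^- 2).
    exact: (@is_derive1_comp R (horner p) (fun y => y^-1)).
  have de : is_derive t 1 (fun y : R => expR (- y^-1)) (expR (- t^-1) * t ^- 2).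
    apply: (@is_derive1_comp R expR (fun y => - y^-1)).
    by rewrite -[t ^- 2]opprK; exact: is_deriveN.
  have E : flat (flat_deriv p) t = p.[t^-1] * (expR (- t^-1) * t ^- 2)
      + expR (- t^-1) * (p^`().[t^-1] * - t ^- 2).
    rewrite /flat t0 /flat_deriv hornerM hornerD hornerN hornerXn.
    by field; rewrite gt_eqF.
  rewrite E; exact: (is_deriveM dp de).
- rewrite {2}/flat ltNge (ltW t0)/=.
  apply: (@near_eq_is_derive _ _ _ (cst 0 : R -> R)).
    by near=> y; rewrite /flat ltNge ifN// negbK ltW//; near: y; exact: lt_nbhsl.
rewrite {2}/flat ltxx.
(* At the origin the quotient [flat p h / h] is [flat (p * 'X) h], of size at most [C * |h|]. The
   [C + 1] below only avoids dividing by zero. *)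
have [C C0 bC] := flat_bound (p * 'X).
have l0 : h^-1 *: ((flat p \o shift 0) (h *: (1 : R)) - flat p 0) @[h --> (0 : R)^'] --> (0 : R).
  apply/cvgrPdist_le => e e0; near=> h.
  have h0 : h != 0 by near: h; exact: nbhs_dnbhs_neq.
  rewrite /= addr0 [h *: 1]mulr1 /flat ltxx -/(flat p h) subr0 sub0r normrN.
  rewrite flatX [_ *: _]mulrC mulfK//.
  apply: le_trans (bC h) _.
  have : `|h| <= e / (C + 1).
    near: h; apply: dnbhs0_le; rewrite divr_gt0//; lra.
  rewrite ler_pdivlMr; last by lra.
  have := normr_ge0 h; nra.
split; first by apply/cvg_ex; exists 0.
exact: cvg_lim.
Unshelve. all: by end_near. Qed.

Lemma flat_continuous p : continuous (flat p).
Proof.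
move=> t; apply: differentiable_continuous; apply/derivable1_diffP.
by case: (is_derive_flat p t).
Qed.

End flat_function.

Section flat_algebra.
Context {R : realType} (n : nat).
Local Notation V := 'rV[R]_n.

(* Closed under directional derivatives, hence made of smooth functions. *)
Inductive flat_alg : (V -> R) -> Prop :=
| flat_alg_cst c : flat_alg (fun=> c)
| flat_alg_coord p i a b : flat_alg (fun x => flat p (a * x ord0 i + b))
| flat_algD g h : flat_alg g -> flat_alg h -> flat_alg (fun x => g x + h x)
| flat_algM g h : flat_alg g -> flat_alg h -> flat_alg (fun x => g x * h x)
| flat_algV g : (forall x, g x != 0) -> flat_alg g -> flat_alg (fun x => (g x)^-1).

Lemma is_derive_coord (F : R -> R) (i : 'I_n) (a b d : R) (x h : V) :
  is_derive (a * x ord0 i + b) 1 F d ->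
  is_derive x h (fun y : V => F (a * y ord0 i + b)) (d * (a * h ord0 i)).
Proof.
move=> dF; apply/is_derive_line0.
have dl : is_derive (0 : R) 1 (fun t : R => a * (t *: h + x) ord0 i + b) (a * h ord0 i).
  have -> : (fun t : R => a * (t *: h + x) ord0 i + b) =
      (fun t : R => (a * h ord0 i) * t + (a * x ord0 i + b)).
    by apply/funext => t; rewrite !mxE; ring.
  apply: is_derive_eq; rewrite -[_ *: _]/(_ * _) addr0; exact: mulr1.
apply: (@is_derive1_comp R F (fun t : R => a * (t *: h + x) ord0 i + b)).
by rewrite scale0r add0r.
Qed.

Lemma flat_alg_derive g : flat_alg g ->
  forall h, exists2 g', flat_alg g' & forall x, is_derive x h g (g' x).
Proof.
elim=> [c|p i a b|g1 g2 _ IH1 _ IH2|g1 g2 a1 IH1 a2 IH2|g1 g1n0 a1 IH1] h.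
- by exists (fun=> 0); [exact: flat_alg_cst|move=> x; exact: is_derive_cst].
- exists (fun x => flat (flat_deriv p) (a * x ord0 i + b) * (a * h ord0 i)).
    by apply: flat_algM; [exact: flat_alg_coord|exact: flat_alg_cst].
  by move=> x; apply: is_derive_coord; exact: is_derive_flat.
- have [d1 b1 D1] := IH1 h; have [d2 b2 D2] := IH2 h.
  by exists (fun x => d1 x + d2 x); [exact: flat_algD|move=> x; exact: is_deriveD].
- have [d1 b1 D1] := IH1 h; have [d2 b2 D2] := IH2 h.
  exists (fun x => g1 x * d2 x + g2 x * d1 x).
    by apply: flat_algD; apply: flat_algM.
  by move=> x; exact: is_deriveM.
- have [d1 b1 D1] := IH1 h.
  exists (fun x => (-1) * ((g1 x)^-1 * (g1 x)^-1) * d1 x).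
    apply: flat_algM => //; apply: flat_algM; first exact: flat_alg_cst.
    by apply: flat_algM; apply: flat_algV.
  move=> x; split.
    by apply: derivableV => //; case: (D1 x).
  by rewrite deriveV//; case: (D1 x) => // _ ->; rewrite expr2 invfM mulN1r.
Qed.

Lemma flat_alg_continuous g : flat_alg g -> continuous g.
Proof.
elim=> [c|p i a b|g1 g2 _ IH1 _ IH2|g1 g2 a1 IH1 a2 IH2|g1 g1n0 a1 IH1] x.
- exact: cst_continuous.
- apply: (@continuous_comp _ _ _ (fun y : V => a * y ord0 i + b)); last first.
    exact: flat_continuous.
  apply: continuousD; last exact: cst_continuous.
  apply: continuousM; first exact: cst_continuous.
  exact: coord_continuous.
- exact: (continuousD (IH1 x) (IH2 x)).
- exact: (continuousM (IH1 x) (IH2 x)).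
- exact: (continuousV (g1n0 x) (IH1 x)).
Qed.

Lemma flat_alg_smooth g : flat_alg g -> smooth g.
Proof.
move=> ag hs.
have : flat_alg (iter_derive hs g).
  elim: hs => //= h hs /flat_alg_derive/(_ h)[g' ag' D].
  by rewrite (_ : 'D_h _ = g')//; apply/funext => x; case: (D x).
move=> aD; split; first exact: flat_alg_continuous.
by move=> h x; have [g' _ D] := flat_alg_derive aD h; case: (D x).
Qed.

Lemma flat_alg_prod (I : Type) (r : seq I) (F : I -> V -> R) :
  (forall i, flat_alg (F i)) -> flat_alg (fun x => \prod_(i <- r) F i x).
Proof.
move=> aF; elim: r => [|i r IH].
  by under eq_fun do rewrite big_nil; exact: flat_alg_cst.
by under eq_fun do rewrite big_cons; exact: flat_algM.
Qed.

End flat_algebra.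

Section smooth_step.
Context {R : realType}.
Local Notation E := (flat (1 : {poly R})).
Local Notation E' := (flat (flat_deriv (1 : {poly R}))).

Let den (t : R) := E t + E (1 - t).

Definition smooth_step (t : R) : R := E t / den t.

(** The quotient rule after cancellation of [E t * E' t]. In this form nonnegativity and vanishing
    outside the unit interval can be read off, and the function visibly belongs to the algebra of
    smooth functions. *)
Definition smooth_step_deriv (t : R) : R :=
  (E' t * E (1 - t) + E t * E' (1 - t)) / den t ^+ 2.

Let E_ge0 (t : R) : 0 <= E t.
Proof. by rewrite /flat; case: ifP => // _; rewrite hornerC mul1r expR_ge0. Qed.

Let E_gt0 (t : R) : 0 < t -> 0 < E t.
Proof. by move=> t0; rewrite /flat t0 hornerC mul1r expR_gt0. Qed.

Let E_eq0 (p : {poly R}) (t : R) : t <= 0 -> flat p t = 0.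
Proof. by move=> t0; rewrite /flat ltNge t0. Qed.

Let E'_ge0 (t : R) : 0 <= E' t.
Proof.
rewrite /flat; case: ifP => // t0; rewrite /flat_deriv derivC subr0 mul1r hornerXn.
by rewrite mulr_ge0 ?expR_ge0// exprn_ge0// invr_ge0 ltW.
Qed.

Let den_gt0 (t : R) : 0 < den t.
Proof.
have [t0|t0] := leP t 0.
  by rewrite ltr_wpDl ?E_ge0// E_gt0//; lra.
by rewrite ltr_pwDl ?E_ge0// E_gt0.
Qed.

Lemma is_derive_smooth_step (t : R) : is_derive t 1 smooth_step (smooth_step_deriv t).
Proof.
have d1 : is_derive t 1 (fun t : R => E (1 - t)) (- E' (1 - t)).
  rewrite -mulrN1; apply: (@is_derive1_comp R E (fun t : R => 1 - t)).
    exact: is_derive_flat.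
  rewrite -[X in is_derive _ _ _ X]sub0r.
  exact: (is_deriveB (is_derive_cst (1 : R) t 1) (is_derive_id t 1)).
have d0 := is_derive_flat (1 : {poly R}) t.
have dd : is_derive t 1 den (E' t - E' (1 - t)) by exact: is_deriveD.
have dn0 : den t != 0 by rewrite gt_eqF.
have dV := is_deriveV dn0 dd.
have e : smooth_step_deriv t =
   E t * (- den t ^- 2 * (E' t - E' (1 - t))) + (den t)^-1 * E' t.
  by rewrite /smooth_step_deriv; rewrite /den in dn0 *; field.
by rewrite e; exact: (is_deriveM d0 dV).
Qed.

Lemma smooth_step_deriv_continuous : continuous smooth_step_deriv.
Proof.
have c1 (p : {poly R}) : continuous (fun t : R => flat p (1 - t)).
  move=> t; apply: (@continuous_comp _ _ _ (fun t : R => 1 - t)); last first.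
    exact: flat_continuous.
  apply: differentiable_continuous; apply/derivable1_diffP.
  by apply: derivableB.
have c0 (p : {poly R}) := @flat_continuous R p.
have cd : continuous den by move=> t; exact: (continuousD (c0 1 t) (c1 1 t)).
move=> t.
have n1 := continuousD (continuousM (c0 (flat_deriv 1) t) (c1 1 t))
  (continuousM (c0 1 t) (c1 (flat_deriv 1) t)).
have dn0 : den t * den t != 0 by rewrite mulf_neq0// gt_eqF.
rewrite (_ : smooth_step_deriv = fun t =>
    (E' t * E (1 - t) + E t * E' (1 - t)) * (den t * den t)^-1)//.
have n2 : {for t, continuous (fun t => den t * den t)} := continuousM (cd t) (cd t).
have n3 : {for t, continuous (fun t => (den t * den t)^-1)} by exact: continuousV.
exact: (continuousM n1 n3).
Qed.

Lemma smooth_step_deriv_ge0 (t : R) : 0 <= smooth_step_deriv t.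
Proof. by rewrite mulr_ge0 ?invr_ge0 ?exprn_ge0 ?(ltW (den_gt0 _))// addr_ge0// mulr_ge0. Qed.

Lemma smooth_step_le0 (t : R) : t <= 0 -> smooth_step t = 0.
Proof. by move=> t0; rewrite /smooth_step (E_eq0 _ t0) mul0r. Qed.

Lemma smooth_step_ge1 (t : R) : 1 <= t -> smooth_step t = 1.
Proof.
move=> t1; rewrite /smooth_step /den [E (1 - t)]E_eq0 ?addr0 ?divff//; last by lra.
by rewrite gt_eqF// E_gt0; lra.
Qed.

Lemma smooth_step_deriv_le0 (t : R) : t <= 0 -> smooth_step_deriv t = 0.
Proof. by move=> t0; rewrite /smooth_step_deriv !(E_eq0 _ t0) !mul0r addr0 mul0r. Qed.

Lemma smooth_step_deriv_ge1 (t : R) : 1 <= t -> smooth_step_deriv t = 0.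
Proof.
move=> t1; have t10 : 1 - t <= 0 by lra.
by rewrite /smooth_step_deriv !(E_eq0 _ t10) !mulr0 addr0 mul0r.
Qed.

Lemma smooth_step01 (t : R) : 0 <= smooth_step t <= 1.
Proof.
rewrite /smooth_step divr_ge0 ?(ltW (den_gt0 _))//= ler_pdivrMr// mul1r.
by rewrite /den lerDl.
Qed.

Lemma smooth_step_homo : {homo smooth_step : s t / s <= t}.
Proof.
move=> s t; rewrite le_eqVlt => /predU1P[->//|st].
have [|c _] := MVT st (fun x _ => is_derive_smooth_step x).
  by apply: derivable_within_continuous => x _; case: (is_derive_smooth_step x).
move=> e; rewrite -subr_ge0 e mulr_ge0 ?smooth_step_deriv_ge0//; lra.
Qed.

Variable n : nat.

Lemma flat_alg_smooth_step (i : 'I_n) (a b : R) :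
  flat_alg (fun x : 'rV[R]_n => smooth_step (a * x ord0 i + b)).
Proof.
have c1 p : flat_alg (fun x : 'rV[R]_n => flat p (1 - (a * x ord0 i + b))).
  rewrite [X in flat_alg X](_ : _ = fun x : 'rV[R]_n => flat p (- a * x ord0 i + (1 - b))).
    exact: flat_alg_coord.
  by apply/funext => x; congr flat; ring.
apply: flat_algM; first exact: flat_alg_coord.
apply: flat_algV; first by move=> x; rewrite gt_eqF.
by apply: flat_algD => //; exact: flat_alg_coord.
Qed.

Lemma flat_alg_smooth_step_deriv (i : 'I_n) (a b : R) :
  flat_alg (fun x : 'rV[R]_n => smooth_step_deriv (a * x ord0 i + b)).
Proof.
have c1 p : flat_alg (fun x : 'rV[R]_n => flat p (1 - (a * x ord0 i + b))).
  rewrite [X in flat_alg X](_ : _ = fun x : 'rV[R]_n => flat p (- a * x ord0 i + (1 - b))).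
    exact: flat_alg_coord.
  by apply/funext => x; congr flat; ring.
have c0 p : flat_alg (fun x : 'rV[R]_n => flat p (a * x ord0 i + b)).
  exact: flat_alg_coord.
apply: flat_algM; first by apply: flat_algD; exact: flat_algM.
apply: flat_algV; first by move=> x; rewrite expf_neq0// gt_eqF.
by apply: flat_algM; exact: flat_algD.
Qed.

End smooth_step.

Lemma row_norm_le (R : realType) n (x : 'rV[R]_n) (r : R) :
  0 <= r -> (forall i, `|x ord0 i| <= r) -> `|x| <= r.
Proof.
move=> r0 xr; rewrite [leLHS]/Num.norm/= mx_normrE.
by apply: bigmax_le => // -[i j] _ /=; rewrite ord1.
Qed.

(** Go from [y] to [x] by replacing one coordinate at a time: [n] moves, each of length at most the
    sup norm of [x - y]. *)
Lemma coordinate_lipschitz (R : realType) n (F : 'rV[R]_n -> R) (C : R) :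
  0 <= C ->
  (forall i x h, `|F (x + h *: delta_mx ord0 i) - F x| <= C * `|h|) ->
  forall x y, `|F x - F y| <= n%:R * C * `|x - y|.
Proof.
move=> C0 FC x y.
pose z k : 'rV[R]_n := \row_i (if (i < k)%N then x ord0 i else y ord0 i).
have z0 : z 0%N = y by apply/rowP => i; rewrite mxE.
have zn : z n = x by apply/rowP => i; rewrite mxE ltn_ord.
have step k : (k < n)%N -> `|F (z k.+1) - F (z k)| <= C * `|x - y|.
  move=> kn; pose i := Ordinal kn.
  have -> : z k.+1 = z k + (x ord0 i - y ord0 i) *: delta_mx ord0 i.
    apply/rowP => j; rewrite !mxE eqxx/= ltnS leq_eqVlt.
    have [->|ji] := eqVneq j i.
      by rewrite /= eqxx ltnn mulr1 addrC subrK.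
    by rewrite (_ : (j == k :> nat) = false) ?mulr0 ?addr0//; exact/negbTE.
  apply: (le_trans (FC _ _ _)); rewrite ler_wpM2l//.
  by have := row_entry_le_norm (x - y) i; rewrite !mxE.
have tel k : (k <= n)%N -> `|F (z k) - F (z 0%N)| <= k%:R * (C * `|x - y|).
  elim: k => [|k IH] kn; first by rewrite subrr normr0 mul0r.
  have -> : F (z k.+1) - F (z 0%N) = (F (z k) - F (z 0%N)) + (F (z k.+1) - F (z k)) by ring.
  rewrite -natr1 mulrDl mul1r; apply: le_trans (ler_normD _ _) _.
  by rewrite lerD ?step// IH// ltnW.
by have := tel n (leqnn n); rewrite z0 zn mulrA.
Qed.

(** The comparison is almost everywhere because it is applied with [Linfty] bounds, in particular
    those on weak derivatives. *)
Lemma Rintegral_le_ae d (T : measurableType d) (R : realType)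
    (mu : {measure set T -> \bar R}) (D : set T) (F G : T -> R) (c : R) :
  measurable D -> measurable_fun D F -> measurable_fun D G ->
  (forall x, 0 <= G x) -> {ae mu, forall x, D x -> `|F x| <= G x} ->
  (\int[mu]_(x in D) (G x)%:E <= c%:E)%E ->
  mu.-integrable D (EFin \o F) /\ `|\int[mu]_(x in D) F x| <= c.
Proof.
move=> mD mF mG G0 FG Gc.
have le : (\int[mu]_(x in D) `|(F x)%:E| <= c%:E)%E.
  apply: le_trans Gc; apply: ae_ge0_le_integral => //.
  - by do 2 apply: measurableT_comp => //.
  - by move=> x _; rewrite lee_fin.
  - exact/measurable_EFinP.
have iF : mu.-integrable D (EFin \o F).
  apply/integrableP; split; first exact/measurable_EFinP.
  exact: le_lt_trans le (ltry _).
split => //; rewrite -lee_fin EFin_normr_Rintegral//.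
by apply: le_trans le; apply: le_abse_integral => //; exact/measurable_EFinP.
Qed.

(** * Ramps, mollifiers and their exact integrals and derivatives *)

Section ramp.
Context {R : realType}.
Implicit Types (c h eps t : R).

(** The derivative of a smooth step that rises from 0 to 1 on [[c, c + eps]], so a unit mass there.
    The argument is written as an affine function of [t] to match [flat_alg_coord]. *)
Definition step_bump c eps t : R := eps^-1 * smooth_step_deriv (eps^-1 * t + - (c / eps)).

(** A compactly supported primitive of the bump at [c] minus the bump at [c + h], playing the part
    of a smoothed indicator of [[c, c + h]]. *)
Definition ramp c h eps t : R :=
  smooth_step (eps^-1 * t + - (c / eps)) - smooth_step (eps^-1 * t + - ((c + h) / eps)).

Lemma step_bump_ge0 c eps t : 0 < eps -> 0 <= step_bump c eps t.
Proof. by move=> e0; rewrite mulr_ge0 ?smooth_step_deriv_ge0// invr_ge0 ltW. Qed.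

Lemma affine_divE c eps t : 0 < eps -> eps^-1 * t + - (c / eps) = (t - c) / eps.
Proof. by move=> e0; field; rewrite gt_eqF. Qed.

Lemma step_bump_eq0 c eps t : 0 < eps -> ~~ (c <= t <= c + eps) -> step_bump c eps t = 0.
Proof.
move=> e0; rewrite /step_bump affine_divE// negb_and -!ltNge => /orP[tc|tc].
  by rewrite smooth_step_deriv_le0 ?mulr0// ler_pdivrMr// mul0r; lra.
by rewrite smooth_step_deriv_ge1 ?mulr0// ler_pdivlMr// mul1r; lra.
Qed.

Lemma is_derive_step_affine c eps t : 0 < eps ->
  is_derive t 1 (fun t : R => smooth_step (eps^-1 * t + - (c / eps))) (step_bump c eps t).
Proof.
move=> e0; rewrite /step_bump [X in is_derive _ _ _ X]mulrC.
apply: (@is_derive1_comp R (@smooth_step R) (fun t : R => eps^-1 * t + - (c / eps))).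
  exact: is_derive_smooth_step.
have := is_deriveD (is_deriveZ eps^-1 (is_derive_id t (1 : R)))
  (is_derive_cst (- (c / eps)) t (1 : R)).
by rewrite addr0 -[_ *: _]/(_ * _) mulr1.
Qed.

Lemma is_derive_ramp c h eps t : 0 < eps ->
  is_derive t 1 (ramp c h eps) (step_bump c eps t - step_bump (c + h) eps t).
Proof. by move=> e0; apply: is_deriveB; exact: is_derive_step_affine. Qed.

Lemma step_bump_continuous c eps : 0 < eps -> continuous (step_bump c eps).
Proof.
move=> e0 t.
apply: (@continuousM _ _ (fun=> eps^-1) (fun t => smooth_step_deriv (eps^-1 * t + - (c / eps)))).
  exact: cst_continuous.
apply: (@continuous_comp _ _ _ (fun t => eps^-1 * t + - (c / eps))); last first.
  exact: smooth_step_deriv_continuous.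
apply: differentiable_continuous; apply/derivable1_diffP.
by apply: derivableD => //; exact: derivableM.
Qed.

Lemma measurable_step_bump c eps : 0 < eps -> measurable_fun setT (step_bump c eps).
Proof. by move=> e0; apply: continuous_measurable_fun; exact: step_bump_continuous. Qed.

Lemma integral_step_bump c eps : 0 < eps ->
  (\int[lebesgue_measure]_t (step_bump c eps t)%:E = 1)%E.
Proof.
move=> e0.
transitivity (\int[lebesgue_measure]_(t in `[c, (c + eps)%R]) (step_bump c eps t)%:E)%E.
  rewrite [RHS]integral_mkcond; apply: eq_integral => t _.
  rewrite patchE; case: ifPn => // /negP tc; rewrite step_bump_eq0//.
  by apply/negP => h; apply: tc; rewrite inE/= in_itv.
rewrite (@continuous_FTC2 _ _ (fun t : R => smooth_step (eps^-1 * t + - (c / eps)))).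
- rewrite !affine_divE// subrr mul0r [smooth_step 0]smooth_step_le0//.
  have -> : (c + eps - c) / eps = 1 by field; rewrite gt_eqF.
  by rewrite smooth_step_ge1// sube0.
- lra.
- by apply: continuous_subspaceT; exact: step_bump_continuous.
- have cS t : continuous_at t (fun t : R => smooth_step (eps^-1 * t + - (c / eps))).
    apply: differentiable_continuous; apply/derivable1_diffP.
    by case: (is_derive_step_affine c t e0).
  split.
  + by move=> t _; case: (is_derive_step_affine c t e0).
  + exact: (cvg_at_right_filter (cS _)).
  + exact: (cvg_at_left_filter (cS _)).
- by move=> t _; rewrite derive1E; case: (is_derive_step_affine c t e0).
Qed.

Lemma ramp_ge0 c h eps t : 0 < eps -> 0 <= h -> 0 <= ramp c h eps t.
Proof.
move=> e0 h0; rewrite subr_ge0; apply: smooth_step_homo.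
by rewrite !affine_divE// ler_pM2r ?invr_gt0//; lra.
Qed.

Lemma ramp_le1 c h eps t : ramp c h eps t <= 1.
Proof.
rewrite /ramp; set u := smooth_step _; set v := smooth_step _.
have /andP[_ u1] : 0 <= u <= 1 by exact: smooth_step01.
have /andP[v0 _] : 0 <= v <= 1 by exact: smooth_step01.
lra.
Qed.

Lemma ramp_eq0 c h eps t : 0 < eps -> 0 <= h ->
  ~~ (c <= t <= c + (eps + h)) -> ramp c h eps t = 0.
Proof.
move=> e0 h0; rewrite /ramp !affine_divE// negb_and -!ltNge => /orP[tc|tc].
  by rewrite !smooth_step_le0 ?subrr// ler_pdivrMr// mul0r; lra.
by rewrite !smooth_step_ge1 ?subrr// ler_pdivlMr// mul1r; lra.
Qed.

Lemma measurable_ramp c h eps : 0 < eps -> measurable_fun setT (ramp c h eps).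
Proof.
move=> e0; apply: continuous_measurable_fun => t.
apply: differentiable_continuous; apply/derivable1_diffP.
by case: (is_derive_ramp c h t e0).
Qed.

Lemma integral_ramp c h eps : 0 < eps -> 0 <= h ->
  (\int[lebesgue_measure]_t (ramp c h eps t)%:E <= (eps + h)%:E)%E.
Proof.
move=> e0 h0.
apply: (@le_trans _ _ (\int[lebesgue_measure]_t (\1_(`[c, (c + (eps + h))%R]) t)%:E)%E).
  apply: ge0_le_integral => //.
  - by move=> t _; rewrite lee_fin ramp_ge0.
  - by apply/measurable_EFinP; exact: measurable_ramp.
  - by apply/measurable_EFinP; exact: measurable_indic.
  move=> t _; rewrite lee_fin indicE; case: (boolP (t \in _)) => [_|/negP tc].
    exact: ramp_le1.
  by rewrite ramp_eq0//; apply/negP => ?; apply: tc; rewrite inE/= in_itv.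
rewrite integral_indic// setIT.
have <- : lebesgue_measure (`[c, (c + (eps + h))%R]%classic : set R) = (eps + h)%:E.
  rewrite lebesgue_measure_itv/= lte_fin ltrDl ltr_wpDr//.
  by rewrite -EFinD addrC addKr.
exact: lexx.
Qed.

End ramp.

Section mollifier.
Context {R : realType} (n : nat).
Local Notation V := 'rV[R]_n.
Local Notation lambda := (lebesgue_row R n).
Implicit Types (a x : V) (h eps : R).

Definition mollifier a eps x : R := \prod_(j < n) step_bump (a ord0 j) eps (x ord0 j).

(* Its i-th partial derivative is the difference of the mollifiers at [a] and     *)
(* [a + h e_i], so the weak derivative of [u] controls difference quotients of the *)
(* mollified [u]. *)
Definition mollifier_ramp (i : 'I_n) a h eps x : R :=
  \prod_(j < n) (if j == i then ramp (a ord0 j) h eps (x ord0 j)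
                 else step_bump (a ord0 j) eps (x ord0 j)).

Lemma mollifier_ge0 a eps x : 0 < eps -> 0 <= mollifier a eps x.
Proof. by move=> e0; apply: prodr_ge0 => j _; exact: step_bump_ge0. Qed.

Lemma mollifier_ramp_ge0 i a h eps x : 0 < eps -> 0 <= h -> 0 <= mollifier_ramp i a h eps x.
Proof.
move=> e0 h0; apply: prodr_ge0 => j _.
by case: ifP => _; [exact: ramp_ge0|exact: step_bump_ge0].
Qed.

Lemma mollifier_eq0 a eps x : 0 < eps -> eps < `|x - a| -> mollifier a eps x = 0.
Proof.
move=> e0; apply: contraTeq => m0; rewrite -leNgt; apply: row_norm_le; first exact: ltW.
move=> j; rewrite !mxE.
have bj : step_bump (a ord0 j) eps (x ord0 j) != 0.
  by apply: contraNneq m0 => b0; rewrite /mollifier (bigD1 j)//= b0 mul0r.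
have : a ord0 j <= x ord0 j <= a ord0 j + eps.
  by apply: contraNT bj => ?; rewrite step_bump_eq0.
by rewrite ler_norml; lra.
Qed.

Lemma mollifier_ramp_eq0 i a h eps x : 0 < eps -> 0 <= h ->
  `|a| + eps + h < `|x| -> mollifier_ramp i a h eps x = 0.
Proof.
move=> e0 h0; apply: contraTeq => m0; rewrite -leNgt.
apply: row_norm_le; first by rewrite !addr_ge0// ltW.
move=> j.
have bj : (if j == i then ramp (a ord0 j) h eps (x ord0 j)
           else step_bump (a ord0 j) eps (x ord0 j)) != 0.
  by apply: contraNneq m0 => b0; rewrite /mollifier_ramp (bigD1 j)//= b0 mul0r.
have : a ord0 j <= x ord0 j <= a ord0 j + (eps + h).
  apply: contraNT bj => nb; case: ifP => _; first by rewrite ramp_eq0.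
  rewrite step_bump_eq0//; apply: contra nb => /andP[-> h1] /=; lra.
have := row_entry_le_norm a j; rewrite !ler_norml; lra.
Qed.

Lemma measurable_prod_coord (k : 'I_n -> measurableTypeR R -> R) :
  (forall i, measurable_fun setT (k i)) ->
  measurable_fun setT (fun x : V => \prod_(i < n) k i (x ord0 i)).
Proof.
move=> mk; apply: measurable_prod => i _.
exact: (measurableT_comp (mk i) (measurable_coord i)).
Qed.

Lemma measurable_mollifier a eps : 0 < eps -> measurable_fun setT (mollifier a eps).
Proof.
move=> e0; apply: (measurable_prod_coord (k := fun j => step_bump (a ord0 j) eps)) => j.
exact: measurable_step_bump.
Qed.

Let ramp_factor i a h eps (j : 'I_n) (t : measurableTypeR R) : R :=
  if j == i then ramp (a ord0 j) h eps t else step_bump (a ord0 j) eps t.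

Let measurable_ramp_factor i a h eps j : 0 < eps ->
  measurable_fun setT (ramp_factor i a h eps j).
Proof.
move=> e0; rewrite /ramp_factor; case: (j == i).
  exact: measurable_ramp.
exact: measurable_step_bump.
Qed.

Lemma measurable_mollifier_ramp i a h eps : 0 < eps ->
  measurable_fun setT (mollifier_ramp i a h eps).
Proof.
move=> e0; apply: (measurable_prod_coord (k := ramp_factor i a h eps)) => j.
exact: measurable_ramp_factor.
Qed.

Lemma integral_mollifier a eps : 0 < eps ->
  (\int[lambda]_x (mollifier a eps x)%:E = 1)%E.
Proof.
move=> e0; rewrite (ge0_integral_row_prod (k := fun j => step_bump (a ord0 j) eps)).
- by rewrite big1// => j _; exact: integral_step_bump.
- by move=> j; exact: measurable_step_bump.
- by move=> j t; exact: step_bump_ge0.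
Qed.

(** The factors other than the [i]-th have mass one; the ramp is at most 1 on a support of length
    [eps + h]. *)
Lemma integral_mollifier_ramp i a h eps : 0 < eps -> 0 <= h ->
  (\int[lambda]_x (mollifier_ramp i a h eps x)%:E <= (eps + h)%:E)%E.
Proof.
move=> e0 h0; rewrite (ge0_integral_row_prod (k := ramp_factor i a h eps)).
- rewrite (bigD1 i)//= big1 ?mule1.
    rewrite /ramp_factor eqxx; exact: integral_ramp.
  by move=> j /negbTE ji; rewrite /ramp_factor ji; exact: integral_step_bump.
- by move=> j; exact: measurable_ramp_factor.
- by move=> j t; rewrite /ramp_factor; case: ifP => _; [exact: ramp_ge0|exact: step_bump_ge0].
Qed.

Lemma mollifier_ramp_test i a h eps : 0 < eps -> 0 <= h ->
  test_function setT (mollifier_ramp i a h eps).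
Proof.
move=> e0 h0; split => //.
  apply: flat_alg_smooth; apply: flat_alg_prod => j; case: (j == i).
    rewrite /ramp.
    have E (x : V) : smooth_step (eps^-1 * x ord0 j + - (a ord0 j / eps)) -
        smooth_step (eps^-1 * x ord0 j + - ((a ord0 j + h) / eps)) =
        smooth_step (eps^-1 * x ord0 j + - (a ord0 j / eps)) +
        (-1) * smooth_step (eps^-1 * x ord0 j + - ((a ord0 j + h) / eps)).
      by rewrite mulN1r.
    under eq_fun do rewrite E.
    apply: flat_algD; first exact: flat_alg_smooth_step.
    by apply: flat_algM; [exact: flat_alg_cst|exact: flat_alg_smooth_step].
  by apply: flat_algM; [exact: flat_alg_cst|exact: flat_alg_smooth_step_deriv].
have sub : fsupport (mollifier_ramp i a h eps) `<=`
    closed_ball_ Num.norm (0 : V) (`|a| + eps + h).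
  rewrite /fsupport [X in _ `<=` X](closure_id _).1; last exact: closed_closed_ball_.
  apply: closure_subset => x /= m0; rewrite /closed_ball_/= sub0r normrN leNgt.
  by apply: contra m0 => /mollifier_ramp_eq0 ->.
apply: bounded_closed_compact; last exact: closed_closure.
exists (`|a| + eps + h); split; first exact: num_real.
move=> M aM x /sub; rewrite /closed_ball_/= sub0r normrN => xa.
exact: le_trans xa (ltW aM).
Qed.

(** Along the [i]-th axis only the ramp factor varies; the product [K] of the others is a
    constant. *)
Lemma derive_mollifier_ramp i a h eps x : 0 < eps ->
  'D_(delta_mx ord0 i) (mollifier_ramp i a h eps) x =
  mollifier a eps x - mollifier (a + h *: delta_mx ord0 i) eps x.
Proof.
move=> e0; apply: derive_val.
pose K := \prod_(j < n | j != i) step_bump (a ord0 j) eps (x ord0 j).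
have -> : mollifier a eps x - mollifier (a + h *: delta_mx ord0 i) eps x =
    (step_bump (a ord0 i) eps (0 + x ord0 i) -
     step_bump (a ord0 i + h) eps (0 + x ord0 i)) * K.
  rewrite add0r mulrBl /mollifier (bigD1 i)//= [in X in _ - X](bigD1 i)//=.
  rewrite !mxE !eqxx mulr1; congr (_ - _ * _); apply: eq_bigr => j /negbTE ji.
  by rewrite !mxE ji andbF mulr0 addr0.
apply/is_derive_line0.
rewrite [X in is_derive _ _ X](_ : _ = (fun t : R => ramp (a ord0 i) h eps (t + x ord0 i) * K)).
  rewrite -[_ * K]addr0 [_ * K]mulrC -[X in _ + X](mulr0 (ramp (a ord0 i) h eps (0 + x ord0 i))).
  rewrite addrC; apply: (@is_deriveM R R (fun t => ramp (a ord0 i) h eps (t + x ord0 i))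
    (fun=> K)).
  rewrite -[X in is_derive _ _ _ X]mulr1.
  apply: (@is_derive1_comp R (ramp (a ord0 i) h eps) (fun t : R => t + x ord0 i)).
    exact: is_derive_ramp.
  have := is_deriveD (is_derive_id (0 : R) (1 : R)) (is_derive_cst (x ord0 i) (0 : R) (1 : R)).
  by rewrite addr0.
apply/funext => t; rewrite /mollifier_ramp (bigD1 i)//= eqxx !mxE !eqxx mulr1.
congr (_ * _); apply: eq_bigr => j /negbTE ji.
by rewrite !mxE ji andbF mulr0 add0r.
Qed.

End mollifier.

(** * Regularity of the scattering coefficient *)

Section lipschitz_of_weak_derivative.
Context {R : realType} (n : nat).
Local Notation V := 'rV[R]_n.
Local Notation lambda := (lebesgue_row R n).
Variable sigma : V -> R.
Hypothesis sigma_cont : continuous sigma.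
Hypothesis sigma_W1 : W_infty 1 sigma.

Let msigma : measurable_fun setT (sigma : V -> measurableTypeR R).
Proof. by have [[]] := sigma_W1. Qed.

Let mollified a eps := \int[lambda]_x (sigma x * mollifier a eps x).

Let continuous_norm (a : V) (eta : R) : 0 < eta -> exists2 eps, 0 < eps &
  forall x, `|x - a| <= eps -> `|sigma x - sigma a| <= eta.
Proof.
move=> eta0.
have /cvgrPdist_le/(_ _ eta0) := @sigma_cont a.
move=> /nbhs_ballP[e /= e0 he]; exists (e / 2); first by rewrite divr_gt0.
move=> x xa; rewrite distrC; apply: he; rewrite -ball_normE/= distrC.
apply: le_lt_trans xa _; lra.
Qed.

Let mollified_integrable (a : V) (eps eta : R) : 0 < eps ->
  (forall x, `|x - a| <= eps -> `|sigma x - sigma a| <= eta) ->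
  lambda.-integrable setT (EFin \o (fun x => sigma x * mollifier a eps x)) /\
  `|mollified a eps - sigma a| <= eta.
Proof.
move=> e0 he.
have eta0 : 0 <= eta.
  by apply: le_trans (he a _); rewrite ?subrr ?normr0// ltW.
have mm := measurable_mollifier a e0.
(* Averaging against the unit mass [mollifier a eps] cannot exceed a bound valid on its support.
   Used for [sigma], for [sigma - sigma a] and for constants. *)
have bnd (F : V -> R) (c : R) : 0 <= c -> measurable_fun setT F ->
    (forall x, `|x - a| <= eps -> `|F x| <= c) ->
    lambda.-integrable setT (EFin \o (fun x => F x * mollifier a eps x)) /\
    `|\int[lambda]_x (F x * mollifier a eps x)| <= c.
  move=> c0 mF Fc.
  apply: (@Rintegral_le_ae _ _ _ _ _ _ (fun x => c * mollifier a eps x)) => //.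
  - exact: measurable_funM.
  - exact: measurable_funM.
  - by move=> x; rewrite mulr_ge0 ?mollifier_ge0.
  - apply: aeW => x _; rewrite normrM [X in _ * X]ger0_norm ?mollifier_ge0//.
    have [xa|xa] := leP `|x - a| eps; last by rewrite mollifier_eq0// !mulr0.
    by rewrite ler_wpM2r ?mollifier_ge0// Fc.
  under eq_integral do rewrite EFinM.
  rewrite ge0_integralZl//; last 2 first.
  - exact/measurable_EFinP.
  - by move=> x _; rewrite lee_fin mollifier_ge0.
  - by rewrite integral_mollifier// mule1.
have [i1 _] : lambda.-integrable setT (EFin \o (fun x => sigma x * mollifier a eps x)) /\
    `|\int[lambda]_x (sigma x * mollifier a eps x)| <= `|sigma a| + eta.
  apply: bnd => //; first by rewrite addr_ge0.
  move=> x xa; rewrite -(subrK (sigma a) (sigma x)) addrC.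
  by apply: le_trans (ler_normD _ _) _; rewrite lerD2l he.
split => //.
have [_] : lambda.-integrable setT (EFin \o (fun x => (sigma x - sigma a) * mollifier a eps x)) /\
    `|\int[lambda]_x ((sigma x - sigma a) * mollifier a eps x)| <= eta.
  by apply: bnd => //; exact: measurable_funB.
have [i2 _] := bnd (fun=> sigma a) `|sigma a| (normr_ge0 _) (measurable_cst _) (fun _ _ => lexx _).
have im : lambda.-integrable setT (EFin \o mollifier a eps).
  have [] := bnd (fun=> 1) 1 ler01 (measurable_cst _) (fun _ _ => _); first by rewrite normr1.
  by under [X in _.-integrable _ (_ \o X)]eq_fun do rewrite mul1r.
under eq_Rintegral do rewrite mulrBl.
rewrite RintegralB// RintegralZl// {2}/Rintegral integral_mollifier//= mulr1.
exact.
Qed.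

(** The almost-everywhere bound passes to averages of [sigma] over small bumps, and by continuity
    these averages tend to the value of [sigma] at the centre. *)
Lemma continuous_Linfty_bounded : exists2 C, 0 <= C & forall x, `|sigma x| <= C.
Proof.
have [[_ [C0 aeC]] _] := sigma_W1.
pose C := Num.max C0 0.
exists C; first by rewrite /C le_max lexx orbT.
move=> a; apply/ler_addgt0Pr => eta eta0.
have [eps e0 he] := continuous_norm a eta0.
have [_ b1] := mollified_integrable e0 he.
have [_ b2] : lambda.-integrable setT (EFin \o (fun x => sigma x * mollifier a eps x)) /\
    `|\int[lambda]_x (sigma x * mollifier a eps x)| <= C.
  have mm := measurable_mollifier a e0.
  apply: (@Rintegral_le_ae _ _ _ _ _ _ (fun x => C * mollifier a eps x)) => //.
  - exact: measurable_funM.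
  - exact: measurable_funM.
  - by move=> x; rewrite mulr_ge0 ?mollifier_ge0// /C le_max lexx orbT.
  - move: aeC; apply: filterS => x /(_ I) sC _.
    rewrite normrM [X in _ * X]ger0_norm ?mollifier_ge0//.
    by rewrite ler_wpM2r ?mollifier_ge0// /C le_max sC.
  under eq_integral do rewrite EFinM.
  rewrite ge0_integralZl//; last 3 first.
  - exact/measurable_EFinP.
  - by move=> x _; rewrite lee_fin mollifier_ge0.
  - by rewrite lee_fin /C le_max lexx orbT.
  by rewrite integral_mollifier// mule1.
rewrite -/(mollified a eps) in b2.
rewrite -(subrK (mollified a eps) (sigma a)) addrC.
by apply: le_trans (ler_normD _ _) _; rewrite lerD// distrC.
Qed.

(** Testing the weak derivative [g] against [mollifier_ramp] expresses the difference of two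
    mollified values of [sigma], at [a] and [a + h e_i], as minus the integral of [g] times the
    ramp, at most [C * (eps + h)]. Letting [eps] tend to 0 removes the mollification. *)
Let coordinate_step i : exists2 C, 0 <= C &
  forall a h, 0 < h -> `|sigma (a + h *: delta_mx ord0 i) - sigma a| <= C * h.
Proof.
have [_ /(_ [:: i] isT)[g [mg [C0 aeC]] wd]] := sigma_W1.
pose C := Num.max C0 0.
have Cge0 : 0 <= C by rewrite /C le_max lexx orbT.
exists C => // a h h0; set b := a + _.
have key eta eps : 0 < eta -> 0 < eps ->
    (forall x, `|x - a| <= eps -> `|sigma x - sigma a| <= eta) ->
    (forall x, `|x - b| <= eps -> `|sigma x - sigma b| <= eta) ->
    `|sigma b - sigma a| <= eta + eta + C * (eps + h).
  move=> eta0 e0 ha hb.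
  have [ia ba] := mollified_integrable e0 ha.
  have [ib bb] := mollified_integrable e0 hb.
  have := wd _ (mollifier_ramp_test i a e0 (ltW h0)).
  rewrite /= expr1 mulN1r.
  under eq_Rintegral do rewrite derive_mollifier_ramp// mulrBr.
  rewrite RintegralB// -/(mollified a eps) -/(mollified b eps) => dE.
  have [_ bg] : lambda.-integrable setT (EFin \o (fun x => g x * mollifier_ramp i a h eps x)) /\
      `|\int[lambda]_x (g x * mollifier_ramp i a h eps x)| <= C * (eps + h).
    have mr := measurable_mollifier_ramp i a h e0.
    have r0 x : 0 <= mollifier_ramp i a h eps x by rewrite mollifier_ramp_ge0// ltW.
    apply: (@Rintegral_le_ae _ _ _ _ _ _ (fun x => C * mollifier_ramp i a h eps x)) => //.
    - exact: measurable_funM.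
    - exact: measurable_funM.
    - by move=> x; rewrite mulr_ge0.
    - move: aeC; apply: filterS => x /(_ I) sC _.
      rewrite normrM [X in _ * X]ger0_norm//.
      by rewrite ler_wpM2r// /C le_max sC.
    under eq_integral do rewrite EFinM.
    rewrite ge0_integralZl//; last 2 first.
    - exact/measurable_EFinP.
    - by move=> x _; rewrite lee_fin.
    by rewrite EFinM lee_wpmul2l ?lee_fin// integral_mollifier_ramp// ltW.
  have -> : sigma b - sigma a = - (mollified b eps - sigma b) +
      (mollified a eps - sigma a) - (mollified a eps - mollified b eps) by ring.
  rewrite dE opprK.
  by do 2 (apply: le_trans (ler_normD _ _) _; rewrite lerD//); rewrite normrN.
apply/ler_addgt0Pr => eta eta0.
(* The losses are [eta'] at each of the two points and [C * eps] with [eps <= eta']: together at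
   most [(2 + C) * eta' = eta]. *)
pose eta' := eta / (2 + C).
have C2 : 0 < 2 + C by rewrite ltr_pwDl.
have eta'0 : 0 < eta' by rewrite divr_gt0.
have [ea ea0 ha] := continuous_norm a eta'0.
have [eb eb0 hb] := continuous_norm b eta'0.
pose eps := Num.min (Num.min ea eb) eta'.
have e0 : 0 < eps by rewrite !lt_min ea0 eb0.
have := key eta' eps eta'0 e0.
have [xa xb xe] : [/\ eps <= ea, eps <= eb & eps <= eta'].
  by rewrite /eps !ge_min !lexx ?orbT.
move=> /(_ (fun x xe => ha x (le_trans xe xa)) (fun x xe => hb x (le_trans xe xb))).
move=> /le_trans; apply.
have eE : eta = eta' * (2 + C) by rewrite divfK// gt_eqF.
have := ler_wpM2l Cge0 xe; rewrite eE; lra.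
Qed.

Lemma continuous_W1infty_lipschitz :
  exists2 L, 0 <= L & forall x y, `|sigma x - sigma y| <= L * `|x - y|.
Proof.
have Cc i : exists C, 0 <= C /\
    forall a h, 0 < h -> `|sigma (a + h *: delta_mx ord0 i) - sigma a| <= C * h.
  by have [C C0 HC] := coordinate_step i; exists C.
have [C HC] := choice Cc.
pose L := \sum_i C i.
have CL i : C i <= L.
  by rewrite /L (bigD1 i)//= lerDl sumr_ge0// => j _; case: (HC j).
have L0 : 0 <= L by apply: sumr_ge0 => j _; case: (HC j).
exists (n%:R * L); first by rewrite mulr_ge0.
apply: coordinate_lipschitz => // i x h.
have [h0|h0|<-] := ltgtP 0 h; last by rewrite scale0r addr0 subrr !normr0 mulr0.
  rewrite (gtr0_norm h0); apply: le_trans ((HC i).2 _ _ h0) _.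
  by rewrite ler_wpM2r// ltW.
(* For negative [h], take the positive step [- h] from the other end point. *)
rewrite (ltr0_norm h0); set y := x + _.
have xE : x = y + (- h) *: delta_mx ord0 i by rewrite /y scaleNr addrK.
rewrite distrC {1}xE; apply: le_trans ((HC i).2 _ _ _) _; first by rewrite oppr_gt0.
by rewrite ler_wpM2r// oppr_ge0 ltW.
Qed.

End lipschitz_of_weak_derivative.

Lemma expRN_le1 (R : realType) (a : R) : 0 <= a -> expR (- a) <= 1.
Proof. by move=> a0; rewrite -(expR0 R) ler_expR oppr_le0. Qed.

Lemma expRN_lipschitz (R : realType) (a b : R) : 0 <= a -> 0 <= b ->
  `|expR (- a) - expR (- b)| <= `|a - b|.
Proof.
wlog ab : a b / a <= b => [H|] a0 b0.
  have [/H->//|/ltW/H h] := leP a b.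
  by rewrite distrC [leRHS]distrC h.
have e1 := expRN_le1 a0; have e0 := expR_ge0 (- a).
have e2 : 1 - (b - a) <= expR (- (b - a)).
  by have := expR_ge1Dx (- (b - a)).
have e3 : expR (- b) = expR (- a) * expR (- (b - a)) by rewrite -expRD; congr expR; ring.
have e4 : expR (- (b - a)) <= 1 by apply: expRN_le1; rewrite subr_ge0.
rewrite ger0_norm; last by rewrite e3; nra.
rewrite distrC ger0_norm ?subr_ge0// e3; nra.
Qed.

(** * The one-step operator and the weak error *)

Section mc_step.
Context {R : realType} (n : nat).
Local Notation V := 'rV[R]_n.
Local Notation lambda := (lebesgue_row R n).
Variable Omega : set V.
Hypothesis mO : measurable Omega.
Hypothesis O_gt0 : (0 < lambda Omega)%E.
Hypothesis O_lty : (lambda Omega < +oo)%E.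
Variable vmax : R.
Hypothesis vmax_ge0 : 0 <= vmax.
Hypothesis O_bnd : forall v, Omega v -> `|v| <= vmax.
Variables (sigma : V -> R) (S Ls : R).
Hypothesis msigma : measurable_fun setT (sigma : V -> measurableTypeR R).
Hypothesis sigma_ge0 : forall x, 0 <= sigma x.
Hypothesis sigma_le : forall x, sigma x <= S.
Hypothesis Ls_ge0 : 0 <= Ls.
Hypothesis sigma_lip : forall x y, `|sigma x - sigma y| <= Ls * `|x - y|.

Definition xlipschitz (g : V * V -> R) (L : R) :=
  forall x y v, Omega v -> `|g (x, v) - g (y, v)| <= L * `|x - y|.

(** The operator [Q]. Both the rate and [g] are sampled at the end of the flight, which is what
    keeps them fixed along a characteristic in [shear_shift]. *)
Definition mc_step (dt : R) (g : V * V -> R) (z : V * V) : R :=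
  let x := z.1 + dt *: z.2 in
  expR (- (sigma x * dt)) * g (x, z.2) +
  (1 - expR (- (sigma x * dt))) * vmean Omega (fun w => g (x, w)).

(** Minus the collision operator applied to [g (x, .)]. *)
Definition deviation (g : V * V -> R) (x v : V) : R :=
  g (x, v) - vmean Omega (fun w => g (x, w)).

Lemma measurable_slice (g : V * V -> R) x : measurable_fun setT g ->
  measurable_fun setT (fun w => g (x, w)).
Proof.
by move=> mg; apply: (measurableT_comp mg); exact: measurable_fun_pair.
Qed.

Lemma xsupported_vmean g B rho x : xsupported Omega g B rho ->
  `|vmean Omega (fun w => g (x, w))| <= B.
Proof.
move=> [mg gB _]; apply: (vmean_bound mO) => //; first exact: measurable_slice.
by move=> v Ov; exact: gB.
Qed.

Lemma xsupported_vmean0 g B rho x : xsupported Omega g B rho -> rho < `|x| ->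
  vmean Omega (fun w => g (x, w)) = 0.
Proof.
move=> [mg gB gr] xr; rewrite /vmean (_ : \int[_]_(w in _) _ = 0) ?mulr0//.
rewrite -[RHS](mul0r (fine (lambda Omega))) -Rintegral_cst//.
by apply: eq_Rintegral => w /set_mem Ow; rewrite gr.
Qed.

Lemma xlipschitz_vmean g B L rho x y : xsupported Omega g B rho -> xlipschitz g L ->
  `|vmean Omega (fun w => g (x, w)) - vmean Omega (fun w => g (y, w))| <= L * `|x - y|.
Proof.
move=> [mg gB _] gL.
rewrite (vmeanB mO O_lty (c := B)); try exact: measurable_slice; try by move=> v Ov; exact: gB.
apply: (vmean_bound mO) => //.
  by apply: measurable_funB; exact: measurable_slice.
by move=> v Ov; exact: gL.
Qed.

Let rate_le1 dt x : 0 <= dt -> 0 <= expR (- (sigma x * dt)) <= 1.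
Proof. by move=> dt0; rewrite expR_ge0 expRN_le1// mulr_ge0. Qed.

Lemma rate_lipschitz dt x y : 0 <= dt ->
  `|expR (- (sigma x * dt)) - expR (- (sigma y * dt))| <= Ls * dt * `|x - y|.
Proof.
move=> dt0; apply: le_trans (expRN_lipschitz _ _) _; rewrite ?mulr_ge0//.
by rewrite -mulrBl normrM (ger0_norm dt0) mulrAC ler_wpM2r.
Qed.

Lemma rate_near1 dt x : 0 <= dt -> `|expR (- (sigma x * dt)) - 1| <= S * dt.
Proof.
move=> dt0; rewrite -(expR0 R) -oppr0.
apply: le_trans (expRN_lipschitz _ (lexx 0)) _; first by rewrite mulr_ge0.
by rewrite subr0 ger0_norm ?mulr_ge0// ler_wpM2r.
Qed.

Lemma convex_bound (e a b c : R) : 0 <= e <= 1 -> `|a| <= c -> `|b| <= c ->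
  `|e * a + (1 - e) * b| <= c.
Proof.
move=> /andP[e0 e1] ac bc.
apply: le_trans (ler_normD _ _) _; have e1' : 0 <= 1 - e by rewrite subr_ge0.
rewrite !normrM (ger0_norm e0) (ger0_norm e1').
apply: le_trans (lerD (ler_wpM2l e0 ac) (ler_wpM2l e1' bc)) _.
by rewrite -mulrDl addrCA subrr addr0 mul1r.
Qed.

Lemma measurable_mc_step dt g : measurable_fun setT g -> measurable_fun setT (mc_step dt g).
Proof.
move=> mg.
have mx : measurable_fun setT (fun z : V * V => z.1 + dt *: z.2).
  exact: (measurableT_comp measurable_fst (measurable_shear dt)).
have me : measurable_fun setT (fun z : V * V => expR (- (sigma (z.1 + dt *: z.2) * dt))).
  apply: measurableT_comp => //; apply: measurableT_comp => //.
  by apply: measurable_funM => //; exact: (measurableT_comp msigma mx).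
apply: measurable_funD; apply: measurable_funM => //.
- exact: (measurableT_comp mg (measurable_shear dt)).
- exact: measurable_funB.
- exact: (measurableT_comp (measurable_vmean mO mg) mx).
Qed.

Lemma xsupported_mc_step dt g B rho : 0 <= dt -> xsupported Omega g B rho ->
  xsupported Omega (mc_step dt g) B (rho + dt * vmax).
Proof.
move=> dt0 xg; have [mg gB gr] := xg; split; first exact: measurable_mc_step.
  by move=> z Oz; apply: convex_bound; [exact: rate_le1|exact: gB|exact: xsupported_vmean xg].
move=> z Oz zr.
have xr : rho < `|z.1 + dt *: z.2|.
  have h1 : `|z.1| <= `|z.1 + dt *: z.2| + `|dt *: z.2|.
    by rewrite -{1}(addrK (dt *: z.2) z.1) ler_normB.
  rewrite normrZ (ger0_norm dt0) in h1.
  have h2 := ler_wpM2l dt0 (O_bnd Oz); lra.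
by rewrite /mc_step gr// (xsupported_vmean0 xg)// !mulr0 addr0.
Qed.

(** Convex combinations and velocity averages do not amplify [L]; only the variation of the rate
    costs something, its Lipschitz constant [Ls * dt] times the oscillation [2 * B]. The growth is
    additive, hence linear in the number of steps. *)
Lemma xlipschitz_mc_step dt g B L rho : 0 <= dt -> 0 <= L ->
  xsupported Omega g B rho -> xlipschitz g L ->
  xlipschitz (mc_step dt g) (L + 2 * B * Ls * dt).
Proof.
move=> dt0 L0 xg gL x y v Ov; have [mg gB gr] := xg.
rewrite /mc_step/=; set x' := x + _; set y' := y + _.
have xy : x' - y' = x - y by rewrite /x' /y' opprD addrACA subrr addr0.
set ex := expR (- (sigma x' * dt)); set ey := expR (- (sigma y' * dt)).
set mx := vmean _ (fun w => g (x', w)); set my := vmean _ (fun w => g (y', w)).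
have -> : ex * g (x', v) + (1 - ex) * mx - (ey * g (y', v) + (1 - ey) * my) =
    (ex * (g (x', v) - g (y', v)) + (1 - ex) * (mx - my)) +
    (ex - ey) * (g (y', v) - my) by ring.
apply: le_trans (ler_normD _ _) _; rewrite [leRHS]mulrDl lerD//.
  apply: convex_bound; first exact: rate_le1.
    by rewrite -xy; exact: gL.
  by rewrite -xy; exact: xlipschitz_vmean xg gL.
have h1 : `|ex - ey| <= Ls * dt * `|x - y| by rewrite -xy; exact: rate_lipschitz.
have h2 : `|g (y', v) - my| <= 2 * B.
  apply: le_trans (ler_normB _ _) _.
  have := gB (y', v) Ov; have := xsupported_vmean y' xg; rewrite -/my; lra.
rewrite normrM; apply: le_trans (ler_pM _ _ h1 h2) _ => //.
by rewrite le_eqVlt; apply/orP; left; apply/eqP; ring.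
Qed.

(** The two terms are the displacement during the flight, at most [dt * vmax], and the collision
    probability, at most [S * dt]. *)
Lemma mc_step_near dt g B L rho z : 0 <= dt -> 0 <= L ->
  xsupported Omega g B rho -> xlipschitz g L -> Omega z.2 ->
  `|mc_step dt g z - g z| <= dt * (L * vmax + 2 * B * S).
Proof.
case: z => x v /= dt0 L0 xg gL Ov; have [mg gB gr] := xg.
rewrite /mc_step/=; set x' := x + _.
set e := expR _; set m := vmean _ _.
have -> : e * g (x', v) + (1 - e) * m - g (x, v) =
   (g (x', v) - g (x, v)) + (1 - e) * (m - g (x', v)) by ring.
apply: le_trans (ler_normD _ _) _; rewrite [leRHS]mulrDr lerD//.
  apply: le_trans (gL _ _ _ Ov) _.
  rewrite /x' addrC addKr normrZ (ger0_norm dt0).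
  by rewrite mulrCA !ler_wpM2l// O_bnd.
have h1 : `|1 - e| <= S * dt by rewrite distrC; exact: rate_near1.
have h2 : `|m - g (x', v)| <= 2 * B.
  apply: le_trans (ler_normB _ _) _.
  have := gB (x', v) Ov; have := xsupported_vmean x' xg; rewrite -/m; lra.
rewrite normrM; apply: le_trans (ler_pM _ _ h1 h2) _ => //.
by rewrite le_eqVlt; apply/orP; left; apply/eqP; ring.
Qed.

(** The first expression is the [s]-derivative of the one-step operator along a characteristic, with
    [dt] left to fly; the second is its value with nothing left to fly. The three terms of the bound
    come from moving [sigma], dropping the exponential and moving [deviation]. *)
Lemma collision_near dt g B L rho x v : 0 <= dt -> 0 <= L ->
  xsupported Omega g B rho -> xlipschitz g L -> Omega v ->
  `|sigma (x + dt *: v) * expR (- (sigma (x + dt *: v) * dt)) *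
      deviation g (x + dt *: v) v - sigma x * deviation g x v| <=
    dt * (2 * B * Ls * vmax + 2 * B * S ^+ 2 + 2 * S * L * vmax).
Proof.
move=> dt0 L0 xg gL Ov; have [mg gB gr] := xg.
set x' := x + _; pose G y := deviation g y v; rewrite -/(G x') -/(G x).
have S0 : 0 <= S := le_trans (sigma_ge0 0) (sigma_le 0).
have GB y : `|G y| <= 2 * B.
  apply: le_trans (ler_normB _ _) _.
  have := gB (y, v) Ov; have := xsupported_vmean y xg; lra.
have B0 : 0 <= B := le_trans (normr_ge0 _) (gB (0, v) Ov).
have xx : `|x' - x| <= dt * vmax.
  rewrite /x' addrC addKr normrZ (ger0_norm dt0) ler_wpM2l//; exact: O_bnd.
set e := expR _.
have /andP[e0 e1] : 0 <= e <= 1 by exact: rate_le1.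
have -> : sigma x' * e * G x' - sigma x * G x =
   (sigma x' - sigma x) * (e * G x') + sigma x * (e - 1) * G x' + sigma x * (G x' - G x).
  by ring.
have h1 : `|(sigma x' - sigma x) * (e * G x')| <= (Ls * (dt * vmax)) * (1 * (2 * B)).
  rewrite normrM ler_pM//.
    by apply: le_trans (sigma_lip _ _) _; rewrite ler_wpM2l.
  by rewrite normrM ler_pM// ger0_norm.
have h2 : `|sigma x * (e - 1) * G x'| <= S * (S * dt) * (2 * B).
  rewrite !normrM !ler_pM ?mulr_ge0//; first by rewrite ger0_norm.
  exact: rate_near1.
have h3 : `|sigma x * (G x' - G x)| <= S * (2 * L * (dt * vmax)).
  rewrite normrM ler_pM//; first by rewrite ger0_norm.
  rewrite /G /deviation opprD addrACA -opprD; apply: le_trans (ler_normB _ _) _.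
  have := gL x' x v Ov; have := xlipschitz_vmean x' x xg gL.
  have := ler_wpM2l L0 xx; lra.
apply: le_trans (ler_normD _ _) _.
apply: le_trans (lerD (le_trans (ler_normD _ _) (lerD h1 h2)) h3) _.
by rewrite le_eqVlt; apply/orP; left; apply/eqP; ring.
Qed.

Lemma xsupported_iter dt g B rho k : 0 <= dt -> xsupported Omega g B rho ->
  xsupported Omega (iter k (mc_step dt) g) B (rho + k%:R * (dt * vmax)).
Proof.
move=> dt0 xg; elim: k => [|k IH]; first by rewrite mul0r addr0.
by rewrite -natr1 mulrDl mul1r addrA iterS; exact: xsupported_mc_step.
Qed.

Lemma xlipschitz_iter dt g B L rho k : 0 <= dt -> 0 <= L -> 0 <= B ->
  xsupported Omega g B rho -> xlipschitz g L ->
  xlipschitz (iter k (mc_step dt) g) (L + k%:R * (2 * B * Ls * dt)).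
Proof.
move=> dt0 L0 B0 xg gL; elim: k => [|k IH]; first by rewrite mul0r addr0.
rewrite -natr1 mulrDl mul1r addrA iterS.
apply: xlipschitz_mc_step IH => //; last exact: (xsupported_iter k dt0 xg).
by rewrite addr_ge0// !mulr_ge0.
Qed.

End mc_step.

Lemma lipschitz_within_continuous (R : realType) (W : R -> R) (a b C : R) :
  0 <= C ->
  (forall s u, s \in `[a, b] -> u \in `[a, b] -> `|W s - W u| <= C * `|s - u|) ->
  {within `[a, b], continuous W}.
Proof.
move=> C0 WC; apply/subspace_continuousP => s sab.
apply/cvgrPdist_le => e e0.
have eC : 0 < e / (C + 1) by rewrite divr_gt0// ltr_wpDl.
have N : nbhs s (fun u => `|s - u| <= e / (C + 1)).
  by apply/nbhs_ballP; exists (e / (C + 1)) => // u /ltW.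
near=> u.
have uab : u \in `[a, b] by near: u; exact: withinT.
apply: le_trans (WC _ _ sab uab) _.
have : `|s - u| <= e / (C + 1) by near: u; apply: filterS N => x.
rewrite ler_pdivlMr ?ltr_wpDl//.
have := normr_ge0 (s - u); nra.
Unshelve. all: by end_near. Qed.

(** The derivative is given only inside the interval, as the transport equation is only posed for
    [0 < t < T]; continuity carries the estimate to the end points. *)
Lemma derive_bound_lipschitz (R : realType) (u du : R -> R) (a b C : R) :
  (forall s, s \in `]a, b[ -> is_derive s 1 u (du s)) ->
  (forall s, s \in `]a, b[ -> `|du s| <= C) ->
  {within `[a, b], continuous u} ->
  forall s r, s \in `[a, b] -> r \in `[a, b] -> `|u s - u r| <= C * `|s - r|.
Proof.
move=> Du duC cu s r; wlog rs : s r / r < s => [H|] sab rab.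
  have [rs|sr|->] := ltgtP r s; first exact: H.
    by rewrite distrC [X in C * X]distrC; exact: H.
  by rewrite !subrr !normr0 mulr0.
move: sab rab; rewrite !in_itv/= => /andP[as_ sb] /andP[ar rb].
have sub x : x \in `]r, s[ -> x \in `]a, b[.
  by rewrite !in_itv/= => /andP[? ?]; apply/andP; split; lra.
have [|c crs ->] := MVT rs (fun x xrs => Du x (sub x xrs)).
  apply: continuous_subspaceW cu => x /=; rewrite !in_itv/= => /andP[? ?].
  by apply/andP; split; lra.
by rewrite normrM ler_wpM2r// duC// sub.
Qed.

(** * Weak error of one time step and its accumulation *)

Section weak_error.
Context {R : realType} (n : nat).
Local Notation V := 'rV[R]_n.
Local Notation lambda := (lebesgue_row R n).
Variable Omega : set V.
Hypothesis mO : measurable Omega.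
Hypothesis O_gt0 : (0 < lambda Omega)%E.
Hypothesis O_lty : (lambda Omega < +oo)%E.
Variable vmax : R.
Hypothesis vmax_ge0 : 0 <= vmax.
Hypothesis O_bnd : forall v, Omega v -> `|v| <= vmax.
Variables (sigma : V -> R) (S Ls : R).
Hypothesis msigma : measurable_fun setT (sigma : V -> measurableTypeR R).
Hypothesis sigma_ge0 : forall x, 0 <= sigma x.
Hypothesis sigma_le : forall x, sigma x <= S.
Hypothesis Ls_ge0 : 0 <= Ls.
Hypothesis sigma_lip : forall x y, `|sigma x - sigma y| <= Ls * `|x - y|.
Variables (T b : R) (F : R -> V * V -> R).
Hypothesis T_gt0 : 0 < T.
Hypothesis b_ge0 : 0 <= b.
Hypothesis mF : forall s : R, 0 <= s <= T -> measurable_fun setT (F s).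
Hypothesis F_bnd : forall (s : R) (z : V * V), 0 <= s <= T -> Omega z.2 -> `|F s z| <= b.
Hypothesis F_cont : forall y v : V, Omega v ->
  {within `[0, T], continuous (fun s : R => F s (y + s *: v, v))}.
Hypothesis F_eq : forall (s : R) (y v : V), 0 < s < T -> Omega v ->
  is_derive s 1 (fun s : R => F s (y + s *: v, v))
    (sigma (y + s *: v) * (vmean Omega (fun w => F s (y + s *: v, w)) - F s (y + s *: v, v))).

Local Notation "'I' H" := (\int[(lambda \x lambda)%E]_(z in [set: V] `*` Omega) H z)
  (at level 10, H at level 8).
Local Notation step := (mc_step Omega sigma).

Let S_ge0 : 0 <= S := le_trans (sigma_ge0 0) (sigma_le 0).

Lemma xsupportedW (H : V * V -> R) (c c' rho rho' : R) : c <= c' -> rho <= rho' ->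
  xsupported Omega H c rho -> xsupported Omega H c' rho'.
Proof.
move=> cc rr [mH Hc Hr]; split => //.
  by move=> z Oz; apply: le_trans cc; exact: Hc.
by move=> z Oz rz; apply: Hr => //; exact: le_lt_trans rr rz.
Qed.

Lemma xsupportedM (H G : V * V -> R) (c d rho : R) : measurable_fun setT H ->
  (forall z, Omega z.2 -> `|H z| <= c) -> xsupported Omega G d rho ->
  xsupported Omega (fun z => H z * G z) (c * d) rho.
Proof.
move=> mH Hc [mG Gd Gr]; split.
- exact: measurable_funM.
- by move=> z Oz; rewrite normrM ler_pM// ?Hc ?Gd.
- by move=> z Oz rz; rewrite Gr// mulr0.
Qed.

Lemma xsupportedD (H G : V * V -> R) (c d rho : R) : xsupported Omega H c rho -> xsupported Omega G d rho ->
  xsupported Omega (fun z => H z + G z) (c + d) rho.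
Proof.
move=> [mH Hc Hr] [mG Gd Gr]; split.
- exact: measurable_funD.
- by move=> z Oz; apply: le_trans (ler_normD _ _) _; rewrite lerD ?Hc ?Gd.
- by move=> z Oz rz; rewrite Hr ?Gr ?addr0.
Qed.

Section one_step.
Variables (t t' B L rho : R) (g : V * V -> R).
Hypothesis t_ge0 : 0 <= t.
Hypothesis tt' : t < t'.
Hypothesis t'T : t' <= T.
Hypothesis B_ge0 : 0 <= B.
Hypothesis L_ge0 : 0 <= L.
Hypothesis xg : xsupported Omega g B rho.
Hypothesis gL : xlipschitz Omega g L.

Let inT (s : R) : s \in `[t, t'] -> 0 <= s <= T.
Proof.
rewrite in_itv/= => /andP[h1 h2].
by rewrite (le_trans t_ge0 h1) (le_trans h2 t'T).
Qed.

Let inTo (s : R) : s \in `]t, t'[ -> 0 < s < T.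
Proof.
rewrite in_itv/= => /andP[h1 h2].
by rewrite (le_lt_trans t_ge0 h1) (lt_le_trans h2 t'T).
Qed.

Let oc (s : R) : s \in `]t, t'[ -> s \in `[t, t'].
Proof. by rewrite !in_itv/= => /andP[h1 h2]; rewrite !ltW. Qed.

Let tau_ge0 (s : R) : s \in `[t, t'] -> 0 <= t' - s.
Proof. by rewrite in_itv/= subr_ge0 => /andP[]. Qed.

(** A support radius valid for every [s]: the flight costs [(t' - s) * vmax] and the shear
    [s * vmax], together at most [T * vmax]. *)
Let rho2 := rho + T * vmax.

Let w (s : R) (z : V * V) : R := F s (z.1 + s *: z.2, z.2) * step (t' - s) g (z.1 + s *: z.2, z.2).

Let loss (tau : R) (z : V * V) : R := sigma (z.1 + tau *: z.2) * expR (- (sigma (z.1 + tau *: z.2) * tau)) *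
  deviation Omega g (z.1 + tau *: z.2) z.2.

Let gain (s : R) (z : V * V) : R := sigma z.1 * (vmean Omega (fun v => F s (z.1, v)) - F s z).

Let h (s : R) (z : V * V) : R := gain s z * step (t' - s) g z + F s z * loss (t' - s) z.

(* [w s z] is the pairing along the characteristic through [z] and [h] its        *)
(* [s]-derivative before shearing. Integrated over velocities, [gain] and [loss]  *)
(* cancel to leading order by [vmean_symmetric]. *)
Let shear_shift (z : V * V) (s : R) : z.1 + s *: z.2 + (t' - s) *: z.2 = z.1 + t' *: z.2.
Proof. by rewrite -addrA -scalerDl subrKC. Qed.

(** The one-step operator along the characteristic through [z]. Everything sits at the fixed point
    [z.1 + t' *: z.2], so [s] enters through the exponential alone. *)
Let k (z : V * V) (s : R) : R :=
  expR (- (sigma (z.1 + t' *: z.2) * (t' - s))) * deviation Omega g (z.1 + t' *: z.2) z.2 +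
  vmean Omega (fun v => g (z.1 + t' *: z.2, v)).

Let stepE (z : V * V) (s : R) : step (t' - s) g (z.1 + s *: z.2, z.2) = k z s.
Proof. by rewrite /mc_step/= shear_shift /k /deviation; ring. Qed.

Let wE (z : V * V) : w ^~ z = fun s => F s (z.1 + s *: z.2, z.2) * k z s.
Proof. by apply/funext => s; rewrite /w stepE. Qed.

Let k_derive (z : V * V) (s : R) : is_derive s 1 (k z)
  (expR (- (sigma (z.1 + t' *: z.2) * (t' - s))) * sigma (z.1 + t' *: z.2) *
   deviation Omega g (z.1 + t' *: z.2) z.2).
Proof.
rewrite -[X in is_derive _ _ _ X]addr0 /k.
set x' := z.1 + t' *: z.2; set D := deviation _ _ _ _; set m := vmean _ _.
apply: (@is_deriveD _ _ _ (fun u : R => expR (- (sigma x' * (t' - u))) * D) (fun=> m)).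
have de : is_derive s 1 (fun u : R => expR (- (sigma x' * (t' - u))))
    (expR (- (sigma x' * (t' - s))) * sigma x').
  apply: (@is_derive1_comp R expR (fun u : R => - (sigma x' * (t' - u)))).
  have -> : (fun u : R => - (sigma x' * (t' - u))) =
      (fun u : R => sigma x' * u + - (sigma x' * t')).
    by apply/funext => u; ring.
  have := is_deriveD (is_deriveZ (sigma x') (is_derive_id s (1 : R)))
    (is_derive_cst (- (sigma x' * t')) s (1 : R)).
  by rewrite addr0 -[_ *: _]/(_ * _) mulr1.
rewrite mulrC -[X in is_derive _ _ _ X]add0r.
rewrite -[X in is_derive _ _ _ (X + _)](mulr0 (expR (- (sigma x' * (t' - s))))).
exact: (is_deriveM de (is_derive_cst D s (1 : R))).
Qed.

Let w_derive (s : R) (z : V * V) : s \in `]t, t'[ -> Omega z.2 ->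
  is_derive s 1 (w ^~ z) (h s (z.1 + s *: z.2, z.2)).
Proof.
move=> st Oz; have dF := F_eq z.1 (inTo st) Oz; rewrite wE.
rewrite /h /gain /loss /= shear_shift stepE.
rewrite addrC [_ * k z s]mulrC [_ * expR _]mulrC.
exact: (is_deriveM dF (k_derive z s)).
Qed.

Let rate_bnd (tau : R) (x : V) : 0 <= tau -> `|sigma x * expR (- (sigma x * tau))| <= S.
Proof.
move=> tau0; rewrite ger0_norm ?mulr_ge0 ?expR_ge0//.
by rewrite -[S]mulr1 ler_pM ?expR_ge0// expRN_le1// mulr_ge0.
Qed.

Let xdev : xsupported Omega (fun z => deviation Omega g z.1 z.2) (2 * B) rho.
Proof.
have [mg gB gr] := xg; split.
- apply: measurable_funB.
    by under eq_fun do rewrite -surjective_pairing.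
  exact: (measurableT_comp (measurable_vmean mO mg) measurable_fst).
- move=> z Oz; apply: le_trans (ler_normB _ _) _.
  have := gB (z.1, z.2) Oz; have := xsupported_vmean mO O_gt0 O_lty z.1 xg; lra.
- move=> z Oz rz; rewrite /deviation (xsupported_vmean0 mO xg rz).
  by rewrite (gr (z.1, z.2)) ?subr0.
Qed.

Let xloss (tau : R) : 0 <= tau -> xsupported Omega (loss tau) (S * (2 * B)) (rho + tau * vmax).
Proof.
move=> tau0; have [mg gB gr] := xg.
have mx : measurable_fun setT (fun z : V * V => z.1 + tau *: z.2).
  exact: (measurableT_comp measurable_fst (measurable_shear tau)).
have msx : measurable_fun setT (fun z : V * V => sigma (z.1 + tau *: z.2)).
  exact: (measurableT_comp msigma mx).
have := xsupported_shear O_bnd tau xdev; rewrite (ger0_norm tau0); apply: xsupportedM.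
- apply: measurable_funM => //; apply: measurableT_comp => //.
  by apply: measurableT_comp => //; exact: measurable_funM.
- by move=> z _; exact: rate_bnd.
Qed.

Let vmeanF_bnd (s : R) (x : V) : 0 <= s <= T -> `|vmean Omega (fun v => F s (x, v))| <= b.
Proof.
move=> sT; apply: (vmean_bound mO) => //.
  by apply: measurable_slice; exact: mF.
by move=> v Ov; exact: F_bnd.
Qed.

Let mgain (s : R) : 0 <= s <= T -> measurable_fun setT (gain s).
Proof.
move=> sT; apply: measurable_funM; first exact: (measurableT_comp msigma measurable_fst).
apply: measurable_funB; last exact: mF.
by apply: (measurableT_comp (measurable_vmean mO (mF sT)) measurable_fst).
Qed.

Let gain_bnd (s : R) (z : V * V) : 0 <= s <= T -> Omega z.2 -> `|gain s z| <= S * (2 * b).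
Proof.
move=> sT Oz; rewrite normrM ler_pM//; first by rewrite ger0_norm.
apply: le_trans (ler_normB _ _) _.
have := vmeanF_bnd z.1 sT; have := F_bnd sT Oz; lra.
Qed.

Let Cd := S * (2 * b) * B + b * (S * (2 * B)).

Let xh (s : R) : s \in `[t, t'] -> xsupported Omega (h s) Cd (rho + (t' - s) * vmax).
Proof.
move=> st; have tau0 := tau_ge0 st; have sT := inT st.
apply: xsupportedD; apply: xsupportedM.
- exact: mgain.
- by move=> z; exact: gain_bnd.
- exact: xsupported_mc_step.
- exact: mF.
- by move=> z; exact: F_bnd.
- exact: xloss.
Qed.

Let shear_rho2 (s : R) : s \in `[t, t'] -> rho + (t' - s) * vmax + `|s| * vmax <= rho2.
Proof.
move=> st; have /andP[s0 _] := inT st; rewrite (ger0_norm s0) -addrA -mulrDl subrK.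
by rewrite /rho2 lerD2l ler_wpM2r.
Qed.

Let xdw (s : R) : s \in `[t, t'] ->
  xsupported Omega (fun z => h s (z.1 + s *: z.2, z.2)) Cd rho2.
Proof.
move=> st; apply: xsupportedW (lexx _) (shear_rho2 st) _.
by apply: xsupported_shear => //; exact: xh.
Qed.

Let xFstep (s : R) : s \in `[t, t'] ->
  xsupported Omega (fun z => F s z * step (t' - s) g z) (b * B) (rho + (t' - s) * vmax).
Proof.
move=> st; apply: xsupportedM.
- by apply: mF; exact: inT.
- by move=> z; apply: F_bnd; exact: inT.
- by apply: xsupported_mc_step => //; exact: tau_ge0.
Qed.

Let xw (s : R) : s \in `[t, t'] -> xsupported Omega (w s) (b * B) rho2.
Proof.
move=> st; apply: xsupportedW (lexx _) (shear_rho2 st) _.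
exact: (xsupported_shear O_bnd s (xFstep st)).
Qed.

Let Cd_ge0 : 0 <= Cd.
Proof. by rewrite addr_ge0// !mulr_ge0. Qed.

Let within_char (z : V * V) : Omega z.2 -> {within `[t, t'], continuous (w ^~ z)}.
Proof.
move=> Oz; rewrite wE => s.
have cF : {within `[t, t'], continuous (fun s : R => F s (z.1 + s *: z.2, z.2))}.
  have sub : `[t, t']%classic `<=` `[0, T]%classic by move=> x /inT; rewrite /= in_itv.
  exact: (continuous_subspaceW sub (@F_cont z.1 z.2 Oz)).
have ck : {within `[t, t'], continuous (k z)}.
  apply: continuous_subspaceT => x; apply: differentiable_continuous.
  by apply/derivable1_diffP; case: (k_derive z x).
exact: (continuousM (cF s) (ck s)).
Qed.

Let w_lipschitz (z : V * V) (s u : R) : Omega z.2 -> s \in `[t, t'] -> u \in `[t, t'] ->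
  `|w s z - w u z| <= Cd * `|s - u|.
Proof.
move=> Oz; apply: (derive_bound_lipschitz (u := w ^~ z) (fun r rt => w_derive rt Oz)).
  by move=> r /oc rt; have [_ + _] := xdw rt; exact.
exact: within_char.
Qed.

(** This is [h s] with the remaining flight time [t' - s] replaced by 0. *)
Let main s z := gain s z * g z + F s z * (sigma z.1 * deviation Omega g z.1 z.2).

Let sigma_bnd x : `|sigma x| <= S.
Proof. by rewrite ger0_norm. Qed.

Let msigma1 : measurable_fun setT (fun z : V * V => sigma z.1).
Proof. exact: (measurableT_comp msigma measurable_fst). Qed.

Let xmain (s : R) : s \in `[t, t'] ->
  xsupported Omega (main s) (S * (2 * b) * B + b * (S * (2 * B))) rho.
Proof.
move=> st; have sT := inT st; apply: xsupportedD.
  apply: xsupportedM => //; first exact: mgain.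
  by move=> z; exact: gain_bnd.
apply: xsupportedM; first exact: mF.
  by move=> z; exact: F_bnd.
by apply: xsupportedM.
Qed.

(** With [G = sigma * g], the two local products [F * G] cancel pointwise and what is left is the
    mean of [F] times [G], minus [F] times the mean of [G]: [sigma] does not depend on the velocity
    and goes through the mean. *)
Let main_cancel (s : R) : s \in `[t, t'] -> I (main s) = 0.
Proof.
move=> st; have sT := inT st; have [mg gB gr] := xg.
pose G (z : V * V) := sigma z.1 * g z.
have xG : xsupported Omega G (S * B) rho by exact: xsupportedM.
have [mG _ _] := xG.
have GE (x : V) : vmean Omega (fun v => G (x, v)) = sigma x * vmean Omega (fun v => g (x, v)).
  rewrite /vmean /G/= RintegralZl//; first by rewrite mulrCA.
  exact: (xsupported_slice mO O_lty x xg).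
have x1 : xsupported Omega (fun z => vmean Omega (fun v => F s (z.1, v)) * G z) (b * (S * B)) rho.
  apply: xsupportedM => //; last by move=> z _; exact: vmeanF_bnd.
  exact: (measurableT_comp (measurable_vmean mO (mF sT)) measurable_fst).
have x2 : xsupported Omega (fun z => F s z * vmean Omega (fun v => G (z.1, v))) (b * (S * B)) rho.
  apply: xsupportedM; [exact: mF|by move=> z; exact: F_bnd|].
  split.
  - exact: (measurableT_comp (measurable_vmean mO mG) measurable_fst).
  - by move=> z _; exact: (xsupported_vmean mO O_gt0 O_lty _ xG).
  - by move=> z _ rz; exact: (xsupported_vmean0 mO xG rz).
have -> : main s = fun z => vmean Omega (fun v => F s (z.1, v)) * G z -
    F s z * vmean Omega (fun v => G (z.1, v)).
  apply/funext => -[x v]; rewrite /main /gain /deviation GE /G/=; ring.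
have [i1 _] := xsupported_integral mO O_lty x1.
have [i2 _] := xsupported_integral mO O_lty x2.
rewrite RintegralB//; last exact: measurableX.
rewrite (vmean_symmetric mO O_gt0 O_lty (mF sT) _ xG (b := b)) ?subrr//.
by move=> z; exact: F_bnd.
Qed.

(** The sup bound of [gain] times the constant of [mc_step_near], plus the sup bound of [F] times
    the constant of [collision_near]. *)
Let K1 := S * (2 * b) * (L * vmax + 2 * B * S) +
  b * (2 * B * Ls * vmax + 2 * B * S ^+ 2 + 2 * S * L * vmax).

Let K1_ge0 : 0 <= K1.
Proof. by rewrite addr_ge0// !mulr_ge0// !addr_ge0// !mulr_ge0// exprn_ge0. Qed.

Let h_small (s : R) : s \in `[t, t'] -> `|I (h s)| <= K1 * (t' - s) * cell_volume Omega rho2.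
Proof.
move=> st; have tau0 := tau_ge0 st; have sT := inT st.
have rr : rho <= rho2 by rewrite lerDl mulr_ge0// ltW.
have xhs : xsupported Omega (h s) Cd rho2.
  apply: xsupportedW (lexx _) _ (xh st).
  by apply: le_trans (shear_rho2 st); rewrite lerDl mulr_ge0.
have xms := xsupportedW (lexx _) rr (xmain st).
have D_meas : measurable ([set: V] `*` Omega) by exact: measurableX.
have [ih _] := xsupported_integral mO O_lty xhs.
have [im _] := xsupported_integral mO O_lty xms.
have -> : I (h s) = I (fun z => h s z - main s z).
  by rewrite RintegralB// main_cancel// subr0.
have xr : xsupported Omega (fun z => h s z - main s z) (K1 * (t' - s)) rho2.
  have [mh _ h0] := xhs; have [mm _ m0] := xms; split.
  - exact: measurable_funB.
  - move=> z Oz.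
    have -> : h s z - main s z = gain s z * (step (t' - s) g z - g z) +
        F s z * (loss (t' - s) z - sigma z.1 * deviation Omega g z.1 z.2).
      by rewrite /h /main; ring.
    apply: le_trans (ler_normD _ _) _; rewrite /K1 [leRHS]mulrDl lerD//.
      rewrite normrM -mulrA ler_pM// ?gain_bnd// [leRHS]mulrC.
      exact: (mc_step_near mO O_gt0 O_lty O_bnd sigma_ge0 sigma_le tau0 L_ge0 xg gL).
    rewrite normrM -mulrA ler_pM// ?F_bnd// [leRHS]mulrC.
    exact: (collision_near mO O_gt0 O_lty O_bnd sigma_ge0 sigma_le Ls_ge0 sigma_lip z.1 tau0 L_ge0 xg gL Oz).
  - by move=> z Oz rz; rewrite h0// m0// subr0.
by have [] := xsupported_integral mO O_lty xr.
Qed.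

(** The pairing [W] interpolates between the two integrals, and its derivative at [s] is [I (h s)],
    of order [t' - s] by the cancellation; over the whole interval it varies by [O((t' - t)^2)]. *)
Lemma weak_error_step :
  `|I (fun z => F t' z * g z) - I (fun z => F t z * step (t' - t) g z)| <=
  K1 * (t' - t) ^+ 2 * cell_volume Omega (rho + T * vmax).
Proof.
have tin : t \in `[t, t'] by rewrite in_itv/= lexx ltW.
have t'in : t' \in `[t, t'] by rewrite in_itv/= lexx ltW.
have D_meas : measurable ([set: V] `*` Omega) by exact: measurableX.
have vol0 := @cell_volume_ge0 R n Omega rho2.
pose W s := I (w s).
have WE s : s \in `[t, t'] -> W s = I (fun z => F s z * step (t' - s) g z).
  by move=> st; exact: (Rintegral_shear mO O_lty O_bnd s (xFstep st)).
(* A step of length 0 is the identity. *)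
have -> : I (fun z => F t' z * g z) = W t'.
  rewrite WE//; apply: eq_Rintegral => z _; congr (_ * _).
  rewrite /mc_step subrr scale0r addr0 mulr0 oppr0 expR0 subrr mul0r addr0 mul1r.
  by rewrite -surjective_pairing.
rewrite -WE//.
(* This crude bound only supplies continuity of [W] up to the end points. *)
have Wlip s u : s \in `[t, t'] -> u \in `[t, t'] ->
    `|W s - W u| <= Cd * cell_volume Omega rho2 * `|s - u|.
  move=> st ut.
  have [is_ _] := xsupported_integral mO O_lty (xw st).
  have [iu _] := xsupported_integral mO O_lty (xw ut).
  rewrite /W -RintegralB//.
  have xd : xsupported Omega (fun z => w s z - w u z) (Cd * `|s - u|) rho2.
    have [ms _ s0] := xw st; have [mu _ u0] := xw ut; split.
    - exact: measurable_funB.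
    - by move=> z Oz; exact: w_lipschitz.
    - by move=> z Oz rz; rewrite s0// u0// subr0.
  by have [_] := xsupported_integral mO O_lty xd; rewrite mulrAC.
have cW : {within `[t, t'], continuous W}.
  by apply: lipschitz_within_continuous Wlip; rewrite mulr_ge0.
(* The integrable majorant, independent of [s], for differentiating under the integral sign. *)
pose G (z : V * V) : R := Cd * \1_[set x : V | `|x| <= rho2] z.1.
have mbox := measurable_row_box (n := n) rho2.
have xG : xsupported Omega G Cd rho2.
  split.
  - apply: measurable_funM => //.
    by apply: (measurableT_comp _ measurable_fst); exact: measurable_indic.
  - move=> z Oz; rewrite /G indicE normrM (ger0_norm Cd_ge0) ler_piMr//.
    by case: (_ \in _); rewrite ?normr1 ?normr0.
  - move=> z Oz rz; rewrite /G indicE memNset ?mulr0//=.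
    by apply/negP; rewrite -ltNge.
have [iG _] := xsupported_integral mO O_lty xG.
have dW s : s \in `]t, t'[ -> is_derive s 1 W (I (h s)).
  move=> st.
  have dw r z : `]t, t'[%classic r -> ([set: V] `*` Omega) z ->
      is_derive r 1 (w ^~ z) (h r (z.1 + r *: z.2, z.2)).
    by move=> rt [_ Oz]; exact: w_derive.
  have st' : `]t, t'[%classic s by [].
  have ifw r : `]t, t'[%classic r ->
      (lambda \x lambda)%E.-integrable ([set: V] `*` Omega) (EFin \o w r).
    by move=> rt; have [] := xsupported_integral mO O_lty (xw (oc rt)).
  have derf r z : `]t, t'[%classic r -> ([set: V] `*` Omega) z -> derivable (w ^~ z) r 1.
    by move=> rt Dz; case: (dw r z rt Dz).
  have G0 z : 0 <= G z by rewrite /G mulr_ge0// indicE.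
  have dE r z : `]t, t'[%classic r -> ([set: V] `*` Omega) z ->
      partial1of2 w r z = h r (z.1 + r *: z.2, z.2).
    by move=> rt Dz; rewrite partial1of2E; case: (dw r z rt Dz).
  have Gub r z : `]t, t'[%classic r -> ([set: V] `*` Omega) z -> `|partial1of2 w r z| <= G z.
    move=> rt Dz; rewrite dE//; have [_ hb h0] := xdw (oc rt); have [_ Oz] := Dz.
    rewrite /G indicE; case: (boolP (z.1 \in _)) => [_|].
      by rewrite mulr1; exact: (hb z Oz).
    rewrite notin_setE/= => /negP; rewrite -ltNge => rz.
    by rewrite (h0 z Oz rz) normr0 mulr0.
  split; first exact: (derivable_under_integral D_meas st' ifw derf G0 iG Gub).
  rewrite -derive1E (differentiation_under_integral D_meas st' ifw derf G0 iG Gub).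
  rewrite -(Rintegral_shear mO O_lty O_bnd s (xh (oc st))).
  by apply: eq_Rintegral => z /set_mem Dz; rewrite -dE.
have := derive_bound_lipschitz (C := K1 * (t' - t) * cell_volume Omega rho2) dW _ cW t'in tin.
rewrite (ger0_norm (tau_ge0 tin)) => Wb.
apply: le_trans (Wb _) _.
  move=> s st; apply: le_trans (h_small (oc st)) _.
  rewrite ler_wpM2r// ler_wpM2l// lerD2l lerN2.
  by move: st; rewrite in_itv/= => /andP[/ltW].
by rewrite le_eqVlt; apply/orP; left; apply/eqP; rewrite /rho2; ring.
Qed.

End one_step.

Lemma weak_error (B L rho : R) (g : V * V -> R) : 0 <= B -> 0 <= L ->
  xsupported Omega g B rho -> xlipschitz Omega g L ->
  exists2 C, 0 <= C & forall M : nat, (0 < M)%N ->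
    `|I (fun z => F T z * g z) - I (fun z => F 0 z * iter M (step (T / M%:R)) g z)| <=
    C * (T / M%:R).
Proof.
move=> B0 L0 xg gL.
(* Lipschitz constant and radius valid for all iterates up to [M], because their total flight time
   is at most [T]. Hence [K] does not see [M]. *)
pose L' := L + 2 * B * Ls * T; pose rho' := rho + T * vmax.
have L'0 : 0 <= L' by rewrite addr_ge0// !mulr_ge0// ltW.
pose K := (S * (2 * b) * (L' * vmax + 2 * B * S) +
  b * (2 * B * Ls * vmax + 2 * B * S ^+ 2 + 2 * S * L' * vmax)) *
  cell_volume Omega (rho' + T * vmax).
have K0 : 0 <= K.
  by rewrite mulr_ge0 ?cell_volume_ge0// addr_ge0// !mulr_ge0// !addr_ge0// !mulr_ge0// exprn_ge0.
exists (K * T); first by rewrite mulr_ge0// ltW.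
move=> M M0; set dt := T / M%:R.
have M0' : 0 < M%:R :> R by rewrite ltr0n.
have dt0 : 0 < dt by rewrite divr_gt0.
have Mdt : M%:R * dt = T by rewrite mulrC divfK// gt_eqF.
have mdt m : (m <= M)%N -> m%:R * dt <= T.
  by move=> mM; rewrite -Mdt ler_pM2r// ler_nat.
pose G m := iter m (step dt) g.
have xG m : (m <= M)%N -> xsupported Omega (G m) B rho'.
  move=> mM; apply: xsupportedW (lexx _) _ (xsupported_iter mO O_gt0 O_lty O_bnd msigma sigma_ge0 m (ltW dt0) xg).
  by rewrite /rho' lerD2l mulrA ler_wpM2r// mdt.
have GL m : (m <= M)%N -> xlipschitz Omega (G m) L'.
  move=> mM x y v Ov.
  apply: le_trans (xlipschitz_iter mO O_gt0 O_lty O_bnd msigma sigma_ge0 Ls_ge0 sigma_lip m (ltW dt0) L0 B0 xg gL x y Ov) _.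
  rewrite ler_wpM2r// /L' lerD2l mulrCA ler_wpM2l ?mulr_ge0// mdt//.
(* Exact evolution for [m] steps, then the algorithm for the remaining [M - m]. The [M] increments
   of size [K * dt^2] add up to [K * T * dt]. *)
pose a m := I (fun z => F (m%:R * dt) z * G (M - m)%N z).
have inc m : (m < M)%N -> `|a m.+1 - a m| <= K * dt ^+ 2.
  move=> mM.
  have d : m.+1%:R * dt - m%:R * dt = dt by rewrite -mulrBl -natr1 addrC addKr mul1r.
  have t0 : 0 <= m%:R * dt by rewrite mulr_ge0// ltW.
  have lt : m%:R * dt < m.+1%:R * dt by rewrite ltr_pM2r// ltr_nat.
  have := weak_error_step t0 lt (mdt _ mM) B0 L'0 (xG (M - m.+1)%N (leq_subr _ _))
    (GL (M - m.+1)%N (leq_subr _ _)).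
  rewrite d [X in _ <= X]mulrAC -/K /a (_ : (M - m)%N = (M - m.+1).+1) //.
  by rewrite subnS prednK// subn_gt0.
have tel m : (m <= M)%N -> `|a m - a 0%N| <= m%:R * (K * dt ^+ 2).
  elim: m => [|m IH] mM; first by rewrite subrr normr0 mul0r.
  have -> : a m.+1 - a 0%N = (a m - a 0%N) + (a m.+1 - a m) by ring.
  rewrite -natr1 mulrDl mul1r; apply: le_trans (ler_normD _ _) _.
  by rewrite lerD ?inc// IH// ltnW.
have := tel M (leqnn M).
rewrite /a subnn subn0 Mdt mul0r => /le_trans; apply.
by rewrite le_eqVlt; apply/orP; left; apply/eqP; rewrite -Mdt; ring.
Qed.

End weak_error.

(** * Independence and the law of the particles *)

Section density.
Import HBNNSimple.

(** The density is known through events only; simple functions and monotone convergence on both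
    sides extend it to integrands. *)
Lemma ge0_integral_density d (U : measurableType d) (R : realType)
    (nu mu : {measure set U -> \bar R}) (k : U -> R) (f : U -> \bar R) :
  measurable_fun setT k -> (forall x, 0 <= k x) ->
  (forall A, measurable A -> nu A = \int[mu]_(x in A) (k x)%:E)%E ->
  measurable_fun setT f -> (forall x, 0 <= f x)%E ->
  (\int[nu]_x f x = \int[mu]_x (f x * (k x)%:E))%E.
Proof.
move=> mk k0 nuk mf f0; pose h := nnsfun_approx measurableT mf.
have mkE : measurable_fun setT (EFin \o k) by exact/measurable_EFinP.
have hmono x : {homo (fun n => (h n x)%:E) : a b / (a <= b)%N >-> (a <= b)%E}.
  by move=> a b ab; rewrite lee_fin; exact/lefP/nd_nnsfun_approx.
have hcvg x : (h n x)%:E @[n --> \oo] --> f x by exact: cvg_nnsfun_approx.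
have L : (\int[nu]_x f x = limn (fun n => \int[nu]_x (h n x)%:E))%E.
  rewrite -monotone_convergence//.
  - by apply: eq_integral => x _; apply/esym/cvg_lim.
  - by move=> n; exact/measurable_EFinP.
  - by move=> n x _; rewrite lee_fin.
have M : (\int[mu]_x (f x * (k x)%:E) = limn (fun n => \int[mu]_x ((h n x)%:E * (k x)%:E)))%E.
  rewrite -monotone_convergence//.
  - by apply: eq_integral => x _; apply/esym/cvg_lim => //; apply: cvgeZr.
  - by move=> n; apply: emeasurable_funM => //; exact/measurable_EFinP.
  - by move=> n x _; rewrite mule_ge0// lee_fin.
  - by move=> x _ a b ab; rewrite lee_wpmul2r// ?lee_fin//; exact: hmono.
rewrite L M; congr (limn _); apply/funext => n.
rewrite integralT_nnsfun sintegralE.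
have mind r : measurable_fun setT (fun x => (r * \1_(h n @^-1` [set r]) x)%:E).
  by apply/measurable_EFinP; exact: measurable_funM.
transitivity (\int[mu]_x (\sum_(y \in range (h n))
    ((y * \1_(h n @^-1` [set y]) x)%:E * (k x)%:E)))%E; last first.
  apply: eq_integral => x _.
  rewrite -ge0_mule_fsuml => [|y]; last exact: nnfun_muleindic_ge0.
  by rewrite fsumEFin // -(fimfunE _ x).
rewrite ge0_integral_fsum//; last 2 first.
  - by move=> y; apply: emeasurable_funM.
  - by move=> m y _; apply: mule_ge0; [exact: nnfun_muleindic_ge0|rewrite lee_fin].
apply: eq_fsbigr => r; rewrite inE => -[t _ hr].
rewrite nuk//.
under [RHS]eq_integral do rewrite EFinM -muleA.
rewrite ge0_integralZl//; first last.
- by rewrite -hr lee_fin.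
- by move=> x _; rewrite mule_ge0 ?lee_fin.
- by apply: emeasurable_funM => //; exact/measurable_EFinP.
congr (_ * _)%E; rewrite integral_mkcond; apply: eq_integral => x _.
by rewrite patchE indicE; case: (_ \in _); rewrite ?mul1e ?mul0e.
Qed.

End density.

Section bounded_expectation.
Context d (T : measurableType d) (R : realType) (P : probability T R).

Lemma bounded_integrable (X : T -> R) (c : R) : measurable_fun setT X ->
  (forall w, `|X w| <= c) -> P.-integrable setT (EFin \o X).
Proof.
move=> mX Xc; have [] := @Rintegral_bound _ _ _ P setT X c measurableT _ mX (fun w _ => Xc w) => //.
exact: (le_lt_trans (probability_le1 P measurableT) (ltry _)).
Qed.

Lemma Rintegral_probability_cst (c : R) : \int[P]_w c = c.
Proof.
rewrite Rintegral_cst// [X in c * fine X](_ : _ = 1%E) ?mulr1//.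
exact: probability_setT.
Qed.

Lemma expectation_density d' (U : measurableType d') (X : T -> U)
    (mu : {measure set U -> \bar R}) (k h : U -> R) (c : R) :
  measurable_fun setT X ->
  measurable_fun setT k -> (forall x, 0 <= k x) ->
  (forall A, measurable A -> P (X @^-1` A) = \int[mu]_(x in A) (k x)%:E)%E ->
  measurable_fun setT h -> (forall x, `|h x| <= c) ->
  \int[P]_w h (X w) = \int[mu]_x (h x * k x).
Proof.
move=> mX mk k0 Pk mh hc.
have k1 : (\int[mu]_x (k x)%:E = 1)%E by rewrite -Pk// preimage_setT probability_setT.
have ik : mu.-integrable setT (EFin \o k).
  apply/integrableP; split; first exact/measurable_EFinP.
  under eq_integral do rewrite gee0_abs ?lee_fin//.
  by rewrite k1 ltry.
have ihk : mu.-integrable setT (EFin \o (fun x => h x * k x)).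
  have : mu.-integrable setT (fun x => (c * k x)%:E).
    by under eq_fun do rewrite EFinM; exact: integrableZl.
  apply: le_integrable => //.
    by apply/measurable_EFinP; exact: measurable_funM.
  move=> x _; rewrite lee_fin !normrM ler_wpM2r//.
  by apply: le_trans (hc x) _; exact: ler_norm.
have mhX : measurable_fun setT (h \o X) by exact: measurableT_comp.
have iX := bounded_integrable mhX (fun w => hc _).
(* Shifting by the bound [c] makes the integrand nonnegative; the shift is removed afterwards since
   both measures have mass one. *)
have key : \int[P]_w (h (X w) + c) = \int[mu]_x ((h x + c) * k x).
  have hc0 x : 0 <= h x + c by have := hc x; rewrite ler_norml; lra.
  have mhc : measurable_fun setT (fun x => (h x + c)%:E).
    by apply/measurable_EFinP; exact: measurable_funD.
  congr fine.
  transitivity (\int[pushforward P X]_x (h x + c)%:E)%E.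
    by rewrite ge0_integral_pushforward// => x _; rewrite lee_fin.
  by rewrite [LHS](@ge0_integral_density _ _ _ _ mu k)// => x; rewrite lee_fin.
have e1 : \int[P]_w (h (X w) + c) = \int[P]_w h (X w) + c.
  rewrite RintegralD//; first by rewrite Rintegral_probability_cst.
  by apply: (bounded_integrable (c := `|c|)) => //; exact: measurable_cst.
have e2 : \int[mu]_x ((h x + c) * k x) = \int[mu]_x (h x * k x) + c.
  under eq_Rintegral do rewrite mulrDl.
  rewrite RintegralD//.
    rewrite RintegralZl//; congr (_ + _); rewrite /Rintegral k1/=; ring.
  by under [X in _.-integrable _ X]eq_fun do rewrite /= EFinM; exact: integrableZl.
by apply: (@addIr _ c); rewrite -e1 -e2.
Qed.

End bounded_expectation.

Section independence.
Context d (T : measurableType d) (R : realType) (P : probability T R).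

(** The finite measures [A |-> P (A]&[B)] and [A |-> P A * P B] agree on a pi-system containing the
    whole space, hence on the sigma-algebra it generates. *)
Lemma dynkin_independent (G : set (set T)) (B : set T) :
  G `<=` measurable -> setI_closed G -> G setT -> measurable B ->
  (forall A, G A -> P (A `&` B) = P A * P B)%E ->
  forall A, <<s G >> A -> P (A `&` B) = (P A * P B)%E.
Proof.
move=> Gm GI GT mB GP A sA.
have fB : P B \is a fin_num by exact: fin_num_measure.
pose b : {nonneg R} := NngNum (fine_ge0 (measure_ge0 P B)).
have m2E C : (mscale b P C = P C * P B)%E by rewrite /mscale/= fineK// muleC.
rewrite -m2E; apply: (@g_sigma_algebra_measure_unique _ R T G Gm (fun=> setT) (fun=> GT) _
  (mrestr P mB) (mscale b P) GI _ _ A sA).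
- by apply/seteqP; split=> // x _; exists 0%N.
- by move=> C GC; rewrite [RHS]m2E -GP.
- move=> _; rewrite /= /mrestr setTI.
  exact: (le_lt_trans (probability_le1 P mB) (ltry _)).
Qed.

Lemma Rintegral_indep d1 d2 (U1 : measurableType d1) (U2 : measurableType d2)
    (X : T -> U1) (Y : T -> U2) (f : U1 * U2 -> R) (c : R) :
  measurable_fun setT X -> measurable_fun setT Y ->
  (forall A B, measurable A -> measurable B ->
    P (X @^-1` A `&` Y @^-1` B) = P (X @^-1` A) * P (Y @^-1` B))%E ->
  measurable_fun setT f -> (forall w w', `|f (X w, Y w')| <= c) ->
  \int[P]_w f (X w, Y w) = \int[P]_w \int[P]_w' f (X w, Y w').
Proof.
move=> mX mY XY mf fc.
have pX A : measurable A -> measurable (X @^-1` A).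
  by move=> mA; rewrite -[X in measurable X]setTI; exact: (mX measurableT).
have pY A : measurable A -> measurable (Y @^-1` A).
  by move=> mA; rewrite -[X in measurable X]setTI; exact: (mY measurableT).
pose X' : {mfun T >-> U1} := HB.pack X (isMeasurableFun.Build _ _ _ _ X mX).
pose Y' : {mfun T >-> U2} := HB.pack Y (isMeasurableFun.Build _ _ _ _ Y mY).
have mXY : measurable_fun setT (fun w => (X w, Y w)) by exact: measurable_fun_pair.
have mXY2 : measurable_fun setT (fun z : T * T => (X z.1, Y z.2)).
  by apply: measurable_fun_pair; exact: measurableT_comp.
(* The product of the two laws is the law of [(X w, Y w)] by independence, and also that of
   [(X w, Y w')] under [P \x P] by construction. Fubini for the second then gives the iterated
   integral. *)
have law1 C : measurable C ->
    (distribution P X' \x distribution P Y')%E C = pushforward P (fun w => (X w, Y w)) C.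
  apply: product_measure_unique => A B mA mB.
  by rewrite /= /distribution /pushforward /= -XY.
have law2 C : measurable C -> (distribution P X' \x distribution P Y')%E C =
    pushforward (P \x P)%E (fun z : T * T => (X z.1, Y z.2)) C.
  apply: product_measure_unique => A B mA mB.
  rewrite /= /distribution /pushforward /=.
  by rewrite -product_measure1E//; [exact: pX|exact: pY].
have mfE : measurable_fun setT (EFin \o f) by exact/measurable_EFinP.
have PP : ((P \x P)%E setT < +oo)%E.
  rewrite -setXTT product_measure1E//.
  rewrite [X in (X * _)%E](_ : _ = 1%E); last exact: probability_setT.
  by rewrite mul1e; exact: (le_lt_trans (probability_le1 P measurableT) (ltry _)).
have i1 : P.-integrable setT (EFin \o (fun w => f (X w, Y w))).
  by apply: bounded_integrable => //; exact: measurableT_comp.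
have mf2 : measurable_fun setT (fun z : T * T => f (X z.1, Y z.2)).
  exact: (measurableT_comp mf mXY2).
have i2 : (P \x P)%E.-integrable setT (EFin \o (fun z : T * T => f (X z.1, Y z.2))).
  by have [] := Rintegral_bound measurableT PP mf2 (fun z _ => fc _ _).
transitivity (\int[(P \x P)%E]_z f (X z.1, Y z.2)).
  congr fine.
  transitivity (\int[pushforward P (fun w => (X w, Y w))]_u (f u)%:E)%E.
    by rewrite (integral_pushforward mXY mfE i1).
  transitivity (\int[pushforward (P \x P) (fun z : T * T => (X z.1, Y z.2))]_u (f u)%:E)%E.
    by apply: eq_measure_integral => A mA _; rewrite /= -law1 ?law2.
  by rewrite (integral_pushforward mXY2 mfE i2).
rewrite /Rintegral -integral12_prod_meas1//.
congr fine; apply: eq_integral => w _; rewrite fineK//.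
apply: integrable_fin_num => //.
apply: (@bounded_integrable _ _ _ P _ c) => //.
by apply: (measurableT_comp mf); exact: measurable_fun_pair.
Qed.

Section blocks.
Variables (I : finType) (F : I -> set (set T)).
Hypothesis F_meas : forall i, F i `<=` measurable.
Hypothesis F_setI : forall i, setI_closed (F i).
Hypothesis F_setT : forall i, F i setT.
Hypothesis F_indep : independent_events P F.

(** A pi-system generating the joint sigma-algebra of the draws indexed by [J]; mutual independence
    is stated on exactly these intersections. *)
Definition block_events (J : {set I}) : set (set T) :=
  [set A | exists2 E : I -> set T, (forall i, i \in J -> F i (E i)) &
     A = \bigcap_(i in [set` J]) E i].

Lemma block_events_measurable J : block_events J `<=` measurable.
Proof.
move=> _ [E FE ->]; apply: fin_bigcap_measurable => // i iJ.
by apply: F_meas; exact: FE.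
Qed.

Lemma block_events_setI J : setI_closed (block_events J).
Proof.
move=> _ _ [E FE ->] [E' FE' ->]; exists (fun i => E i `&` E' i).
  by move=> i iJ; apply: F_setI; [exact: FE|exact: FE'].
by rewrite bigcapI.
Qed.

Lemma block_events_setT J : block_events J setT.
Proof. by exists (fun=> setT) => //; apply/seteqP; split. Qed.

Lemma block_events_single (J : {set I}) i A : i \in J -> F i A -> block_events J A.
Proof.
move=> iJ FA; exists (fun j => if j == i then A else setT).
  by move=> j jJ; case: eqP => [->|].
apply/seteqP; split=> [w Aw j jJ /=|w /(_ i iJ)/=]; last by rewrite eqxx.
by case: eqP.
Qed.

(** The product rule holds on the two pi-systems by gluing the families over [J] and [K] into one.
    It is then extended to the generated sigma-algebras one side at a time. *)
Lemma block_independent (J K : {set I}) (A B : set T) : [disjoint J & K]%B ->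
  <<s block_events J >> A -> <<s block_events K >> B ->
  P (A `&` B) = (P A * P B)%E.
Proof.
move=> JK sA sB.
have sm J' C : <<s block_events J' >> C -> measurable C.
  apply: smallest_sub; first exact: sigma_algebra_measurable.
  exact: block_events_measurable.
have base A' B' : block_events J A' -> block_events K B' -> P (A' `&` B') = (P A' * P B')%E.
  move=> [E FE ->] [E' FE' ->].
  pose D i := if i \in J then E i else E' i.
  have DJ i : i \in J -> D i = E i by rewrite /D => ->.
  have DK i : i \in K -> D i = E' i.
    by move=> iK; rewrite /D; case: ifPn => // iJ; move: (disjointFr JK iJ); rewrite iK.
  have -> : \bigcap_(i in [set` J]) E i `&` \bigcap_(i in [set` K]) E' i =
      \bigcap_(i in [set` J :|: K]) D i.
    apply/seteqP; split=> [w [wJ wK] i /=|w w1].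
      by rewrite inE => /orP[iJ|iK]; [rewrite DJ//; exact: wJ|rewrite DK//; exact: wK].
    split=> i iJ; [rewrite -DJ//|rewrite -DK//]; apply: w1; rewrite /= inE iJ ?orbT//.
  have FD i : i \in J :|: K -> F i (D i).
    rewrite inE => /orP[iJ|iK]; first by rewrite DJ//; exact: FE.
    by rewrite DK//; exact: FE'.
  rewrite (F_indep FE) (F_indep FE') (F_indep FD).
  rewrite (eq_bigl [predU J & K]); last by move=> i; rewrite !inE.
  rewrite bigU//=; congr (_ * _)%E; apply: eq_bigr => i ij; [by rewrite DJ|by rewrite DK].
have half A' : block_events J A' -> P (B `&` A') = (P B * P A')%E.
  move=> JA'; apply: (dynkin_independent (G := block_events K)) => //.
  - exact: block_events_measurable.
  - exact: block_events_setI.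
  - exact: block_events_setT.
  - exact: (block_events_measurable JA').
  - by move=> C KC; rewrite setIC base// muleC.
apply: (dynkin_independent (G := block_events J)) => //.
- exact: block_events_measurable.
- exact: block_events_setI.
- exact: block_events_setT.
- exact: sm sB.
- by move=> C JC; rewrite setIC half// muleC.
Qed.

(* [X] only depends on the coordinates in [J]. *)
Definition block_measurable d' (U : measurableType d') (J : {set I}) (X : T -> U) :=
  forall A, measurable A -> <<s block_events J >> (X @^-1` A).

Lemma block_measurableE d' (U : measurableType d') (J : {set I}) (X : T -> U) :
  block_measurable J X <->
  measurable_fun setT (X : g_sigma_algebraType (block_events J) -> U).
Proof.
split=> [mX _ A mA|mX A mA]; first by rewrite setTI; exact: mX.
by have := mX measurableT A mA; rewrite setTI.
Qed.

Lemma block_measurableW d' (U : measurableType d') (J K : {set I}) (X : T -> U) :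
  J \subset K -> block_measurable J X -> block_measurable K X.
Proof.
move=> JK mX A mA; have := mX _ mA; apply: smallest_sub.
  exact: smallest_sigma_algebra.
move=> _ [E FE ->]; apply: sub_sigma_algebra.
exists (fun i => if i \in J then E i else setT).
  by move=> i _; case: ifP => [/FE|].
apply/seteqP; split=> [w h i iK /=|w h i /= iJ].
  by case: ifP => // iJ; exact: h.
by have := h i (fintype.subsetP JK _ iJ); rewrite iJ.
Qed.

Lemma block_measurable_measurable d' (U : measurableType d') (J : {set I}) (X : T -> U) :
  block_measurable J X -> measurable_fun setT X.
Proof.
move=> mX _ A mA; rewrite setTI; move: (mX _ mA); apply: smallest_sub.
  exact: sigma_algebra_measurable.
exact: block_events_measurable.
Qed.

Lemma block_measurable_comp d1 d2 (U : measurableType d1) (U' : measurableType d2)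
    (J : {set I}) (X : T -> U) (h : U -> U') :
  measurable_fun setT h -> block_measurable J X -> block_measurable J (h \o X).
Proof.
move=> mh mX A mA; rewrite comp_preimage; apply: mX.
by rewrite -[X in measurable X]setTI; exact: mh.
Qed.

Lemma block_measurable_pair d1 d2 (U1 : measurableType d1) (U2 : measurableType d2)
    (J : {set I}) (X : T -> U1) (Y : T -> U2) :
  block_measurable J X -> block_measurable J Y ->
  block_measurable J (fun w => (X w, Y w)).
Proof.
by rewrite !block_measurableE => mX mY; exact: measurable_fun_pair.
Qed.

Lemma block_measurable_single d' (U : measurableType d') (J : {set I}) i (X : T -> U) :
  i \in J -> generated_events X `<=` F i -> block_measurable J X.
Proof.
move=> iJ XF A mA; apply: sub_sigma_algebra; apply: (block_events_single iJ).
by apply: XF; exists A => //; rewrite setTI.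
Qed.

Lemma Rintegral_blocks d1 d2 (U1 : measurableType d1) (U2 : measurableType d2)
    (J K : {set I}) (X : T -> U1) (Y : T -> U2) (f : U1 * U2 -> R) (c : R) :
  [disjoint J & K]%B -> block_measurable J X -> block_measurable K Y ->
  measurable_fun setT f -> (forall w w', `|f (X w, Y w')| <= c) ->
  \int[P]_w f (X w, Y w) = \int[P]_w \int[P]_w' f (X w, Y w').
Proof.
move=> JK mX mY mf fc; apply: (Rintegral_indep _ _ _ mf fc).
- exact: block_measurable_measurable mX.
- exact: block_measurable_measurable mY.
- by move=> A B mA mB; apply: (block_independent JK); [exact: mX|exact: mY].
Qed.

End blocks.
End independence.

Lemma uniform_prob_lt (R : realType) (c : R) : 0 <= c <= 1 ->
  uniform_prob (@ltr01 R) `]-oo, c[%classic = c%:E.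
Proof.
move=> /andP[c0 c1]; rewrite /uniform_prob integral_uniform_pdf.
have -> : `]-oo, c[%classic `&` `[0, 1]%classic = `[0, c[%classic :> set R.
  apply/seteqP; split=> x /=; rewrite !in_itv/=.
    by move=> [xc /andP[-> _]].
  by move=> /andP[x0 xc]; rewrite xc x0 (le_trans (ltW xc)).
transitivity (\int[lebesgue_measure]_(x in (`[0%R, c[%classic : set R)) (cst 1%E x))%E.
  apply: eq_integral => x; rewrite inE/= in_itv/= => /andP[x0 xc].
  by rewrite /uniform_pdf x0 (le_trans (ltW xc))//= subr0 invr1.
rewrite integral_cst//= mul1e lebesgue_measure_itv/= lte_fin.
by case: ltP => [_|c0']; rewrite ?sube0//; congr (_%:E); apply/eqP; rewrite eq_le c0 c0'.
Qed.

Section generated_events.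
Context d (T : measurableType d) d' (U : measurableType d') (X : T -> U).

Lemma generated_events_setI : setI_closed (generated_events X).
Proof.
move=> _ _ [A mA <-] [B mB <-]; exists (A `&` B); first exact: measurableI.
by rewrite !setTI preimage_setI.
Qed.

Lemma generated_events_setT : generated_events X setT.
Proof. by exists setT => //; rewrite setTI preimage_setT. Qed.

Lemma generated_events_measurable : measurable_fun setT X ->
  generated_events X `<=` measurable.
Proof. by move=> mX _ [A mA <-]; exact: mX. Qed.

End generated_events.

(** * The particle chain and its conditional expectations *)

Section monte_carlo_chain.
Context {R : realType} (n : nat).
Local Notation V := 'rV[R]_n.
Local Notation lambda := (lebesgue_row R n).
Variable Omega : set V.
Hypothesis mO : measurable Omega.
Hypothesis O_gt0 : (0 < lambda Omega)%E.
Hypothesis O_lty : (lambda Omega < +oo)%E.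
Variable sigma : V -> R.
Hypothesis msigma : measurable_fun setT (sigma : V -> measurableTypeR R).
Hypothesis sigma_ge0 : forall x, 0 <= sigma x.
Variable dt : R.
Hypothesis dt_ge0 : 0 <= dt.

(** One step of [particle], with the current state paired against the fresh draws so that each
    component of the pair depends on its own block. *)
Definition mc_move (u : (V * V) * (measurableTypeR R * V)) : V * V :=
  let x := u.1.1 + dt *: u.1.2 in
  (x, if expR (- (sigma x * dt)) <= u.2.1 then u.2.2 else u.1.2).

Lemma measurable_mc_move : measurable_fun setT mc_move.
Proof.
have m1 : measurable_fun setT (fun u : (V * V) * (measurableTypeR R * V) => u.1.1 + dt *: u.1.2).
  apply: measurable_funD_row.
    exact: (measurableT_comp measurable_fst measurable_fst).
  by apply: measurable_funZ_row; exact: (measurableT_comp measurable_snd measurable_fst).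
have me : measurable_fun setT (fun u : (V * V) * (measurableTypeR R * V) =>
    expR (- (sigma (u.1.1 + dt *: u.1.2) * dt))).
  apply: measurableT_comp => //; apply: measurableT_comp => //.
  by apply: measurable_funM => //; exact: (measurableT_comp msigma m1).
apply: measurable_fun_pair => //; apply: measurable_fun_ifT.
- apply: measurable_fun_ler => //.
  exact: (measurableT_comp measurable_fst measurable_snd).
- exact: (measurableT_comp measurable_snd measurable_snd).
- exact: (measurableT_comp measurable_snd measurable_fst).
Qed.

Lemma mc_step_bound (g : V * V -> R) (c : R) : measurable_fun setT g ->
  (forall z, `|g z| <= c) -> forall z, `|mc_step Omega sigma dt g z| <= c.
Proof.
move=> mg gc z; apply: convex_bound => //.
  by rewrite expR_ge0 expRN_le1// mulr_ge0.
by apply: (vmean_bound mO) => //; exact: measurable_slice.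
Qed.

Section draws.
Context d (T : measurableType d) (P : probability T R) (N M : nat).
Variables (z0 : 'I_N -> T -> V * V) (p : 'I_N -> nat -> T -> R)
  (eta : 'I_N -> nat -> T -> V) (fin : V -> V -> R).
Hypothesis draws : monte_carlo_draws P M z0 p eta Omega fin.

Local Notation I := ('I_N + ('I_N * 'I_M + 'I_N * 'I_M))%type.
Let F : I -> set (set T) := draw_events z0 p eta.

Lemma draw_events_measurable i : F i `<=` measurable.
Proof.
case: i => [j|[[j m]|[j m]]]; apply: generated_events_measurable.
- exact: (draws_measurable_init draws).
- exact: (draws_measurable_p draws).
- exact: (draws_measurable_eta draws).
Qed.

Lemma draw_events_setI i : setI_closed (F i).
Proof. by case: i => [j|[[j m]|[j m]]]; exact: generated_events_setI. Qed.

Lemma draw_events_setT i : F i setT.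
Proof. by case: i => [j|[[j m]|[j m]]]; exact: generated_events_setT. Qed.

Let blocks := Rintegral_blocks draw_events_measurable draw_events_setI draw_events_setT
  (draws_independent draws).

Let happens_before (j : 'I_N) (m : nat) (i : I) : bool :=
  match i with
  | inl j' => j' == j
  | inr (inl (j', k)) => (j' == j) && (k < m)%N
  | inr (inr (j', k)) => (j' == j) && (k < m)%N
  end.

(** All the randomness behind the state of particle [j] at time [m]. The inequality [k < m] is
    strict because draw [k] is consumed in the step from [k] to [k.+1]. *)
Definition draws_before (j : 'I_N) (m : nat) : {set I} :=
  [set i | happens_before j m i].

Definition draw_owner (i : I) : 'I_N :=
  match i with inl j => j | inr (inl (j, _)) => j | inr (inr (j, _)) => j end.

Definition trajectory (j : 'I_N) (m : nat) (w : T) : V * V :=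
  particle sigma dt (z0 j w) (fun k => p j k w) (fun k => eta j k w) m.

Let p_block (J : {set I}) j (m : 'I_M) : inr (inl (j, m)) \in J ->
  block_measurable F J (p j m : T -> measurableTypeR R).
Proof. by move=> iJ; apply: (block_measurable_single draw_events_setT iJ). Qed.

Let eta_block (J : {set I}) j (m : 'I_M) : inr (inr (j, m)) \in J ->
  block_measurable F J (eta j m).
Proof. by move=> iJ; apply: (block_measurable_single draw_events_setT iJ). Qed.

Lemma trajectory_block j m : (m <= M)%N ->
  block_measurable F (draws_before j m) (trajectory j m).
Proof.
elim: m => [|m IH] mM.
  by apply: (block_measurable_single draw_events_setT (i := inl j)); rewrite ?inE/=.
pose m' := Ordinal mM.
have sub : draws_before j m \subset draws_before j m.+1.
  by apply/fintype.subsetP => -[j'|[[j' k]|[j' k]]]; rewrite !inE//= => /andP[/eqP -> km];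
    rewrite eqxx/= ltnW.
have mp : block_measurable F (draws_before j m.+1) (p j m' : T -> measurableTypeR R).
  by apply: p_block; rewrite !inE/= eqxx ltnSn.
have me : block_measurable F (draws_before j m.+1) (eta j m').
  by apply: eta_block; rewrite !inE/= eqxx ltnSn.
exact: (block_measurable_comp measurable_mc_move (block_measurable_pair
  (block_measurableW draw_events_setT sub (IH (ltnW mM))) (block_measurable_pair mp me))).
Qed.

Lemma measurable_trajectory j m : (m <= M)%N -> measurable_fun setT (trajectory j m).
Proof.
by move=> mM; exact: (block_measurable_measurable draw_events_measurable (@trajectory_block j _ mM)).
Qed.

Let expectation_eta j (m : 'I_M) (h : V -> R) (c : R) : measurable_fun setT h ->
  (forall v, `|h v| <= c) -> \int[P]_w h (eta j m w) = vmean Omega h.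
Proof.
move=> mh hc.
pose k v : R := (fine (lambda Omega))^-1 * \1_Omega v.
have O0 := fine_Omega_gt0 O_gt0 O_lty.
have mk : measurable_fun setT k by exact: measurable_funM.
have k0 v : 0 <= k v by rewrite mulr_ge0 ?invr_ge0 ?(ltW O0)// indicE.
rewrite (expectation_density (mu := lambda) (draws_measurable_eta draws j m) mk k0 _ mh hc).
  rewrite /vmean [in RHS]Rintegral_mkcond -RintegralZl//.
    by apply: eq_Rintegral => v _; rewrite /k patchE indicE; case: (_ \in _); rewrite ?mulr1 ?mulr0// mulrC.
  have [iO _] := @Rintegral_bound _ _ _ lambda Omega h c mO O_lty
    (measurable_funTS mh) (fun v _ => hc v).
  by rewrite -restrict_EFin; apply: (proj1 (integrable_mkcond _ mO)).
move=> A mA; rewrite (draws_eta draws)//.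
under eq_integral do rewrite EFinM.
rewrite ge0_integralZl//; first last.
- by rewrite lee_fin invr_ge0 ltW.
- by apply/measurable_EFinP; exact: measurable_indic.
by rewrite integral_indic// setIC muleC.
Qed.

Let expectation_switch j (m : 'I_M) (a b c : R) : 0 <= c <= 1 ->
  \int[P]_w (if c <= p j m w then a else b) = c * b + (1 - c) * a.
Proof.
move=> c01.
have mp := draws_measurable_p draws j m.
have mA : measurable (p j m @^-1` `]-oo, c[).
  by rewrite -[X in measurable X]setTI; apply: mp.
under eq_Rintegral => w _.
  (* The velocity is kept on the event [p < c], which has probability [c]. *)
  rewrite (_ : (if _ then _ else _) = a + (b - a) * \1_(p j m @^-1` `]-oo, c[) w); last first.
    rewrite indicE; case: leP => cp.
      rewrite memNset ?mulr0 ?addr0//= in_itv/=; apply/negP; by rewrite -leNgt.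
    by rewrite mem_set ?mulr1 ?subrKC//= in_itv/=.
  over.
have mi : measurable_fun setT (\1_(p j m @^-1` `]-oo, c[) : T -> R) by exact: measurable_indic.
have ii : P.-integrable setT (EFin \o (\1_(p j m @^-1` `]-oo, c[) : T -> R)).
  apply: (@bounded_integrable _ _ _ P _ 1) => // w.
  by rewrite indicE; case: (_ \in _); rewrite ?normr1 ?normr0.
have iz : P.-integrable setT (EFin \o (fun w => (b - a) * \1_(p j m @^-1` `]-oo, c[) w)).
  apply: (@bounded_integrable _ _ _ P _ `|b - a|); first exact: measurable_funM.
  move=> w; rewrite indicE normrM ler_piMr//.
  by case: (_ \in _); rewrite ?normr1 ?normr0.
rewrite RintegralD//; last first.
  by apply: (@bounded_integrable _ _ _ P _ `|a|) => //; exact: measurable_cst.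
rewrite Rintegral_probability_cst RintegralZl// /Rintegral integral_indic// setIT.
rewrite [X in fine X](_ : _ = c%:E); first by rewrite /=; ring.
by rewrite -uniform_prob_lt// -(draws_p draws j m)//.
Qed.

(** Conditional expectation given the past, done with Fubini twice: first the past against the pair
    [(p, eta)], then, with the state frozen at [z], [p] against [eta]. The inner average over [eta]
    gives the velocity mean, the outer one over [p] the two weights. *)
Lemma trajectory_step j (m : nat) (g : V * V -> R) (c : R) : (m < M)%N ->
  measurable_fun setT g -> (forall z, `|g z| <= c) ->
  \int[P]_w g (trajectory j m.+1 w) =
  \int[P]_w mc_step Omega sigma dt g (trajectory j m w).
Proof.
move=> mM mg gc; pose m' := Ordinal mM.
pose Kp : {set I} := finset.set1 (inr (inl (j, m'))).
pose Ke : {set I} := finset.set1 (inr (inr (j, m'))).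
pose K : {set I} := finset.setU Kp Ke.
have dJK : [disjoint draws_before j m & K]%B.
  rewrite disjoint_sym finset.disjoints_subset; apply/fintype.subsetP => i.
  rewrite !inE => /orP[] /eqP ->; by rewrite /= ?eqxx ltnn.
have pK : block_measurable F K (fun w => (p j m' w : measurableTypeR R, eta j m' w)).
  by apply: block_measurable_pair; [apply: p_block|apply: eta_block]; rewrite !inE eqxx ?orbT.
have mgm : measurable_fun setT (g \o mc_move) by exact: (measurableT_comp mg measurable_mc_move).
rewrite (blocks dJK (@trajectory_block j _ (ltnW mM)) pK mgm (fun _ _ => gc _)).
apply: eq_Rintegral => w0 _; move: (trajectory j m w0) => z {w0}.
set x := z.1 + dt *: z.2; set e := expR (- (sigma x * dt)).
pose h (u : measurableTypeR R * V) := g (mc_move (z, u)).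
have mh : measurable_fun setT h.
  by apply: (measurableT_comp mgm); exact: measurable_fun_pair.
have dpe : [disjoint Kp & Ke]%B.
  by rewrite disjoints1 inE.
rewrite (blocks dpe (@p_block Kp j m' (set11 _))
  (@eta_block Ke j m' (set11 _)) mh (fun _ _ => gc _)).
have mgx : measurable_fun setT (fun v => g (x, v)) by exact: measurable_slice.
under eq_Rintegral => w _.
  rewrite (_ : \int[P]_w' _ = if e <= p j m' w then vmean Omega (fun v => g (x, v)) else g (x, z.2)); last first.
    rewrite -(expectation_eta j m' mgx (fun v => gc _)) /h /mc_move/= -/x -/e.
    by case: ifP => // _; rewrite Rintegral_probability_cst.
  over.
rewrite expectation_switch//.
by rewrite expR_ge0 expRN_le1// mulr_ge0.
Qed.

(** The last step of the trajectory is integrated out first and absorbed into the observable, so the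
    induction runs over all [g] and uses [iterSr]. *)
Lemma expectation_trajectory j (m : nat) (g : V * V -> R) (c : R) : (m <= M)%N ->
  measurable_fun setT g -> (forall z, `|g z| <= c) ->
  \int[P]_w g (trajectory j m w) = \int[P]_w iter m (mc_step Omega sigma dt) g (z0 j w).
Proof.
elim: m g => [|m IH] g mM mg gc; first by [].
rewrite (trajectory_step j mM mg gc) iterSr; apply: IH; first exact: ltnW.
- exact: (measurable_mc_step mO msigma).
- exact: mc_step_bound.
Qed.

(** Particles are split off one at a time: the product over the first [k] depends only on draws
    owned by them, a block disjoint from the draws of particle [k]. *)
Lemma expectation_trajectory_prod (m : nat) (psi : V * V -> R) (c : R) : (m <= M)%N ->
  0 <= c -> measurable_fun setT psi -> (forall z, `|psi z| <= c) ->
  \int[P]_w \prod_(j < N) psi (trajectory j m w) =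
  \prod_(j < N) \int[P]_w psi (trajectory j m w).
Proof.
move=> mM c0 mpsi psic.
suff H k : (k <= N)%N -> \int[P]_w \prod_(j < N | (j < k)%N) psi (trajectory j m w) =
    \prod_(j < N | (j < k)%N) \int[P]_w psi (trajectory j m w).
  have := H N (leqnn N).
  rewrite [RHS](eq_bigl predT); last by move=> j; rewrite ltn_ord.
  by under eq_Rintegral => w _ do (rewrite (eq_bigl predT); last by move=> j; rewrite ltn_ord).
elim: k => [|k IH] kN.
  under eq_Rintegral do rewrite big_pred0//.
  by rewrite big_pred0// Rintegral_probability_cst.
pose k' := Ordinal kN.
have split_k (G : 'I_N -> R) : \prod_(j < N | (j < k.+1)%N) G j =
    (\prod_(j < N | (j < k)%N) G j) * G k'.
  rewrite (bigD1 k') ?ltnSn//= mulrC; congr (_ * _); apply: eq_bigl => j.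
  rewrite ltnS leq_eqVlt; have [->|jk] := eqVneq j k'; first by rewrite /= ltnn andbF.
  by rewrite (_ : (j == k :> nat) = false) ?andbT//; exact/negbTE.
under eq_Rintegral do rewrite split_k.
rewrite split_k -IH; last exact: ltnW.
pose J : {set I} := finset (fun i : I => (draw_owner i < k)%N).
have dJ : [disjoint J & draws_before k' m]%B.
  rewrite disjoint_sym finset.disjoints_subset; apply/fintype.subsetP => -[j|[[j l]|[j l]]];
    rewrite !inE/=; [move=> /eqP->|move=> /andP[/eqP-> _]|move=> /andP[/eqP-> _]];
    by rewrite ltnn.
have sub (j : 'I_N) : (j < k)%N -> draws_before j m \subset J.
  by move=> jk; apply/fintype.subsetP => -[j'|[[j' l]|[j' l]]];
    rewrite !inE/=; [move=> /eqP->|move=> /andP[/eqP-> _]|move=> /andP[/eqP-> _]].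
pose X w : measurableTypeR R := \prod_(j < N | (j < k)%N) psi (trajectory j m w).
have mX : block_measurable F J X.
  apply/block_measurableE; rewrite /X.
  under eq_fun do rewrite big_mkcond.
  apply: measurable_prod => j _; case jk : (j < k)%N; last exact: measurable_cst.
  have := block_measurableW draw_events_setT (sub _ jk) (@trajectory_block j _ mM).
  by move=> /(block_measurable_comp mpsi) /block_measurableE.
have Xc w : `|X w| <= \prod_(j < N | (j < k)%N) c.
  by rewrite /X normr_prod; apply: ler_prod => j _; rewrite normr_ge0 psic.
have mf : measurable_fun setT
    (fun u : measurableTypeR R * (V * V) => u.1 * psi u.2 : measurableTypeR R).
  apply: measurable_funM; first exact: measurable_fst.
  exact: (measurableT_comp mpsi measurable_snd).
have fc w w' : `|X w * psi (trajectory k' m w')| <= (\prod_(j < N | (j < k)%N) c) * c.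
  by rewrite normrM ler_pM.
rewrite [LHS](blocks dJ mX (@trajectory_block k' _ mM) mf fc)/=.
have mY : measurable_fun setT (psi \o trajectory k' m).
  by apply: measurableT_comp => //; exact: measurable_trajectory.
under eq_Rintegral => w _.
  rewrite RintegralZl//; last by apply: (@bounded_integrable _ _ _ P _ c mY) => w'; exact: psic.
  over.
rewrite RintegralZr//; apply: (@bounded_integrable _ _ _ P X _ _ Xc).
exact: (block_measurable_measurable draw_events_measurable mX).
Qed.

End draws.
End monte_carlo_chain.

(** * Sup, support and Lipschitz bounds for test functions *)

Section test_function_bounds.
Context {R : realType}.

Lemma compactly_vanishing_bounded (V : normedModType R) (g : V -> R) (K : set V) :
  compact K -> continuous g -> (forall x, ~ K x -> g x = 0) ->
  exists2 B, 0 <= B & forall x, `|g x| <= B.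
Proof.
move=> cK cg g0.
have cgK : {within K, continuous g} by apply: continuous_subspaceT.
have [M [_ hM]] := compact_bounded (continuous_compact cgK cK : compact (g @` K : set R^o)).
exists (`|M| + 1); first by rewrite addr_ge0.
move=> x; have [Kx|nKx] := pselect (K x); last by rewrite g0// normr0 addr_ge0.
apply: (hM (`|M| + 1)); first by rewrite (le_lt_trans (ler_norm M))// ltrDl.
by exists x.
Qed.

Lemma fsupport_eq0 (V : normedModType R) (g : V -> R) x : ~ fsupport g x -> g x = 0.
Proof.
by move=> nx; apply/eqP/negPn/negP => gx; apply: nx; exact: subset_closure.
Qed.

Lemma derive_fsupport_eq0 (V : normedModType R) (g : V -> R) v x :
  ~ fsupport g x -> 'D_v g x = 0.
Proof.
move=> nx; have xo : nbhs x (~` fsupport g).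
  by apply: open_nbhs_nbhs; split => //; exact/closed_openC/closed_closure.
rewrite (@near_eq_derive _ _ _ _ (cst 0)) ?derive_cst//.
by move: xo; apply: filterS => y /fsupport_eq0 ->.
Qed.

Context (n : nat).
Local Notation V := 'rV[R]_n.

Lemma test_function_bounds (D : set (V * V)) (phi : V * V -> R) :
  test_function D phi ->
  exists (B L rho : R), [/\ 0 <= B /\ 0 <= L, measurable_fun setT (phi : V * V -> measurableTypeR R),
    (forall z, `|phi z| <= B), (forall z, rho < `|z.1| -> phi z = 0) &
    forall x y v, `|phi (x, v) - phi (y, v)| <= L * `|x - y|].
Proof.
move=> [sphi cphi _].
have cont hs : continuous (iter_derive hs phi) by have [] := sphi hs.
have [B B0 phiB] := compactly_vanishing_bounded cphi (cont [::]) (@fsupport_eq0 _ phi).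
have [rho [_ hrho]] := compact_bounded cphi.
(* Only Lipschitz continuity in [x] is wanted, so derivatives are taken in the position directions.
   They vanish off the support of [phi], hence are bounded. *)
pose h (i : 'I_n) : V * V := (delta_mx ord0 i, 0).
have /choice[C hC] (i : 'I_n) : exists C, 0 <= C /\ forall z, `|'D_(h i) phi z| <= C.
  have [C C0 phiC] := compactly_vanishing_bounded cphi (cont [:: h i])
    (@derive_fsupport_eq0 _ phi (h i)).
  by exists C.
pose S := \sum_(i < n) C i.
have CS i : C i <= S.
  by rewrite /S (bigD1 i)//= lerDl sumr_ge0// => j _; have [] := hC j.
have S0 : 0 <= S by rewrite sumr_ge0// => j _; have [] := hC j.
exists B, (n%:R * S), (rho + 1); split=> //.
- by split; rewrite ?mulr_ge0.
- by apply: continuous_row2_measurable; exact: (cont [::]).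
- move=> z rz; apply: fsupport_eq0 => /(hrho (rho + 1)).
  rewrite ltrDl ltr01 => /(_ isT) zr.
  have : `|z.1| <= `|z| by rewrite prod_normE le_max lexx.
  by move=> /(lt_le_trans rz)/lt_le_trans/(_ zr); rewrite ltxx.
- move=> x y v; apply: (@coordinate_lipschitz R n (fun x => phi (x, v)) S S0) => i a t.
  have := @line_lipschitz R _ phi (a, v) (h i) S t
    (fun z => (sphi [::]).2 (h i) z) (fun z => le_trans ((hC i).2 z) (CS i)).
  rewrite (_ : (a, v) + t *: h i = (a + t *: delta_mx ord0 i, v))//.
  by rewrite /h; congr pair => /=; rewrite scaler0 addr0.
Qed.

End test_function_bounds.

(** * Concentration *)

(* Used instead of Hoeffding's lemma, at the price of a worse constant. *)
Lemma expR_le_quadratic (R : realType) (x : R) : expR x <= x + expR (2 * x ^+ 2).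
Proof.
(* For [x <= 1/2], [expR x <= 1 / (1 - x) <= 1 + x + 2 x^2], the last step because [(1 + x + 2 x^2)
   (1 - x) = 1 + x^2 (1 - 2 x)]. For [x > 1/2] simply [x <= 2 x^2]. *)
have [x1|x1] := leP x 2^-1.
  have y0 : 0 < 1 - x by lra.
  have := expR_ge1Dx (- x); rewrite expRN => e1.
  have e2 : expR x <= (1 - x)^-1.
    by rewrite -[leLHS]invrK lef_pV2// posrE invr_gt0 expR_gt0.
  have e3 : (1 - x)^-1 <= 1 + x + 2 * x ^+ 2.
    rewrite -[leLHS]mul1r ler_pdivrMr//.
    have : 0 <= x ^+ 2 * (1 - 2 * x) by rewrite mulr_ge0 ?sqr_ge0//; lra.
    rewrite (_ : (1 + x + 2 * x ^+ 2) * (1 - x) = 1 + x ^+ 2 * (1 - 2 * x)); last by ring.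
    by lra.
  have := expR_ge1Dx (2 * x ^+ 2); lra.
have : expR x <= expR (2 * x ^+ 2).
  rewrite ler_expR expr2 mulrA ler_peMl//; lra.
lra.
Qed.

Section subgaussian.
Context {R : realType} d (T : measurableType d) (P : probability T R).

(** Integrate [expR_le_quadratic] at [s * Y]: the linear term has mean zero. *)
Lemma mgf_centered (Y : T -> R) (D s : R) : measurable_fun setT Y ->
  (forall w, `|Y w| <= D) -> \int[P]_w Y w = 0 ->
  \int[P]_w expR (s * Y w) <= expR (2 * s ^+ 2 * D ^+ 2).
Proof.
move=> mY YD Y0; set E := expR _.
have iY := @bounded_integrable _ _ _ P _ _ mY YD.
have me : measurable_fun setT (fun w => expR (s * Y w)).
  by apply: measurableT_comp => //; exact: measurable_funM.
have Ye w : `|expR (s * Y w)| <= expR (`|s| * D).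
  rewrite ger0_norm ?expR_ge0// ler_expR (le_trans (ler_norm _))// normrM.
  by rewrite ler_wpM2l.
have isY : P.-integrable setT (EFin \o (fun w => s * Y w)).
  by apply: (@bounded_integrable _ _ _ P _ (`|s| * D)) => [|w];
    [exact: measurable_funM|rewrite normrM ler_wpM2l].
have icE : P.-integrable setT (EFin \o (fun=> E)).
  by apply: (@bounded_integrable _ _ _ P _ `|E|).
apply: (@le_trans _ _ (\int[P]_w (s * Y w + E))); last first.
  by rewrite RintegralD// Rintegral_probability_cst RintegralZl// Y0 mulr0 add0r.
apply: le_Rintegral => //.
- exact: (@bounded_integrable _ _ _ P _ _ me Ye).
- exact: (integrableD measurableT isY icE).
- move=> w _; apply: le_trans (expR_le_quadratic _) _.
  rewrite lerD2l ler_expR exprMn mulrA ler_wpM2l//; first exact: (mulr_ge0 (ler0n _ 2) (sqr_ge0 _)).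
  by rewrite -(real_normK (num_real (Y w))) lerXn2r// ?nnegrE// (le_trans _ (YD w)).
Qed.

Variables (S : T -> R) (c v : R).
Hypothesis mS : measurable_fun setT S.
Hypothesis Sc : forall w, `|S w| <= c.
Hypothesis v_gt0 : 0 < v.
Hypothesis mgf_le : forall s, \int[P]_w expR (s * S w) <= expR (v * s ^+ 2).

Let measurable_mgf s : measurable_fun setT (fun w => expR (s * S w)).
Proof. by apply: measurableT_comp => //; exact: measurable_funM. Qed.

Let integrable_mgf s : P.-integrable setT (EFin \o (fun w => expR (s * S w))).
Proof.
apply: (@bounded_integrable _ _ _ P _ (expR (`|s| * c))) => // w.
rewrite ger0_norm ?expR_ge0// ler_expR (le_trans (ler_norm _))// normrM.
by rewrite ler_wpM2l.
Qed.

Let tail_one_sided (eps r : R) : 0 < eps -> `|r| = 1 ->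
  (P [set w | (eps <= r * S w)%R] <= (expR (- (eps ^+ 2 / (4 * v))))%:E)%E.
Proof.
move=> e0 r1.
have mX : measurable_fun setT (fun w => r * S w) by exact: measurable_funM.
pose X : {mfun T >-> R} := HB.pack (fun w => r * S w) (isMeasurableFun.Build _ _ _ _ _ mX).
(* The minimiser of the Chernoff exponent [v * s^2 - s * eps], with value [- eps^2 / (4 * v)]. *)
pose s := eps / (2 * v).
have s0 : 0 < s by rewrite divr_gt0// mulr_gt0.
apply: (le_trans (chernoff (P := P) X eps s0)).
have -> : ('M_P X s = (\int[P]_w expR (s * r * S w))%:E)%E.
  rewrite /mmt_gen_fun unlock /Rintegral fineK; last first.
    exact: (integrable_fin_num _ (integrable_mgf _)).
  by apply: eq_integral => w _; rewrite /= mulrC mulrA.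
rewrite -EFinM lee_fin; apply: (@le_trans _ _ (expR (v * (s * r) ^+ 2) * expR (- (s * eps)))).
  by rewrite ler_wpM2r ?expR_ge0.
rewrite -expRD ler_expR le_eqVlt; apply/orP; left; apply/eqP.
rewrite exprMn -(real_normK (num_real r)) r1 /s; field.
by rewrite gt_eqF.
Qed.

Lemma subgaussian_tail (eps : R) : 0 < eps ->
  (P [set w | (eps <= `|S w|)%R] <= (2 * expR (- (eps ^+ 2 / (4 * v))))%:E)%E.
Proof.
move=> e0.
have mr r : measurable [set w | (eps <= r * S w)%R].
  rewrite -[X in measurable X]setTI; apply: measurable_fun_le => //.
  exact: measurable_funM.
have sub : [set w | (eps <= `|S w|)%R] `<=`
    [set w | (eps <= 1 * S w)%R] `|` [set w | (eps <= (- 1) * S w)%R].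
  by move=> w /=; rewrite mul1r mulN1r ler_normr => /orP[]; [left|right].
apply: (@le_trans _ _ (P ([set w | (eps <= 1 * S w)%R] `|` [set w | (eps <= (- 1) * S w)%R]))).
  apply: le_measure => //; rewrite inE; last exact: measurableU.
  rewrite -[X in measurable X]setTI; apply: measurable_fun_le => //.
  exact: measurableT_comp.
apply: (le_trans (measureU2 _ (mr _) (mr _))).
rewrite mulr_natl mulr2n EFinD leeD// tail_one_sided// ?normrN ?normr1//.
Qed.

Lemma subgaussian_mean (t : R) : 0 < t ->
  \int[P]_w `|S w| <= 2 * expR (v * t ^+ 2) / t.
Proof.
move=> t0.
have iS : P.-integrable setT (EFin \o (fun w => `|S w|)).
  apply: (@bounded_integrable _ _ _ P _ c) => [|w]; first exact: measurableT_comp.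
  by rewrite normr_id.
have iD := integrableD measurableT (integrable_mgf t) (integrable_mgf (- t)).
have iT : P.-integrable setT (EFin \o (fun w => t^-1 * (expR (t * S w) + expR (- t * S w)))).
  exact: (integrableZl measurableT t^-1 iD).
apply: (@le_trans _ _ (\int[P]_w (t^-1 * (expR (t * S w) + expR (- t * S w))))).
  apply: le_Rintegral => // w _.
  rewrite mulrC ler_pdivlMr// -[X in _ * X <= _](gtr0_norm t0) -normrM mulrC.
  (* Applied to [|t * S|], where the right side is even, this bounds [t * |S|] by two exponentials
     controlled by [mgf_le]. *)
  have h (x : R) : x <= expR x + expR (- x).
    by have := expR_ge1Dx x; have := expR_gt0 (- x); lra.
  rewrite mulNr; case: (ger0P (t * S w)) => _; first exact: h.
  by rewrite -[X in _ <= expR X + _]opprK addrC h.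
rewrite RintegralZl// RintegralD//.
rewrite mulrC ler_wpM2r ?invr_ge0 ?(ltW t0)//.
have := mgf_le t; have := mgf_le (- t); rewrite sqrrN; lra.
Qed.

End subgaussian.

Section empirical_mean.
Context {R : realType} d (T : measurableType d) (P : probability T R) (N : nat).
Variables (Z : 'I_N -> T -> R) (D : R).
Hypothesis N_gt0 : (0 < N)%N.
Hypothesis mZ : forall j, measurable_fun setT (Z j).
Hypothesis ZD : forall j w, `|Z j w| <= D.
Hypothesis Z0 : forall j, \int[P]_w Z j w = 0.

Definition empirical_mean (w : T) : R := N%:R^-1 * \sum_(j < N) Z j w.

Lemma measurable_empirical_mean : measurable_fun setT empirical_mean.
Proof. by apply: measurable_funM => //; exact: measurable_sum. Qed.

Let N0 : 0 < N%:R :> R. Proof. by rewrite ltr0n. Qed.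

Lemma empirical_mean_bound w : `|empirical_mean w| <= D.
Proof.
rewrite normrM ger0_norm ?invr_ge0 ?ler0n// ler_pdivrMl//.
apply: le_trans (ler_norm_sum _ _ _) _.
apply: le_trans (ler_sum _ (fun j _ => ZD j w)) _.
by rewrite sumr_const card_ord mulr_natl.
Qed.

Lemma expectation_empirical_mean : \int[P]_w empirical_mean w = 0.
Proof.
have iZ j := @bounded_integrable _ _ _ P _ _ (mZ j) (ZD j).
have iS : P.-integrable setT (EFin \o (fun w => \sum_(j < N) Z j w)).
  apply: (@bounded_integrable _ _ _ P _ (N%:R * D)); first exact: measurable_sum.
  move=> w; apply: le_trans (ler_norm_sum _ _ _) _.
  apply: le_trans (ler_sum _ (fun j _ => ZD j w)) _.
  by rewrite sumr_const card_ord mulr_natl.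
rewrite RintegralZl// /Rintegral; under eq_integral do rewrite -sumEFin.
rewrite integral_sum//.
rewrite [X in fine X]big1 ?mulr0// => j _.
by rewrite -[LHS]fineK ?[fine _]Z0//; exact: (integrable_fin_num _ (iZ j)).
Qed.

Lemma mgf_empirical_mean (s : R) :
  (forall t, \int[P]_w \prod_(j < N) expR (t * Z j w) =
             \prod_(j < N) \int[P]_w expR (t * Z j w)) ->
  \int[P]_w expR (s * empirical_mean w) <= expR (2 * D ^+ 2 / N%:R * s ^+ 2).
Proof.
move=> ZP.
under eq_Rintegral do rewrite /empirical_mean mulrA mulr_sumr expR_sum.
rewrite ZP.
apply: (@le_trans _ _ (\prod_(j < N) expR (2 * (s / N%:R) ^+ 2 * D ^+ 2))).
  apply: ler_prod => j _; rewrite (mgf_centered _ (mZ j) (ZD j) (Z0 j)) andbT.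
  by apply: Rintegral_ge0 => w _; exact: expR_ge0.
rewrite prodr_const card_ord -expRM_natl ler_expR le_eqVlt; apply/orP; left; apply/eqP.
by field; rewrite gt_eqF.
Qed.

End empirical_mean.

(** * Bias and fluctuation of the algorithm *)

Section velocity_restriction.
Context {R : realType} (n : nat).
Local Notation V := 'rV[R]_n.
Local Notation lambda := (lebesgue_row R n).
Variable Omega : set V.
Hypothesis mO : measurable Omega.
Let mD : measurable ([set: V] `*` Omega).
Proof. exact: measurableX. Qed.

(** The data are measurable only over [Omega]; the extension by zero is measurable on the whole
    phase space. *)
Definition velocity_restrict (u : V -> V -> R) : V * V -> measurableTypeR R :=
  (fun z => u z.1 z.2) \_ ([set: V] `*` Omega).

Lemma velocity_restrictE (u : V -> V -> R) x v : Omega v ->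
  velocity_restrict u (x, v) = u x v.
Proof. by move=> Ov; rewrite /velocity_restrict patchE mem_set. Qed.

Lemma measurable_rte_solution (T : R) (sigma : V -> R) (fin : V -> V -> R)
    (f : R -> V -> V -> R) (s : R) :
  rte_solution T Omega sigma fin f -> 0 <= s <= T ->
  measurable_fun setT (velocity_restrict (f s)).
Proof.
move=> sol /andP[s0 sT]; apply/(measurable_restrictT _ mD).
pose E : set (measurableTypeR R * V * V) :=
  [set z | [/\ 0 <= z.1.1, z.1.1 <= T & Omega z.2]].
have mE : measurable E.
  rewrite (_ : E = ([set` `[0, T]] `*` [set: V]) `*` Omega).
    by apply: measurableX => //; exact: measurableX.
  apply/seteqP; split=> [[[t x] v]/= [t0 tT Ov]|[[t x] v]/= [[+ _] Ov]].
    by rewrite in_itv/= t0 tT.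
  by rewrite in_itv/= => /andP[].
apply: (measurable_comp mE _ (rte_measurable sol)
  (g := fun z : V * V => ((s : measurableTypeR R, z.1), z.2))).
  by move=> _ [z [_ Oz] <-].
apply: measurable_funTS; apply: measurable_fun_pair => //.
by apply: measurable_fun_pair.
Qed.

Lemma initial_expectation (T : R) (sigma : V -> R) (fin : V -> V -> R)
    (f : R -> V -> V -> R) d (W : measurableType d) (P : probability W R)
    (X : W -> V * V) (h : V * V -> R) (c : R) :
  0 <= T -> rte_solution T Omega sigma fin f ->
  probability_density Omega fin ->
  measurable_fun ([set: V] `*` Omega) (fun z => fin z.1 z.2 : measurableTypeR R) ->
  measurable_fun setT X ->
  (forall A, measurable A -> P (X @^-1` A) =
     \int[(lambda \x lambda)]_(z in A `&` ([set: V] `*` Omega)) (fin z.1 z.2)%:E)%E ->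
  measurable_fun setT h -> (forall z, `|h z| <= c) ->
  \int[P]_w h (X w) =
  \int[(lambda \x lambda)%E]_(z in [set: V] `*` Omega) (velocity_restrict (f 0) z * h z).
Proof.
move=> T0 sol [fin0 _] mfin mX lawX mh hc.
have mk : measurable_fun setT (velocity_restrict fin).
  by apply/(measurable_restrictT _ mD).
have k0 z : 0 <= velocity_restrict fin z.
  rewrite /velocity_restrict patchE; case: ifPn => // /set_mem[_ Oz].
  exact: fin0.
rewrite (expectation_density (mu := (lambda \x lambda)%E) mX mk k0 _ mh hc); last first.
  move=> A mA; rewrite lawX// integral_mkcondr; apply: eq_integral => z _.
  by rewrite /velocity_restrict !patchE; case: ifPn.
rewrite [RHS]Rintegral_mkcond; congr fine.
apply: ae_eq_integral => //.
- by apply/measurable_EFinP; exact: measurable_funM.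
- apply/measurable_EFinP/(measurable_restrictT _ mD)/measurable_funTS.
  apply: measurable_funM => //; apply: (measurable_rte_solution sol).
  by rewrite lexx.
- move: (rte_initial sol); apply: filterS => z Hz _ /=.
  rewrite !patchE /velocity_restrict; case: ifPn => [Dz|nDz].
    by have [_ Oz] := set_mem Dz; rewrite patchE Dz [in RHS]patchE Dz Hz// mulrC.
  by rewrite patchE (negbTE nDz) mulr0.
Qed.

End velocity_restriction.

Section weak_bias.
Context {R : realType} (n : nat).
Local Notation V := 'rV[R]_n.
Local Notation lambda := (lebesgue_row R n).
Variables (Omega : set V) (sigma : V -> R) (fin : V -> V -> R) (Tf : R)
  (f : R -> V -> V -> R).
Hypothesis hOmega : velocity_domain Omega.
Hypothesis sigma_ge0 : forall x, 0 <= sigma x.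
Hypothesis sigma_cont : continuous sigma.
Hypothesis sigma_W1 : W_infty 1 sigma.
Hypothesis fin_density : probability_density Omega fin.
Hypothesis fin_meas :
  measurable_fun ([set: V] `*` Omega) (fun z => fin z.1 z.2 : measurableTypeR R).
Hypothesis Tf_gt0 : 0 < Tf.
Hypothesis f_sol : rte_solution Tf Omega sigma fin f.

(** The bias estimate in the form used at the end: [C] is fixed before [M], [N] and the probability
    space, and all particles share one mean [a]. *)
Lemma trajectory_weak_error (phi : V * V -> R) (B L rho : R) :
  0 <= B -> 0 <= L -> measurable_fun setT (phi : V * V -> measurableTypeR R) ->
  (forall z, `|phi z| <= B) -> (forall z, rho < `|z.1| -> phi z = 0) ->
  (forall x y v, `|phi (x, v) - phi (y, v)| <= L * `|x - y|) ->
  exists2 C, 0 <= C & forall (M N : nat), (0 < M)%N ->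
  forall (d : measure_display) (T : measurableType d) (P : probability T R)
    (z0 : 'I_N -> T -> V * V) (p : 'I_N -> nat -> T -> R) (eta : 'I_N -> nat -> T -> V),
  monte_carlo_draws P M z0 p eta Omega fin ->
  exists2 a : R, (forall j, \int[P]_w phi (trajectory sigma (Tf / M%:R) z0 p eta j M w) = a) &
    `|a - \int[lambda]_x \int[lambda]_(v in Omega) (f Tf x v * phi (x, v))| <= C * (Tf / M%:R).
Proof.
move=> B0 L0 mphi phiB phi0 phiL; have [oO bO /andP[Ogt Olt]] := hOmega.
have mO : measurable Omega by exact: open_row_measurable.
have [K [_ hK]] := bO; pose vmax := `|K| + 1.
have vmax0 : 0 <= vmax by rewrite addr_ge0.
have Ov v : Omega v -> `|v| <= vmax.
  by apply: hK; rewrite (le_lt_trans (ler_norm K))// ltrDl.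
have [S S0 sS] := continuous_Linfty_bounded sigma_cont sigma_W1.
have [Ls Ls0 sL] := continuous_W1infty_lipschitz sigma_cont sigma_W1.
have sle x : sigma x <= S by apply: le_trans (sS x); exact: ler_norm.
have msigma : measurable_fun setT (sigma : V -> measurableTypeR R).
  exact: continuous_row_measurable.
have [b0 fb] := rte_bounded f_sol.
pose F s := velocity_restrict Omega (f s).
have FE s x v : Omega v -> F s (x, v) = f s x v by exact: velocity_restrictE.
have mF (s : R) : 0 <= s <= Tf -> measurable_fun setT (F s).
  by move=> sT; exact: (measurable_rte_solution mO f_sol sT).
have Fb (s : R) (z : V * V) : 0 <= s <= Tf -> Omega z.2 -> `|F s z| <= `|b0|.
  by case: z => x v sT /= Oz; rewrite FE//; apply: le_trans (fb _ _ _ sT Oz) (ler_norm _).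
have Fc (y v : V) : Omega v -> {within `[0, Tf], continuous (fun s => F s (y + s *: v, v))}.
  move=> Oz; rewrite (_ : (fun s => _) = (fun s => f s (y + s *: v) v)).
    exact: (rte_continuous f_sol).
  by apply/funext => s; rewrite FE.
have Fe (s : R) (y v : V) : 0 < s < Tf -> Omega v ->
    is_derive s 1 (fun s => F s (y + s *: v, v))
      (sigma (y + s *: v) *
       (vmean Omega (fun w => F s (y + s *: v, w)) - F s (y + s *: v, v))).
  move=> sT Oz; have := rte_equation f_sol (y + s *: v) sT Oz.
  (* The point is put on the space-time line through [(0, y)] with direction [(1, v)], so that
     [is_derive_line] yields the ordinary derivative along the characteristic. *)
  rewrite (_ : ((s : R^o), y + s *: v) = s *: ((1 : R^o), v) + ((0 : R^o), y)); last first.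
    by congr pair => /=; [rewrite /GRing.scale/= mulr1 addr0|rewrite addrC].
  move=> /is_derive_line; rewrite /collision FE// /vmean.
  rewrite (_ : (fun t : R => _) = (fun s0 => F s0 (y + s0 *: v, v))); last first.
    apply/funext => t; rewrite FE//=; congr (f _ _ _); last by rewrite addrC.
    by rewrite /GRing.scale/= mulr1 addr0.
  rewrite (_ : \int[lambda]_(w in Omega) f s (y + s *: v) w =
    \int[lambda]_(w in Omega) F s (y + s *: v, w))//.
  by apply: eq_Rintegral => w /set_mem Ow; rewrite FE.
have xphi : xsupported Omega phi B rho by split=> // z _; exact: phi0.
have lphi : xlipschitz Omega phi L by move=> x y v _; exact: phiL.
have [C C0 HC] := weak_error mO Ogt Olt vmax0 Ov msigma sigma_ge0 sle Ls0 sL Tf_gt0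
  (normr_ge0 b0) mF Fb Fc Fe B0 L0 xphi lphi.
exists C => // M N M0 d T P z0 p eta draws.
pose dt := Tf / M%:R.
have dt0 : 0 <= dt by rewrite divr_ge0 ?ler0n// ltW.
have itB k : measurable_fun setT (iter k (mc_step Omega sigma dt) phi) /\
    forall z, `|iter k (mc_step Omega sigma dt) phi z| <= B.
  elim: k => [|k [IHm IHb]] //=; split; first exact: (measurable_mc_step mO msigma).
  by apply: mc_step_bound.
have xFT : xsupported Omega (fun z => F Tf z * phi z) (`|b0| * B) rho.
  have TT : 0 <= Tf <= Tf by rewrite lexx ltW.
  by apply: xsupportedM xphi => [|z]; [exact: mF|exact: Fb].
exists (\int[(lambda \x lambda)%E]_(z in [set: V] `*` Omega)
   (F 0 z * iter M (mc_step Omega sigma dt) phi z)) => [j|].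
  rewrite (expectation_trajectory mO Ogt Olt msigma sigma_ge0 dt0 draws j (leqnn M) mphi phiB).
  apply: (initial_expectation mO (ltW Tf_gt0) f_sol fin_density fin_meas _ _
    (itB M).1 (itB M).2).
    exact: (draws_measurable_init draws).
  exact: (draws_init draws).
rewrite distrC; apply: le_trans (HC M M0); rewrite le_eqVlt; apply/orP; left; apply/eqP.
congr (`|_ - _|); rewrite [RHS](Rintegral_iterated mO Olt xFT).
apply: eq_Rintegral => x _; apply: eq_Rintegral => v /set_mem Oz.
by rewrite FE.
Qed.

End weak_bias.

Section error_bounds.
Context {R : realType} d (T : measurableType d) (P : probability T R) (S : T -> R) (c v r : R).
Hypothesis mS : measurable_fun setT S.
Hypothesis Sc : forall w, `|S w| <= c.
Let e w := S w + r.

Let me_ : measurable_fun setT e. Proof. exact: measurable_funD. Qed.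

Let ec w : `|e w| <= c + `|r|.
Proof. by apply: le_trans (ler_normD _ _) _; rewrite lerD2r. Qed.

Lemma expectation_shifted : \int[P]_w S w = 0 -> ('E_P[e] = r%:E)%E.
Proof.
move=> S0; rewrite unlock -[LHS]fineK; last first.
  exact: (integrable_fin_num _ (@bounded_integrable _ _ _ P _ _ me_ ec)).
congr (_%:E); rewrite [LHS]RintegralD//; first by rewrite [X in X + _]S0 add0r Rintegral_probability_cst.
- exact: (@bounded_integrable _ _ _ P _ _ mS Sc).
- by apply: (@bounded_integrable _ _ _ P _ `|r|).
Qed.

Lemma expectation_norm_shifted :
  ('E_P[fun w => `|e w|%R] <= (\int[P]_w `|S w| + `|r|)%:E)%E.
Proof.
have mn : measurable_fun setT (fun w => `|e w|) by exact: measurableT_comp.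
have mnS : measurable_fun setT (fun w => `|S w|) by exact: measurableT_comp.
have ie : P.-integrable setT (EFin \o (fun w => `|e w|)).
  by apply: (@bounded_integrable _ _ _ P _ _ mn) => w; rewrite normr_id; exact: ec.
have iS : P.-integrable setT (EFin \o (fun w => `|S w|)).
  by apply: (@bounded_integrable _ _ _ P _ _ mnS) => w; rewrite normr_id; exact: Sc.
have ir : P.-integrable setT (EFin \o (fun=> `|r|)).
  by apply: (@bounded_integrable _ _ _ P _ `|r|) => // w; rewrite normr_id.
rewrite unlock -[leLHS]fineK; last exact: (integrable_fin_num _ ie).
rewrite lee_fin -[X in _ + X](Rintegral_probability_cst P) -RintegralD//.
apply: le_Rintegral => //; first exact: (integrableD measurableT iS ir).
by move=> w _; exact: ler_normD.
Qed.

Lemma tail_shifted (eps s : R) : `|r| <= s ->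
  (P [set w | (eps + s <= `|e w|)%R] <= P [set w | (eps <= `|S w|)%R])%E.
Proof.
move=> rs; apply: le_measure; rewrite ?inE.
- rewrite -[X in measurable X]setTI; apply: measurable_fun_le => //.
  exact: measurableT_comp.
- rewrite -[X in measurable X]setTI; apply: measurable_fun_le => //.
  exact: measurableT_comp.
- move=> w /=; have := ler_normD (S w) r; rewrite -/(e w); lra.
Qed.

End error_bounds.

(* The constant C is chosen before M, N and the random draws, and also stands *)
(* for the hidden constants multiplying dt and 1 / (N * eps ^ 2) in the tail. *)
(* The sampling error of order N^(-1/2) in E|e| does not vanish with dt.      *)
Theorem theorem2p1 (R : realType) (n : nat) (hn : (0 < n)%N)
  (Omega : set 'rV[R]_n) (hOmega : velocity_domain Omega)
  (sigma : 'rV[R]_n -> R) (sigma_ge0 : forall x, 0 <= sigma x)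
  (sigma_cont : continuous sigma) (sigma_W1 : W_infty 1 sigma)
  (fin : 'rV[R]_n -> 'rV[R]_n -> R) (fin_density : probability_density Omega fin)
  (fin_W2 : W_infty_Linfty 2 Omega fin)
  (Tf : R) (Tf_gt0 : 0 < Tf)
  (f : R -> 'rV[R]_n -> 'rV[R]_n -> R)
  (f_sol : rte_solution Tf Omega sigma fin f)
  (phi : 'rV[R]_n * 'rV[R]_n -> R)
  (hphi : test_function ([set: 'rV[R]_n] `*` Omega) phi) :
  exists2 C : R, 0 < C &
  forall (M N : nat), (0 < M)%N -> (0 < N)%N ->
  forall (d : measure_display) (T : measurableType d) (P : probability T R)
    (z0 : 'I_N -> T -> 'rV[R]_n * 'rV[R]_n) (p : 'I_N -> nat -> T -> R)
    (eta : 'I_N -> nat -> T -> 'rV[R]_n),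
  monte_carlo_draws P M z0 p eta Omega fin ->
  let dt := Tf / M%:R in
  let e := monte_carlo_error M z0 p eta Tf Omega sigma f phi in
  [/\ (`| 'E_P[e] | <= (C * dt)%:E)%E,
      ('E_P[fun w => `|e w|%R] <= (C * (dt + (Num.sqrt N%:R)^-1))%:E)%E &
      forall eps : R, 0 < eps ->
        (P [set w | (eps + C * dt <= `|e w|)%R] <=
         (C * expR (- (N%:R * eps ^+ 2 / C)))%:E)%E].
Proof.
have [B [L [rho [[B0 L0] mphi phiB phi0 phiL]]]] := test_function_bounds hphi.
have [C1 C10 HC] := trajectory_weak_error hOmega sigma_ge0 sigma_cont sigma_W1
  fin_density fin_W2.1.1 Tf_gt0 f_sol B0 L0 mphi phiB phi0 phiL.
(* [2 * B] bounds [phi - a]; the extra 1 keeps [D] positive when [phi] vanishes. *)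
pose D := 2 * B + 1; have D0 : 0 < D by rewrite /D; lra.
have D20 : 0 < D ^+ 2 by rewrite exprn_gt0.
pose E := expR (2 * D ^+ 2); have E0 : 0 < E by exact: expR_gt0.
(* One summand per use: [C1] for the bias, [2 * E] for the mean deviation, [8 * D^2] for the
   denominator in the exponent, and 2 for the two-sided tail. *)
pose C := C1 + 2 * E + 8 * D ^+ 2 + 2; have C0 : 0 < C by rewrite /C; lra.
exists C => // M N M0 N0 d T P z0 p eta draws dt e.
have [a Ea ab] := HC M N M0 d T P z0 p eta draws.
set b := \int[lebesgue_row R n]_x _ in ab.
have msigma : measurable_fun setT (sigma : 'rV[R]_n -> measurableTypeR R).
  exact: continuous_row_measurable.
have dt0 : 0 <= dt by rewrite divr_ge0 ?ler0n// ltW.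
have N0' : 0 < N%:R :> R by rewrite ltr0n.
have mY j := measurable_trajectory msigma dt draws j (leqnn M).
have mphiY j : measurable_fun setT (phi \o trajectory sigma dt z0 p eta j M).
  exact: measurableT_comp.
have aB : `|a| <= B.
  rewrite -(Ea (Ordinal N0)).
  apply: (le_trans (le_normr_Rintegral measurableT _)).
    exact: (@bounded_integrable _ _ _ P _ _ (mphiY _) (fun w => phiB _)).
  rewrite -[leRHS](Rintegral_probability_cst P); apply: le_Rintegral => //.
  - apply: (@bounded_integrable _ _ _ P _ B) => [|w]; last by rewrite normr_id; exact: phiB.
    exact: (measurableT_comp _ (mphiY _)).
  - by apply: (@bounded_integrable _ _ _ P _ `|B|).
pose Z j w := phi (trajectory sigma dt z0 p eta j M w) - a.
have phiD z : `|phi z - a| <= D.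
  by apply: le_trans (ler_normB _ _) _; have := phiB z; rewrite /D; lra.
have mZ j : measurable_fun setT (Z j).
  apply: (@measurable_funB _ _ _ setT (phi \o _) (cst a)); [exact: mphiY|exact: measurable_cst].
have ZD j w : `|Z j w| <= D by exact: phiD.
have Z0 j : \int[P]_w Z j w = 0.
  rewrite RintegralB//; first by rewrite Ea Rintegral_probability_cst subrr.
  - exact: (@bounded_integrable _ _ _ P _ _ (mphiY _) (fun w => phiB _)).
  - by apply: (@bounded_integrable _ _ _ P _ `|a|).
have ZP t : \int[P]_w \prod_(j < N) expR (t * Z j w) =
    \prod_(j < N) \int[P]_w expR (t * Z j w).
  apply: (expectation_trajectory_prod msigma dt draws (leqnn M)
    (psi := fun z => expR (t * (phi z - a))) (c := expR (`|t| * D))) => [||z].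
  - exact: expR_ge0.
  - by apply: measurableT_comp => //; apply: measurable_funM => //; exact: measurable_funB.
  - rewrite ger0_norm ?expR_ge0// ler_expR (le_trans (ler_norm _))// normrM.
    by rewrite ler_wpM2l.
pose S := empirical_mean Z.
have mS : measurable_fun setT S by exact: measurable_empirical_mean.
have SD w : `|S w| <= D by exact: empirical_mean_bound.
have S0 : \int[P]_w S w = 0 by exact: expectation_empirical_mean.
have mgfS s := mgf_empirical_mean N0 mZ ZD Z0 s ZP.
have v0 : 0 < 2 * D ^+ 2 / N%:R by rewrite divr_gt0// mulr_gt0.
(* The error is the centered fluctuation [S] plus the deterministic bias [a - b]. *)
have eE : e = fun w => S w + (a - b).
  apply/funext => w; rewrite /S /empirical_mean /Z big_split/= sumr_const card_ord.
  rewrite -mulr_natl /e /monte_carlo_error -/b /trajectory -/dt.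
  by field; rewrite gt_eqF.
have C1C : C1 * dt <= C * dt by rewrite ler_wpM2r// /C; lra.
rewrite eE; split.
- rewrite (expectation_shifted _ mS SD)// abse_EFin lee_fin.
  exact: le_trans ab C1C.
- apply: (le_trans (expectation_norm_shifted _ _ mS SD)); rewrite lee_fin mulrDr addrC.
  apply: lerD; first exact: le_trans ab C1C.
  (* At [t = sqrt N] the exponent [(2 * D^2 / N) * t^2] is the constant [2 * D^2], whence [E]. *)
  have sN : 0 < Num.sqrt N%:R :> R by rewrite sqrtr_gt0.
  apply: le_trans (subgaussian_mean mS SD mgfS sN) _.
  rewrite sqr_sqrtr ?ler0n// mulfVK ?gt_eqF// -/E ler_wpM2r ?invr_ge0 ?(ltW sN)// /C; lra.
- move=> eps eps0; apply: (le_trans (tail_shifted P mS eps (le_trans ab C1C))).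
  apply: (le_trans (subgaussian_tail mS SD v0 mgfS eps0)); rewrite lee_fin.
  apply: ler_pM; rewrite ?expR_ge0//; first by rewrite /C; lra.
  rewrite ler_expR lerN2.
  rewrite (_ : _ / (4 * _) = N%:R * eps ^+ 2 / (8 * D ^+ 2)); last first.
    by field; rewrite !gt_eqF.
  rewrite ler_wpM2l//.
    by rewrite mulr_ge0 ?sqr_ge0// ltW.
  by rewrite lef_pV2// ?posrE ?mulr_gt0// /C; lra.
Qed.
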